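(* Let $r=\{r_{ij}\}_{0\le i\le j\le n}$ be rank conditions which can occur, and suppose that the rectangle $R_{ij}$ is empty whenever $j-i>2$. Then $$P_r=\sum(-1)^{|\mu|-d(r)}\,G_{\mu_1}\otimes\cdots\otimes G_{\mu_n},$$ where $|\mu|=\sum_i|\mu_i|$ and the sum is over all partitions $\mu_i=(R_{i-1,i}+\sigma_i,\ \tau_{i-1})$, $1\le i\le n$, such that for all $1\le i\le n-1$ one has $\sigma_i\cup\hat\tau_i=R_{i-1,i+1}$ and $\sigma_i\cap\hat\tau_i$ is a rook strip (with $\tau_0=\sigma_n=\emptyset$).
   Context: **Rank conditions and rectangles.** Non-negative integers $r_{ij}$, $0\le i\le j\le n$, $n\ge1$, ''can occur'' if there are vector spaces and linear maps $V_0\to\cdots\to V_n$ with $\dim V_i=r_{ii}$ and $\operatorname{rank}(V_i\to V_j)=r_{ij}$ for $i<j$. Put $d(r)=\sum_{i<j}(r_{i,j-1}-r_{ij})(r_{i+1,j}-r_{ij})$. For $i<j$, $R_{ij}$ is the rectangle with $r_{i+1,j}-r_{ij}$ rows and $r_{i,j-1}-r_{ij}$ columns, identified with the partition whose Young diagram it is; it is empty if it has no rows or no columns. **Notation in the sum.** $\sigma_i$ and $\tau_i$ are partitions whose Young diagrams are contained in $R_{i-1,i+1}$; $\hat\tau_i$ is the Young diagram of $\tau_i$ rotated by 180 degrees and placed in the bottom-right corner of $R_{i-1,i+1}$. A rook strip is a skew diagram with at most one box in any row or column. If $R_{i-1,i}$ has $m_i$ rows and $a_i$ columns then $(R_{i-1,i}+\sigma_i,\tau_{i-1})=(a_i+\sigma_{i,1},\dots,a_i+\sigma_{i,m_i},\tau_{i-1,1},\tau_{i-1,2},\dots)$.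 **Stable Grothendieck polynomials.** For $w\in S_n$ the double Grothendieck polynomial $\mathfrak G_w(x;y)$ is defined by $\mathfrak G_{w_0}=\prod_{i+j\le n}(x_i+y_j-x_iy_j)$ for the longest permutation $w_0=n\,(n-1)\cdots1$, and $\mathfrak G_w=\pi_i(\mathfrak G_{ws_i})$ whenever $s_i=(i,i+1)\in S_n$ and $\ell(ws_i)=\ell(w)+1$, where $\pi_i(f)=\frac{(1-x_{i+1})f(x_1,x_2,\dots)-(1-x_i)f(\dots,x_{i+1},x_i,\dots)}{x_i-x_{i+1}}$; this is independent of choices and of $n$. Let $1^m\times w\in S_{m+n}$ be the identity on $\{1,\dots,m\}$ and $j\mapsto w(j-m)+m$ for $j>m$; put $G_w(x;y)=\lim_{m\to\infty}\mathfrak G_{1^m\times w}\in\mathbb Z[[x_i,y_i]]_{i\ge1}$ (coefficientwise stable limit). For a partition $\lambda$ and $p\ge\ell(\lambda)$ let $w_\lambda$ be the permutation with $w_\lambda(i)=i+\lambda_{p+1-i}$ for $1\le i\le p$ and $w_\lambda(i)<w_\lambda(i+1)$ for $i\ne p$; put $G_\lambda=G_{w_\lambda}$ (independent of $p$). The $G_\lambda$ form a $\mathbb Z$-basis of a subring $\Gamma\subset\mathbb Z[[x_i,y_i]]$. The integers $d^\nu_{\lambda\mu}$ are the coefficients with $G_\nu(x,x';y,y')=\sum_{\lambda,\mu}d^\nu_{\lambda\mu}G_\lambda(x;y)G_\mu(x';y')$ for disjoint sets of variables. **Sequences of integers.** For $i\ge0$, $k\in\mathbb Z$ let $h_k(x_1,\dots,x_N/1^i)$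 be the coefficient of $t^k$ in $(1-t)^i/\prod_{j=1}^N(1-x_jt)$. For a finite integer sequence $I=(I_1,\dots,I_\ell)$ (with $I_j=0$ for $j>\ell$) and $N\ge\ell$ put $\mathcal G_I(x_1,\dots,x_N)=\det\big(h_{I_i+j-1}(x_1,\dots,x_N/1^{i-1})\big)_{1\le i,j\le N}$. For $N\ge\ell$ with $N\ge i-I_i$ for $1\le i\le\ell$ there is a unique finite expansion $\mathcal G_I=\sum_\lambda\delta_{I,\lambda}\mathcal G_\lambda$ over partitions $\lambda$ of length $\le N$, with $\delta_{I,\lambda}\in\mathbb{Z}$ independent of $N$. Put $G_I=\sum_\lambda\delta_{I,\lambda}G_\lambda\in\Gamma$. **Definition of $P_r\in\Gamma^{\otimes n}$**, by induction on $n$. If $n=1$, $P_r=G_{R_{01}}$. If $n\ge2$, let $\bar r_{ij}=r_{i,j+1}$ for $0\le i\le j\le n-1$, and write $P_{\bar r}=\sum_\mu c_\mu(\bar r)\,G_{\mu_1}\otimes\cdots\otimes G_{\mu_{n-1}}$. Then $P_r$ is obtained from $P_{\bar r}$ by replacing each $G_{\mu_1}\otimes\cdots\otimes G_{\mu_{n-1}}$ by $\sum\big(\prod_{i=1}^{n-1}d^{\mu_i}_{\sigma_i\tau_i}\big)G_{I_1}\otimes\cdots\otimes G_{I_n}$, the sum over all partitions $\sigma_1,\dots,\sigma_{n-1},\tau_1,\dots,\tau_{n-1}$ such that $\sigma_i$ has at most as many rows as $R_{i-1,i}$, where $I_i=(a_i+\sigma_{i,1},\dots,a_i+\sigma_{i,m_i},\tau_{i-1,1},\tau_{i-1,2},\dots)$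 with $m_i,a_i$ the numbers of rows and columns of $R_{i-1,i}$ and $\tau_0=\sigma_n=\emptyset$. *)

(* Defs.v *)
From HB Require Import structures.
From mathcomp Require Import all_boot all_order all_fingroup all_algebra.
From mathcomp Require Import finmap.
From mathcomp Require Import boolp classical_sets functions cardinality fsbigop.
From mathcomp Require Import freeg mpoly.

Set Implicit Arguments.
Unset Strict Implicit.
Unset Printing Implicit Defensive.

Import Order.TTheory GRing.Theory Num.Theory.

Local Open Scope classical_set_scope.
Local Open Scope ring_scope.

(* A mathematical object characterized by a property is rendered below by
   [xget d A]: an element of [A], or the default [d] if [A] is empty.  In each
   use the element of [A] exists and is unique.
   Rows, columns, variables and tensor factors are numbered from 0. *)

(** Partitions *)

Definition is_part (s : seq nat) : bool := sorted geq s && all (ltn 0) s.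

Record part := Part { part_seq :> seq nat; _ : is_part part_seq }.

HB.instance Definition _ := [isSub for part_seq].
HB.instance Definition _ := [Countable of part by <:].

Definition part0 : part := @Part [::] isT.

Lemma rect_is_part m a : is_part (nseq (if a == 0%N then 0%N else m) a).
Proof.
rewrite /is_part; case: eqP => // /eqP; rewrite -lt0n => a_gt0.
apply/andP; split; last by rewrite all_nseq /= a_gt0 orbT.
by case: m => //= m; elim: m => //= m ->; rewrite leqnn.
Qed.

Definition rect m a : part := Part (rect_is_part m a).

Definition diagram (l : part) : set (nat * nat) :=
  [set b | (b.2 < nth 0%N l b.1)%N].

Definition rect_diagram (m a : nat) : set (nat * nat) :=
  [set b | (b.1 < m)%N /\ (b.2 < a)%N].

Definition rotated (m a : nat) (l : part) : set (nat * nat) :=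
  [set b | rect_diagram m a b /\ diagram l ((m - b.1).-1, (a - b.2).-1)%N].

Definition skew_diagram (S : set (nat * nat)) : Prop :=
  exists la mu : part, diagram mu `<=` diagram la /\ S = diagram la `\` diagram mu.

Definition rook_strip (S : set (nat * nat)) : Prop :=
  skew_diagram S /\
  forall b c, S b -> S c -> b.1 = c.1 \/ b.2 = c.2 -> b = c.

(** Double Grothendieck polynomials, in Z[y][x] *)

Section Grothendieck.
Variable n : nat.
Local Notation pol := {mpoly {mpoly int[n]}[n]}.

Definition perm_len (w : 'S_n) : nat :=
  #|[set p : 'I_n * 'I_n | (p.1 < p.2)%N && (w p.2 < w p.1)%N]|.

Definition perm_w0 : 'S_n := perm (@rev_ord_inj n).

Definition groth_w0 : pol :=
  \prod_(i < n) \prod_(j < n | (i.+1 + j.+1 <= n)%N)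
    ('X_i + ('X_j)%:MP - 'X_i * ('X_j)%:MP).

(* [msym] acts on the outer variables x only. *)
Definition isobaric (i j : 'I_n) (f : pol) : pol :=
  xget 0 [set g : pol |
    ('X_i - 'X_j) * g = (1 - 'X_j) * f - (1 - 'X_i) * msym (tperm i j) f].

(* In {perm T}, (s * t) x = t (s x), so w s_i is written s_i * w.
   The result does not depend on the ascent chosen; [pick] takes the first one.
   The recursion depth is the colength of w, which is less than [fuel]. *)
Fixpoint groth_rec (fuel : nat) (w : 'S_n) : pol :=
  if fuel is k.+1 then
    if w == perm_w0 then groth_w0
    else if [pick p : 'I_n * 'I_n | (p.2 == p.1.+1 :> nat) &&
               (perm_len (tperm p.1 p.2 * w)%g == (perm_len w).+1)] is Some p
    then isobaric p.1 p.2 (groth_rec k (tperm p.1 p.2 * w)%g)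
    else 0
  else 0.

Definition groth (w : 'S_n) : pol := groth_rec (n * n).+1 w.

End Grothendieck.

(** Stable Grothendieck polynomials *)

(* The exponents of x^a = x_0^(a 0) x_1^(a 1) ... *)
Definition monom := {fsfun nat -> nat with 0%N}.

(* Elements of Z[[x_i, y_i]]: the coefficient of x^a y^b is [f a b]. *)
Definition series := monom -> monom -> int.

Definition monom_lt (N : nat) (a : monom) : Prop :=
  forall i, a i <> 0%N -> (i < N)%N.

Definition poly_series N (f : {mpoly {mpoly int[N]}[N]}) : series := fun a b =>
  if `[< monom_lt N a /\ monom_lt N b >]
  then (f@_[multinom a i | i < N])@_[multinom b i | i < N] else 0.

Fixpoint one_times (m n : nat) (w : 'S_n) : 'S_(m + n) :=
  match m with
  | 0%N => w
  | m'.+1 => lift_perm ord0 ord0 (one_times m' w)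
  end.

Definition stable_groth n (w : 'S_n) : series := fun a b =>
  xget 0 [set v : int | exists M : nat, forall m : nat, (M <= m)%N ->
            poly_series (groth (one_times m w)) a b = v].

(* p is the length of l and the permutation lies in S_(p + l_1). *)
Definition perm_part (l : part) : 'S_(size l + head 0%N l) :=
  xget 1%g [set w : 'S_(size l + head 0%N l) |
    (forall i : 'I_(size l + head 0%N l), (i < size l)%N ->
       w i = (i + nth 0%N l (size l - i.+1))%N :> nat) /\
    (forall i j : 'I_(size l + head 0%N l), j = i.+1 :> nat -> i.+1 <> size l ->
       (w i < w j)%N)].

Definition G_part (l : part) : series := stable_groth (perm_part l).

(* The group Gamma, given by its Z-basis: [<< l >>] stands for G_l. *)
Definition Gamma := {freeg part}.

(* Exponents of x^a x'^a' after identifying (x, x') with a single sequence of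
   variables by x_i -> x_(2i), x'_i -> x_(2i+1).  The series G_l are symmetric in
   x and in y, so any other identification gives the same G_l(x, x'; y, y'). *)
Definition interleave (a a' : monom) : monom :=
  [fsfun k in ([fset i.*2 | i in finsupp a] `|`
               [fset i.*2.+1 | i in finsupp a'])%fset =>
    if odd k then a' k./2 else a k./2].

(* The d^nu_(lambda, mu), as an element of the free group on pairs
   (lambda, mu).  As the two sets of variables are disjoint, a coefficient of
   G_lambda(x; y) G_mu(x'; y') is a product of two coefficients. *)
Definition coprod (nu : part) : {freeg (part * part)%type} :=
  xget 0 [set d : {freeg (part * part)%type} | forall a a' b b' : monom,
    G_part nu (interleave a a') (interleave b b') =
    \sum_(lm <- dom d) coeff lm d * (G_part lm.1 a b * G_part lm.2 a' b')].

(** The elements G_I for sequences of integers *)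

(* Truncating 1 / (1 - x_j t) = \sum_a x_j^a t^a after t^k does not change the
   coefficient of t^k. *)
Definition hcomp (N i : nat) (k : int) : {mpoly int[N]} :=
  match k with
  | Posz k => ((1 - 'X) ^+ i * \prod_(j < N) \poly_(a < k.+1) ('X_j ^+ a))`_k
  | Negz _ => 0
  end.

Definition calG (N : nat) (s : seq int) : {mpoly int[N]} :=
  \det (\matrix_(i < N, j < N) hcomp N i (nth 0 s i + j%:Z)).

Definition calG_part (N : nat) (l : part) : {mpoly int[N]} :=
  calG N [seq k%:Z | k <- l].

Definition G_seq (s : seq int) : Gamma :=
  xget 0 [set c : {freeg part} | forall N : nat, (size s <= N)%N ->
    (forall i, (i < size s)%N -> i.+1%:Z - nth 0 s i <= N%:Z) ->
    (forall l, l \in dom c -> (size l <= N)%N) /\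
    calG N s = \sum_(l <- dom c) coeff l c *: calG_part N l].

(** Tensor powers of Gamma, given by the basis of the
    G_(mu_0) (x) ... (x) G_(mu_(n-1)) *)

Definition Gamma_tensor (n : nat) := {freeg (n.-tuple part)}.

Definition tensor n (g : 'I_n -> Gamma) : Gamma_tensor n :=
  \sum_(mu \in [set: n.-tuple part])
    (\prod_(i < n) coeff (tnth mu i) (g i)) *: << mu >>.

(** Rank conditions; only the values [r i j] with i <= j <= n matter *)

Fixpoint comp_maps (K : fieldType) (V : nat -> vectType K)
    (f : forall i, 'Hom(V i, V i.+1)) (i k : nat) : 'Hom(V i, V (k + i)%N) :=
  match k with
  | 0%N => \1%VF
  | k'.+1 => (f (k' + i)%N \o comp_maps f i k')%VF
  end.

Definition can_occur (K : fieldType) (n : nat) (r : nat -> nat -> nat) : Prop :=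
  exists (V : nat -> vectType K) (f : forall i, 'Hom(V i, V i.+1)),
    (forall i, (i <= n)%N -> \dim {: V i} = r i i) /\
    (forall i k, (0 < k)%N -> (k + i <= n)%N ->
       \dim (limg (comp_maps f i k)) = r i (k + i)%N).

(* The truncated subtractions are exact when r can occur. *)
Definition nrows (r : nat -> nat -> nat) (i j : nat) : nat := (r i.+1 j - r i j)%N.
Definition ncols (r : nat -> nat -> nat) (i j : nat) : nat := (r i j.-1 - r i j)%N.

Definition rect_empty r i j : Prop := nrows r i j = 0%N \/ ncols r i j = 0%N.

Definition expected_codim (n : nat) (r : nat -> nat -> nat) : nat :=
  (\sum_(i < n.+1) \sum_(j < n.+1 | i < j) ncols r i j * nrows r i j)%N.

(* The sequence (R_(i,i+1) + sigma_(i+1), tau_i) of the i-th tensor factor.  The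
   lists are sigma = (sigma_1, ..., sigma_(n-1)), tau = (tau_1, ..., tau_(n-1));
   the defaults give tau_0 = sigma_n = part0. *)
Definition factor_seq (r : nat -> nat -> nat) (sigma tau : seq part) (i : nat)
    : seq nat :=
  mkseq (fun k => ncols r i i.+1 + nth 0 (nth part0 sigma i) k)%N (nrows r i i.+1)
  ++ nth part0 (part0 :: tau) i.

Definition rbar (r : nat -> nat -> nat) : nat -> nat -> nat :=
  fun i j => r i j.+1.

(* P_r for rank conditions r_ij with 0 <= i <= j <= n.+1. *)
Fixpoint quiverP (n : nat) (r : nat -> nat -> nat) : Gamma_tensor n.+1 :=
  match n with
  | 0%N => << [tuple rect (nrows r 0 1) (ncols r 0 1)] >>
  | n'.+1 =>
      let Pbar := quiverP n' (rbar r) in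
      \sum_(mu <- dom Pbar) coeff mu Pbar *:
        \sum_(st \in [set st : (n'.+1.-tuple part * n'.+1.-tuple part)%type |
                forall i, (size (tnth st.1 i) <= nrows r i i.+1)%N])
          (\prod_(i < n'.+1)
             coeff (tnth st.1 i, tnth st.2 i) (coprod (tnth mu i))) *:
          tensor (fun i : 'I_n'.+2 =>
                    G_seq [seq k%:Z | k <- factor_seq r st.1 st.2 i])
  end.

(* Trailing zeros of a sequence are irrelevant when it is seen as a partition. *)
Definition part_of_seq (mu : part) (s : seq nat) : Prop :=
  forall k, nth 0%N mu k = nth 0%N s k.

(* Main.v *)
Require Import Defs.
From HB Require Import structures.
From mathcomp Require Import all_boot all_order all_fingroup all_algebra.
From mathcomp Require Import finmap.
From mathcomp Require Import boolp classical_sets functions cardinality fsbigop.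
From mathcomp Require Import freeg mpoly.
From mathcomp Require Import zify ring.

Set Implicit Arguments.
Unset Strict Implicit.
Unset Printing Implicit Defensive.

Import Order.TTheory GRing.Theory Num.Theory.

Local Open Scope classical_set_scope.
Local Open Scope ring_scope.

(* In the 0-Hecke algebra with generators u_i, u_i^2 = - u_i, put h_i(z) = 1 + z u_i.
   By Fomin and Kirillov, the double Grothendieck polynomial of w is the coefficient
   of w in an explicit product of factors h_i(x_j) and h_i(y_j).  For the permutation of
   a partition this coefficient only depends on the induced action on lattice paths,
   and in the stable limit G_lambda is the coefficient, at the path of lambda, of a
   product of full increasing and decreasing words h_0(z) h_1(z) ... and ... h_1(z) h_0(z).

   On the paths in a rectangle R, u_i and u_(n-2-i) are adjoint for the bilinear form
   whose matrix is (-1)^k at pairs of paths differing by a rook strip of size k.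
   Separating the two sets of variables in the product, this gives the coproduct of
   G_R: d^R_(sigma, tau) is (-1)^(|sigma| + |tau| - |R|) if sigma and the rotated tau
   cover R and meet in a rook strip, and 0 otherwise; this uses that the G_lambda are
   linearly independent.

   If all R_ij with j - i > 1 are empty, P_r is the tensor product of the G_(R_(i,i+1)).
   Under the hypothesis of the theorem this applies to the shifted rank conditions, so
   P_r is computed by one step of the recursion.  By Sylvester's rank inequality the
   sequences that occur in it are partitions, and G_I = G_mu when I is a partition mu,
   because the calG_mu are linearly independent: multiplication by the
   Vandermonde determinant turns them into alternants. *)

(** * The 0-Hecke action *)

(** The action is defined on all functions [nat -> nat], not only on permutations: [hact] compares
    two neighbouring values and does nothing when they are equal. Hence the same words act on
    permutations and on 0/1-sequences, and passing from the permutation of a partition to its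
    lattice path is a restriction of one operator. Separating variables requires that full blocks
    commute. An increasing and a decreasing block commute by the Yang-Baxter relation. Two blocks of
    the same kind commute by conjugation with an inverse: the inverse of a decreasing block with
    parameter y is the increasing one with parameter y/(y-1), which is why fractions enter. In the
    matrix of rook strip signs the row of the full rectangle is a unit vector. So G_R is the value
    of the bilinear form at a delta function and at the image of a delta function under a word, and
    adjointness lets half of the blocks move to the first argument. What remains on each side is a G
    in half of the variables, and the matrix entries become the coproduct coefficients. *)

Definition adj_swap (i k : nat) : nat :=
  if k == i then i.+1 else if k == i.+1 then i else k.

Lemma adj_swapK i : involutive (adj_swap i).
Proof. by move=> k; rewrite /adj_swap; do !case: eqP => //=; lia. Qed.

Lemma adj_swapL i : adj_swap i i = i.+1.
Proof. by rewrite /adj_swap eqxx. Qed.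

Lemma adj_swapR i : adj_swap i i.+1 = i.
Proof. by rewrite /adj_swap eqxx; case: eqP => //; lia. Qed.

Lemma adj_swapD i k : k != i -> k != i.+1 -> adj_swap i k = k.
Proof. by rewrite /adj_swap => /negbTE -> /negbTE ->. Qed.

Lemma adj_swapKf (w : nat -> nat) i : w \o adj_swap i \o adj_swap i = w.
Proof. by apply/funext => k /=; rewrite adj_swapK. Qed.

Section HeckeAction.
Variable R : comNzRingType.
Implicit Types (f g : (nat -> nat) -> R) (w : nat -> nat) (x y z : R).

(* A function f of permutations stands for the element sum_w f(w) w of the 0-Hecke
   algebra, and [hact i z f] for its product with 1 + z u_i on the right. *)
Definition hact (i : nat) z f : (nat -> nat) -> R := fun w =>
  if (w i.+1 < w i)%N then (1 - z) * f w + z * f (w \o adj_swap i) else f w.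

Definition actw (W : seq (nat * R)) f := foldl (fun f p => hact p.1 p.2 f) f W.

Definition weq (W V : seq (nat * R)) := forall f, actw W f = actw V f.

Lemma actw_cat W V f : actw (W ++ V) f = actw V (actw W f).
Proof. by rewrite /actw foldl_cat. Qed.

Lemma actw_rcons W p f : actw (rcons W p) f = hact p.1 p.2 (actw W f).
Proof. by rewrite -cats1 actw_cat. Qed.

Lemma actw_cons p W f : actw (p :: W) f = actw W (hact p.1 p.2 f).
Proof. by []. Qed.

Lemma weq_sym W V : weq W V -> weq V W. Proof. by move=> h f; rewrite h. Qed.
Lemma weq_trans V W U : weq W V -> weq V U -> weq W U.
Proof. by move=> h k f; rewrite h. Qed.
Lemma weq_cat W W' V V' : weq W W' -> weq V V' -> weq (W ++ V) (W' ++ V').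
Proof. by move=> h k f; rewrite !actw_cat h k. Qed.

Lemma weq_catl W V V' : weq V V' -> weq (W ++ V) (W ++ V').
Proof. exact: weq_cat. Qed.

Lemma weq_catr W V V' : weq V V' -> weq (V ++ W) (V' ++ W).
Proof. by move=> h; apply: weq_cat. Qed.

Lemma hact0 i f : hact i 0 f = f.
Proof. by apply/funext => w; rewrite /hact; case: ifP => // _; ring. Qed.

Lemma hact_add i x y f : hact i y (hact i x f) = hact i (x + y - x * y) f.
Proof.
apply/funext => w; rewrite /hact /= adj_swapKf adj_swapL adj_swapR.
by case: ltnP => // h; rewrite ltnNge ltnW //=; ring.
Qed.

Lemma adj_swap_far i j w : (i.+1 < j)%N || (j.+1 < i)%N ->
  w \o adj_swap i \o adj_swap j = w \o adj_swap j \o adj_swap i.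
Proof.
move=> h; apply/funext => k /=; congr (w _); rewrite /adj_swap.
by do !case: eqP => //=; lia.
Qed.

Lemma hact_far i j x y f : (i.+1 < j)%N || (j.+1 < i)%N ->
  hact i x (hact j y f) = hact j y (hact i x f).
Proof.
move=> h; apply/funext => w; rewrite /hact /= adj_swap_far //.
rewrite ![adj_swap i _]adj_swapD; try lia.
rewrite ![adj_swap j _]adj_swapD; try lia.
by case: ltnP => // _; case: ltnP => // _; ring.
Qed.

Lemma adj_swap_braid i w :
  w \o adj_swap i \o adj_swap i.+1 \o adj_swap i =
  w \o adj_swap i.+1 \o adj_swap i \o adj_swap i.+1.
Proof.
apply/funext => k /=; congr (w _); rewrite /adj_swap.
by do !case: eqP => //=; lia.
Qed.

(** The Yang-Baxter relation; x + y - xy is the formal group sum belonging to u_i^2 = - u_i. Only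
    the relative order of three neighbouring values of w matters, and f enters through its values at
    six rearrangements of w, so each order leaves a ring identity. *)
Lemma hact_YB i x y f :
  hact i x (hact i.+1 (x + y - x * y) (hact i y f)) =
  hact i.+1 y (hact i (x + y - x * y) (hact i.+1 x f)).
Proof.
have swE : ((adj_swap i i = i.+1) * (adj_swap i i.+1 = i) * (adj_swap i i.+2 = i.+2)
   * (adj_swap i.+1 i = i) * (adj_swap i.+1 i.+1 = i.+2) * (adj_swap i.+1 i.+2 = i.+1))%type.
  by rewrite /adj_swap; do !split; do !case: eqP => //; lia.
apply/funext => w; rewrite /hact /= !adj_swapKf adj_swap_braid !swE.
have E : w \o adj_swap i.+1 \o adj_swap i \o adj_swap i.+1 \o adj_swap i =
  w \o adj_swap i \o adj_swap i.+1 by rewrite -adj_swap_braid adj_swapKf.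
rewrite ?E ?adj_swapKf.
move: (f w) (f _) (f _) (f _) (f _) (f _) => f0 f1 f2 f3 f4 f5.
move: (w i) (w i.+1) (w i.+2) => p q r {swE E}.
by case: (ltngtP p q) => pq; case: (ltngtP q r) => qr; case: (ltngtP p r) => pr;
  (try by exfalso; lia); ring.
Qed.

Lemma weq_nil i x : weq [:: (i, 0 : R)] [::].
Proof. by move=> f; rewrite /actw /= hact0. Qed.

Lemma weq_add i x y : weq [:: (i, x); (i, y)] [:: (i, x + y - x * y)].
Proof. by move=> f; rewrite /actw /= hact_add. Qed.

Lemma weq_far i x W : all (fun p : nat * R => (i.+1 < p.1) || (p.1.+1 < i))%N W ->
  weq ((i, x) :: W) (rcons W (i, x)).
Proof.
elim: W => // -[j y] W IH /= /andP[h1 /IH h2] f.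
by rewrite [RHS]actw_cons -(h2 (hact j y f)) !actw_cons /= hact_far // orbC.
Qed.

Lemma weq_YB i x y : weq [:: (i, y); (i.+1, x + y - x * y); (i, x)]
                         [:: (i.+1, x); (i, x + y - x * y); (i.+1, y)].
Proof. by move=> f; rewrite /actw /= hact_YB. Qed.

Definition decw (k i : nat) z : seq (nat * R) := [seq (j, z) | j <- rev (index_iota i k)].
Definition incw (k i : nat) z : seq (nat * R) := [seq (j, z) | j <- index_iota i k].

Lemma index_iota_ltn i k : (i < k)%N -> index_iota i k = i :: index_iota i.+1 k.
Proof. by move=> h; rewrite /index_iota; case: k h => // k h; rewrite subSS subSn. Qed.

Lemma index_iota_geq i k : (k <= i)%N -> index_iota i k = [::].
Proof. by rewrite /index_iota => /eqP ->. Qed.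

Lemma decw_geq k i z : (k <= i)%N -> decw k i z = [::].
Proof. by move=> h; rewrite /decw index_iota_geq. Qed.

Lemma incw_geq k i z : (k <= i)%N -> incw k i z = [::].
Proof. by move=> h; rewrite /incw index_iota_geq. Qed.

Lemma decw_ltn k i z : (i < k)%N -> decw k i z = rcons (decw k i.+1 z) (i, z).
Proof. by move=> h; rewrite /decw index_iota_ltn // rev_cons map_rcons. Qed.

Lemma incw_ltn k i z : (i < k)%N -> incw k i z = (i, z) :: incw k i.+1 z.
Proof. by move=> h; rewrite /incw index_iota_ltn. Qed.

Lemma decw_bound k i z p : p \in decw k i z -> (i <= p.1 < k)%N.
Proof. by move=> /mapP[j]; rewrite mem_rev mem_index_iota => h ->. Qed.

Lemma incw_bound k i z p : p \in incw k i z -> (i <= p.1 < k)%N.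
Proof. by move=> /mapP[j]; rewrite mem_index_iota => h ->. Qed.

(** The outer letters h_i(y) and h_i(x) enclose the instance for i + 1. They commute with every
    letter from i + 2 on, so they can be brought next to the middle letter h_(i+1)(x + y - xy),
    where Yang-Baxter applies. *)
Lemma weq_inc_dec k i x y : (i < k)%N ->
  weq (incw k i y ++ decw k i x)
      (decw k i.+1 x ++ (i, x + y - x * y) :: incw k i.+1 y).
Proof.
move=> ik; move: {2}(k - i)%N (leqnn (k - i)%N) => d.
elim: d i ik => [|d IH] i ik le_d; first by lia.
have [k_i1|i1_k] := leqP k i.+1.
  have -> : k = i.+1 by lia.
  rewrite incw_ltn // decw_ltn // incw_geq // decw_geq //= => f.
  by rewrite /actw /= hact_add; congr hact; ring.
rewrite incw_ltn // decw_ltn // -cats1 /=.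
have far z (W : seq (nat * R)) : {in W, forall p, i.+2 <= p.1 < k}%N ->
    weq ((i, z) :: W) (rcons W (i, z)).
  by move=> h; apply: weq_far; apply/allP => p /h /andP[hp _] /=; rewrite hp.
have step1 : weq (incw k i.+1 y ++ decw k i.+1 x ++ [:: (i, x)])
    (decw k i.+2 x ++ [:: (i.+1, x + y - x * y); (i, x)] ++ incw k i.+2 y).
  rewrite catA; apply: weq_trans (weq_catr _ (IH _ _ _)) _ => //; first by lia.
  rewrite -catA; apply: weq_catl => /=.
  rewrite -(cat1s (i.+1, _)) -[X in weq _ X]cat1s; apply: weq_catl.
  by apply: weq_sym; rewrite cats1; apply: far => p /incw_bound.
apply: weq_trans (weq_catl [:: (i, y)] step1) _.
rewrite catA cat1s (decw_ltn x i1_k).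
apply: weq_trans (weq_catr _ (far _ _ _)) _; first by move=> p /decw_bound.
rewrite -!cats1 -!catA; apply: weq_catl; rewrite !catA /=.
rewrite (incw_ltn y i1_k).
by apply: (weq_catr (incw k i.+2 y) (weq_YB i x y)).
Qed.

(** The middle letter of [weq_inc_dec] factors as h_i(x) h_i(y), and each factor completes the block
    next to it. *)
Lemma weq_dec_inc k i x y : weq (decw k i x ++ incw k i y) (incw k i y ++ decw k i x).
Proof.
have [ki|ik] := leqP k i; first by rewrite decw_geq // incw_geq.
apply: weq_sym; apply: weq_trans (weq_inc_dec _ _ ik) _.
rewrite (decw_ltn x ik) (incw_ltn y ik) -cats1 -catA; apply: weq_catl.
rewrite -cat1s -[X in weq _ X]/([:: (i, x); (i, y)] ++ incw k i.+1 y).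
by apply: weq_catr; apply: weq_sym; apply: weq_add.
Qed.

(** Letters with formal sum 0 are inverse to each other, so the product telescopes from the middle
    outwards. *)
Lemma weq_dec_incV k i x y : x + y - x * y = 0 -> weq (decw k i x ++ incw k i y) [::].
Proof.
move=> xy0; move: {2}(k - i)%N (leqnn (k - i)%N) => d.
elim: d i => [|d IH] i le_d; first by rewrite decw_geq ?incw_geq //; lia.
have [ki|ik] := leqP k i; first by rewrite decw_geq // incw_geq.
rewrite (decw_ltn x ik) (incw_ltn y ik) -cats1 -catA /=.
apply: weq_trans (IH i.+1 _); last by lia.
apply: weq_catl; rewrite -[X in weq X]/([:: (i, x); (i, y)] ++ incw k i.+1 y).
apply: (weq_trans (weq_catr _ (weq_add i x y))).
by rewrite xy0; apply: (weq_catr (incw k i.+1 y) (weq_nil i 0)).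
Qed.

Lemma weq_inc_decV k i x y : x + y - x * y = 0 -> weq (incw k i y ++ decw k i x) [::].
Proof.
by move=> xy0; apply: weq_trans (weq_sym (weq_dec_inc _ _ _ _)) (weq_dec_incV _ _ _).
Qed.

(** The trivial product dec(y) inc(z) is inserted in front; inc(z) moves past dec(x) and cancels
    against dec(y). *)
Lemma weq_dec_decV k i x y z : y + z - y * z = 0 ->
  weq (decw k i x ++ decw k i y) (decw k i y ++ decw k i x).
Proof.
move=> yz0; have V := weq_inc_decV k i yz0.
apply: (weq_trans (weq_catr (decw k i x ++ decw k i y)
  (weq_sym (weq_dec_incV k i yz0)))).
rewrite -!catA; apply: weq_catl.
rewrite catA; apply: weq_trans (weq_catr _ (weq_sym (weq_dec_inc _ _ _ _))) _.
by rewrite -catA -[X in weq _ X]cats0; apply: weq_catl.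
Qed.

Lemma weq_inc_incV k i x y z : y + z - y * z = 0 ->
  weq (incw k i x ++ incw k i y) (incw k i y ++ incw k i x).
Proof.
move=> yz0; have zy0 : z + y - z * y = 0 by rewrite -yz0; ring.
apply: (weq_trans (weq_catr (incw k i x ++ incw k i y)
  (weq_sym (weq_inc_decV k i zy0)))).
rewrite -!catA; apply: weq_catl.
rewrite catA; apply: weq_trans (weq_catr _ (weq_dec_inc _ _ _ _)) _.
by rewrite -catA -[X in weq _ X]cats0; apply: weq_catl; apply: weq_dec_incV.
Qed.

End HeckeAction.

Arguments actw {R} W f _ : simpl never.

Definition mapw (R S : Type) (phi : R -> S) (W : seq (nat * R)) : seq (nat * S) :=
  [seq (p.1, phi p.2) | p <- W].

Lemma actw_morph (R S : comNzRingType) (phi : {rmorphism R -> S}) W f w :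
  phi (actw W f w) = actw (mapw phi W) (phi \o f) w.
Proof.
elim: W f => // -[i z] W IH f.
suff E : phi \o hact i z f = hact i (phi z) (phi \o f) by rewrite [LHS]IH E.
apply/funext => u; rewrite /hact /=.
by case: ifP => // _; rewrite rmorphD !rmorphM rmorphB rmorph1.
Qed.

Lemma mapw_cat (R S : Type) (phi : R -> S) W V :
  mapw phi (W ++ V) = mapw phi W ++ mapw phi V.
Proof. exact: map_cat. Qed.

Lemma mapw_dec (R S : comNzRingType) (phi : R -> S) k i z :
  mapw phi (decw k i z) = decw k i (phi z).
Proof. by rewrite /mapw -map_comp. Qed.

Lemma mapw_inc (R S : comNzRingType) (phi : R -> S) k i z :
  mapw phi (incw k i z) = incw k i (phi z).
Proof. by rewrite /mapw -map_comp. Qed.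

Lemma weq_inj (R S : comNzRingType) (phi : {rmorphism R -> S}) W V :
  injective phi -> weq (mapw phi W) (mapw phi V) -> weq W V.
Proof.
by move=> inj h f; apply/funext => w; apply: inj; rewrite !actw_morph h.
Qed.

(* h_i(z) is invertible over the fractions, with inverse h_i(u). *)
Lemma oplus_frac_inv (R : idomainType) (z : R) : 1 - z != 0 ->
  exists u : {fraction R}, tofrac z + u - tofrac z * u = 0.
Proof.
move=> z1; exists (tofrac z / (tofrac z - 1)).
have : tofrac z - 1 != 0 :> {fraction R}.
  by rewrite -tofrac1 -tofracB tofrac_eq0 -opprB oppr_eq0.
by move=> h; field.
Qed.

Lemma weq_dec_dec (R : idomainType) k i (x y : R) : 1 - y != 0 ->
  weq (decw k i x ++ decw k i y) (decw k i y ++ decw k i x).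
Proof.
move=> /oplus_frac_inv[u u0].
apply: (@weq_inj _ _ (@tofrac R)); first by move=> a b /eqP; rewrite tofrac_eq => /eqP.
by rewrite !mapw_cat !mapw_dec; apply: weq_dec_decV u0.
Qed.

Lemma weq_inc_inc (R : idomainType) k i (x y : R) : 1 - y != 0 ->
  weq (incw k i x ++ incw k i y) (incw k i y ++ incw k i x).
Proof.
move=> /oplus_frac_inv[u u0].
apply: (@weq_inj _ _ (@tofrac R)); first by move=> a b /eqP; rewrite tofrac_eq => /eqP.
by rewrite !mapw_cat !mapw_inc; apply: weq_inc_incV u0.
Qed.

(** * Fomin-Kirillov words *)

Section FK.
Variable R : comNzRingType.
Implicit Types (x y : nat -> R) (f : (nat -> nat) -> R).

(** The block for j = k is empty. It is kept so that exchanging the last two parameters x_(k-1) and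
    x_k is not a special case. *)
Definition fkA (k i : nat) x := flatten [seq decw k j (x j) | j <- index_iota i k.+1].
Definition fkB (k i : nat) y :=
  flatten [seq incw k j (y (j - i)%N) | j <- rev (index_iota i k)].
(* [fkred] is a word of the same product of length l(w_0); the coefficient of w_0 is the
   product of its parameters. *)
Definition fkrow (k i l : nat) (x : R) y : seq (nat * R) :=
  [seq (j, x + y (j - i)%N - x * y (j - i)%N) | j <- rev (index_iota l k)].
Definition fkred (k i : nat) x y :=
  flatten [seq fkrow k j j (x j) y | j <- index_iota i k].

Lemma all_flatten_map (T : eqType) (S : Type) (P : pred S) (F : T -> seq S) (s : seq T) :
  {in s, forall j, all P (F j)} -> all P (flatten [seq F j | j <- s]).
Proof.
elim: s => //= a s IH h; rewrite all_cat h ?mem_head //=.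
by apply: IH => j js; apply: h; rewrite inE js orbT.
Qed.

Lemma rev_iota_ltn i k : (i < k)%N ->
  rev (index_iota i k) = rcons (rev (index_iota i.+1 k)) i.
Proof. by move=> h; rewrite index_iota_ltn // rev_cons. Qed.

(** The x-block moves to the left through the y-blocks. Each crossing is an instance of
    [weq_inc_dec]: it removes the lowest letter of both blocks and leaves one letter with the formal
    sum, which commutes with the shortened y-blocks standing to its left. *)
Lemma fkrow_reduce k i l (x : R) y : (l <= k)%N ->
  weq (flatten [seq incw k j (y (j - i)%N) | j <- rev (index_iota l k)] ++ decw k l x)
      (fkrow k i l x y ++
       flatten [seq incw k j.+1 (y (j - i)%N) | j <- rev (index_iota l k)]).
Proof.
move=> lk; move: {2}(k - l)%N (leqnn (k - l)%N) => d.
elim: d l lk => [|d IH] l lk le_d.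
  by rewrite /fkrow index_iota_geq ?decw_geq //; lia.
have [kl|{}lk] := leqP k l; first by rewrite /fkrow index_iota_geq ?decw_geq //.
rewrite /fkrow rev_iota_ltn // !map_rcons !flatten_rcons -catA.
apply: weq_trans (weq_catl _ (weq_inc_dec _ _ lk)) _.
rewrite catA; apply: weq_trans (weq_catr _ (IH _ lk _)) _; first by lia.
rewrite -cats1 -!catA; apply: weq_catl.
rewrite -cat1s !catA; apply: weq_catr.
rewrite cats1; apply: weq_sym; apply: weq_far.
apply: all_flatten_map => j; rewrite mem_rev mem_index_iota => h.
by apply/allP => p /incw_bound /andP[hp _] /=; apply/orP; left; apply: leq_trans hp; lia.
Qed.

Lemma fkB_ltn k i y : (i < k)%N ->
  flatten [seq incw k j.+1 (y (j - i)%N) | j <- rev (index_iota i k)] = fkB k i.+1 y.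
Proof.
move=> ik; rewrite /fkB.
suff -> : [seq incw k j.+1 (y (j - i)%N) | j <- rev (index_iota i k)] =
  incw k k (y (k - i.+1)%N) :: [seq incw k j (y (j - i.+1)%N) | j <- rev (index_iota i.+1 k)].
  by rewrite /= incw_geq.
have E : rev (index_iota i.+1 k.+1) = k :: rev (index_iota i.+1 k).
  rewrite /index_iota (_ : (k.+1 - i.+1 = (k - i.+1) + 1)%N); last by lia.
  by rewrite iotaD rev_cat /= subnKC.
rewrite -[RHS]/([seq incw k j (y (j - i.+1)%N) | j <- k :: rev (index_iota i.+1 k)]).
rewrite -E !map_rev /index_iota subSS -[i.+1]add1n iotaDl -map_comp.
by congr rev; apply: eq_map => j /=; rewrite add1n subSS.
Qed.

Lemma fk_reduce k i x y : weq (fkB k i y ++ fkA k i x) (fkred k i x y).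
Proof.
move: {2}(k - i)%N (leqnn (k - i)%N) => d.
elim: d i => [|d IH] i le_d.
  have ki : (k <= i)%N by lia.
  rewrite /fkB /fkred index_iota_geq //= /fkA.
  have [->|{}ki] : i = k \/ (k < i)%N by lia.
    by rewrite index_iota_ltn // index_iota_geq //= decw_geq.
  by rewrite index_iota_geq.
have [ki|ik] := leqP k i.
  rewrite /fkB /fkred index_iota_geq //= /fkA.
  have [->|{}ki] : i = k \/ (k < i)%N by lia.
    by rewrite index_iota_ltn // index_iota_geq //= decw_geq.
  by rewrite index_iota_geq.
rewrite /fkA /fkred index_iota_ltn; last by lia.
rewrite (@index_iota_ltn i k) //= catA.
apply: weq_trans (weq_catr _ (fkrow_reduce i (x i) y (ltnW ik))) _.
by rewrite fkB_ltn // -catA; apply: weq_catl; apply: IH; lia.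
Qed.

End FK.

(** The extra letter commutes with the blocks from i + 2 on and lengthens block i + 1 by the letter
    i. Blocks i and i + 1 then have the same range and commute. *)
Lemma fkA_swap (R : idomainType) k i (x : nat -> R) : (forall j, 1 - x j != 0) -> (i < k)%N ->
  weq (rcons (fkA k 0 x) (i, x i.+1)) (rcons (fkA k 0 (x \o adj_swap i)) (i, x i)).
Proof.
move=> x1 ik.
have E (z : nat -> R) : fkA k 0 z = flatten [seq decw k j (z j) | j <- index_iota 0 i] ++
   decw k i (z i) ++ decw k i.+1 (z i.+1) ++
   flatten [seq decw k j (z j) | j <- index_iota i.+2 k.+1].
  rewrite /fkA (_ : index_iota 0 k.+1 = index_iota 0 i ++ index_iota i k.+1).
    by rewrite map_cat flatten_cat (@index_iota_ltn i) ?(@index_iota_ltn i.+1) //; lia.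
  by rewrite /index_iota !subn0 -{2}[i]add0n -iotaD; congr iota; lia.
have F (z : nat -> R) u : weq (rcons (fkA k 0 z) (i, u))
   (flatten [seq decw k j (z j) | j <- index_iota 0 i] ++
   (decw k i (z i) ++ rcons (decw k i.+1 (z i.+1)) (i, u)) ++
   flatten [seq decw k j (z j) | j <- index_iota i.+2 k.+1]).
  rewrite E -cats1 -!catA; apply: weq_catl; apply: weq_catl.
  rewrite -cats1 -!catA; apply: weq_catl.
  rewrite cats1; apply: weq_sym; apply: weq_far.
  apply: all_flatten_map => j; rewrite mem_index_iota => h.
  by apply/allP => p /decw_bound /andP[hp _] /=; apply/orP; left; apply: leq_trans hp; lia.
apply: weq_trans (F _ _) _; apply: weq_trans _ (weq_sym (F _ _)).
rewrite /= adj_swapL adj_swapR -!decw_ltn //.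
have -> : [seq decw k j (x (adj_swap i j)) | j <- index_iota 0 i] =
          [seq decw k j (x j) | j <- index_iota 0 i].
  by apply/eq_in_map => j; rewrite mem_index_iota => h; rewrite adj_swapD //; lia.
have -> : [seq decw k j (x (adj_swap i j)) | j <- index_iota i.+2 k.+1] =
          [seq decw k j (x j) | j <- index_iota i.+2 k.+1].
  by apply/eq_in_map => j; rewrite mem_index_iota => h; rewrite adj_swapD //; lia.
by apply: weq_catl; apply: weq_catr; apply: weq_dec_dec.
Qed.

Definition fkw (R : comNzRingType) k (x y : nat -> R) := fkB k 0 y ++ fkA k 0 x.

(** The coefficients of this identity at w and at w s_i are the recursion by isobaric divided
    differences. *)
Lemma fkw_swap (R : idomainType) k i (x y : nat -> R) f w :
  (forall j, 1 - x j != 0) -> (i < k)%N ->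
  hact i (x i.+1) (actw (fkw k x y) f) w = hact i (x i) (actw (fkw k (x \o adj_swap i) y) f) w.
Proof.
move=> x1 ik; have := weq_catl (fkB k 0 y) (fkA_swap x1 ik).
by move=> /(_ f) h; rewrite -!rcons_cat !actw_rcons /= in h; rewrite h.
Qed.

Definition perm_nat n (w : 'S_n) (k : nat) : nat :=
  if insub k is Some a then w a : nat else k.

Lemma perm_nat_ord n (w : 'S_n) (a : 'I_n) : perm_nat w a = w a.
Proof. by rewrite /perm_nat valK. Qed.

Lemma perm_nat_lt n (w : 'S_n) k (h : (k < n)%N) : perm_nat w k = w (Ordinal h).
Proof. by rewrite -perm_nat_ord. Qed.

Lemma perm_nat_geq n (w : 'S_n) k : (n <= k)%N -> perm_nat w k = k.
Proof. by move=> h; rewrite /perm_nat insubF // ltnNge h. Qed.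

Lemma perm_nat_tperm n (w : 'S_n) (i j : 'I_n) : j = i.+1 :> nat ->
  perm_nat (tperm i j * w) = perm_nat w \o adj_swap i.
Proof.
move=> ji; apply/funext => k /=; have [nk|kn] := leqP n k.
  rewrite adj_swapD ?perm_nat_geq //; first by apply/eqP => e; have := ltn_ord i; lia.
  by apply/eqP => e; have := ltn_ord j; lia.
rewrite perm_nat_lt permM /adj_swap; case: eqP => [ki|ki].
  have -> : Ordinal kn = i by apply/val_inj.
  by rewrite tpermL -ji perm_nat_ord.
case: eqP => [kj|kj].
  have -> : Ordinal kn = j by apply/val_inj; rewrite /= kj.
  by rewrite tpermR perm_nat_ord.
rewrite tpermD; first by rewrite -perm_nat_ord.
  by apply/eqP => e; apply: ki; rewrite e.
by apply/eqP => e; apply: kj; rewrite -ji e.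
Qed.

(** In the definition of [perm_len] the braces denote a classical set; the finite set on the right
    gives access to the cardinality lemmas. *)
Lemma perm_lenE n (w : 'S_n) : perm_len w =
  #|[set p : 'I_n * 'I_n | (p.1 < p.2)%N && (w p.2 < w p.1)%N]%SET|.
Proof. by apply: eq_card => p; rewrite !inE; apply/asboolP/idP. Qed.

Lemma perm_len_ascent n (w : 'S_n) (i j : 'I_n) : j = i.+1 :> nat -> (w i < w j)%N ->
  perm_len (tperm i j * w) = (perm_len w).+1.
Proof.
move=> ji wij; rewrite !perm_lenE.
pose f (p : 'I_n * 'I_n) := (tperm i j p.1, tperm i j p.2).
have fK : involutive f by case=> a b; rewrite /f /= !tpermK.
have tD k : k != i -> k != j -> tperm i j k = k by move=> ? ?; rewrite tpermD // eq_sym.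
set S := [set p | _]%SET; set S' := [set p | _]%SET.
(* Exchanging positions i and j carries inversions to inversions, and (i, j) is the only new one. *)
have -> : S = ((i, j) |: [set f p | p in S'])%SET.
  apply/setP => -[a b]; rewrite in_setU1 !inE /= !permM.
  have -> : ((a, b) \in [set f p | p in S']%SET) = (f (a, b) \in S').
    apply/imsetP/idP => [[p pS ->]|h]; first by rewrite fK.
    by exists (f (a, b)); rewrite ?fK.
  rewrite inE /= xpair_eqE -!val_eqE /=.
  have valE (k l : 'I_n) : k != l -> (k : nat) <> l by move=> kl; apply/eqP.
  have [->|ai] := eqVneq a i; [|have [->|aj] := eqVneq a j];
  (have [->|bi] := eqVneq b i; [|have [->|bj] := eqVneq b j]);
  rewrite ?tpermL ?tpermR ?tD //;
  (try move: (valE _ _ ai)); (try move: (valE _ _ aj));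
  (try move: (valE _ _ bi)); (try move: (valE _ _ bj)); rewrite ?ji; lia.
rewrite cardsU1 card_imset; last exact: inv_inj fK.
suff -> : (i, j) \notin [set f p | p in S']%SET by [].
apply/negP => /imsetP[p pS e].
by move: pS; rewrite -(fK p) -e inE /= tpermL tpermR ji ltnNge leqW.
Qed.

Lemma perm_len_descent n (w : 'S_n) (i j : 'I_n) : j = i.+1 :> nat -> (w j < w i)%N ->
  perm_len w = (perm_len (tperm i j * w)).+1.
Proof.
move=> ji wij; rewrite -(perm_len_ascent ji); first by rewrite mulgA tperm2 mul1g.
by rewrite !permM tpermL tpermR.
Qed.

(** Since the values strictly decrease, counting from the right end bounds [w a] below by n - 1 - a,
    and counting from the left end bounds it above by the same number. *)
Lemma perm_ascent_exists n (w : 'S_n) :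
  (forall i j : 'I_n, j = i.+1 :> nat -> (w j < w i)%N) -> w = perm_w0 n.
Proof.
move=> h.
have lo k (a : 'I_n) : (a + k = n.-1)%N -> (k <= w a)%N.
  elim: k a => // k IH a ak.
  have an : (a.+1 < n)%N by have := ltn_ord a; lia.
  by apply: leq_ltn_trans (h a (Ordinal an) erefl); apply: IH; rewrite /=; lia.
have hi k (a : 'I_n) : a = k :> nat -> (w a + k <= n.-1)%N.
  elim: k a => [|k IH] a ak; first by have := ltn_ord (w a); lia.
  have kn : (k < n)%N by have := ltn_ord a; lia.
  have := IH (Ordinal kn) erefl; have := h (Ordinal kn) a ak; lia.
apply/permP => a; rewrite permE; apply/val_inj => /=.
have := lo (n.-1 - a)%N a; have := hi a a erefl; have := ltn_ord a.
move=> an h1 h2; have := h2 ltac:(lia); lia.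
Qed.

(** * The coefficient of a reduced word at its own permutation *)

Section TopCoefficient.
Variable R : comNzRingType.
Implicit Types (W : seq (nat * R)) (x y : nat -> R).

Definition eid (w : nat -> nat) : R := `[< w = id >]%:R.

Definition wprod W : nat -> nat := foldl (fun g p => g \o adj_swap p.1) id W.

Lemma wprod_rcons W p : wprod (rcons W p) = wprod W \o adj_swap p.1.
Proof. by rewrite /wprod -cats1 foldl_cat. Qed.

Lemma wprod_cat W V : wprod (W ++ V) = wprod W \o wprod V.
Proof.
elim/last_ind: V => [|V p IH]; first by rewrite cats0.
by rewrite -rcons_cat !wprod_rcons IH.
Qed.

Lemma perm_len1 n : perm_len (1%g : 'S_n) = 0%N.
Proof.
rewrite perm_lenE; apply/eqP; rewrite cards_eq0; apply/eqP/setP => p.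
by rewrite !inE !perm1; lia.
Qed.

Lemma perm_nat_id n (w : 'S_n) : perm_nat w = id -> w = 1%g.
Proof.
by move=> h; apply/permP => a; apply/val_inj; rewrite /= perm1 -perm_nat_ord h.
Qed.

Lemma perm_len_tperm_le n (w : 'S_n) (i j : 'I_n) : j = i.+1 :> nat ->
  (perm_len w <= (perm_len (tperm i j * w)).+1)%N.
Proof.
move=> ji; have [wij|wij] := ltnP (w j) (w i); first by rewrite (perm_len_descent ji wij).
rewrite (perm_len_ascent ji); first by lia.
rewrite ltn_neqAle wij andbT; apply/negP => /eqP /val_inj/perm_inj e.
by move: ji; rewrite e; lia.
Qed.

Definition bounded_word n W := all (fun p => (p.1.+1 < n)%N) W.

Lemma wprod_len n W (w : 'S_n) : bounded_word n W -> perm_nat w = wprod W ->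
  (perm_len w <= size W)%N.
Proof.
elim/last_ind: W w => [|W [i z] IH] w; first by move=> _ /perm_nat_id ->; rewrite perm_len1.
rewrite /bounded_word all_rcons wprod_rcons size_rcons /= => /andP[hi hW] hw.
have hi' : (i < n)%N by lia.
have e : Ordinal hi = (Ordinal hi').+1 :> nat by [].
apply: leq_trans (perm_len_tperm_le w e) _; rewrite ltnS; apply: IH => //.
by rewrite (perm_nat_tperm _ e) hw /= adj_swapKf.
Qed.

Lemma actw_long n W (w : 'S_n) : bounded_word n W -> (size W < perm_len w)%N ->
  actw W eid (perm_nat w) = 0.
Proof.
elim/last_ind: W w => [|W [i z] IH] w.
  move=> _ /= h; rewrite /actw /= /eid; case: asboolP => // /perm_nat_id e.
  by move: h; rewrite e perm_len1.
rewrite /bounded_word all_rcons size_rcons /= => /andP[hi hW] hw.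
have hi' : (i < n)%N by lia.
have e : Ordinal hi = (Ordinal hi').+1 :> nat by [].
rewrite actw_rcons /hact /= IH //; last by lia.
case: ifP => //; rewrite !perm_nat_lt => h.
rewrite -(perm_nat_tperm w e) IH ?mulr0 ?addr0 //.
by move: hw; rewrite (perm_len_descent e h).
Qed.

(** To reach w from a reduced word, z u_i must be chosen in every factor. The summand with 1 - z
    vanishes because w is longer than the remaining word, by [actw_long]. *)
Lemma actw_top n W (w : 'S_n) : bounded_word n W -> perm_nat w = wprod W ->
  perm_len w = size W -> actw W eid (perm_nat w) = \prod_(p <- W) p.2.
Proof.
elim/last_ind: W w => [|W [i z] IH] w.
  by move=> _ -> _; rewrite big_nil /actw /= /eid; case: asboolP.
rewrite /bounded_word all_rcons wprod_rcons size_rcons /= => /andP[hi hW] hw hl.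
have hi' : (i < n)%N by lia.
have e : Ordinal hi = (Ordinal hi').+1 :> nat by [].
have hw' : perm_nat (tperm (Ordinal hi') (Ordinal hi) * w) = wprod W.
  by rewrite (perm_nat_tperm _ e) hw /= adj_swapKf.
have := wprod_len hW hw'.
rewrite actw_rcons /hact /= !perm_nat_lt; have [h|h] := ltnP.
  have hl' : perm_len (tperm (Ordinal hi') (Ordinal hi) * w) = size W.
    by apply/eqP; rewrite -eqSS -hl (perm_len_descent e h).
  rewrite -(perm_nat_tperm w e) (IH _ hW hw' hl') => _.
  by rewrite actw_long ?hl // mulr0 add0r -cats1 big_cat big_seq1 mulrC.
rewrite (perm_len_ascent e); first by rewrite hl; lia.
rewrite ltn_neqAle h andbT; apply/negP => /eqP/val_inj/perm_inj/(congr1 val) /=; lia.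
Qed.

Lemma wprod_fkrow k i l (x : R) y : (l <= k)%N ->
  wprod (fkrow k i l x y) = fun a =>
    if a == l then k else if (l < a <= k)%N then a.-1 else a.
Proof.
move=> lk; move: {2}(k - l)%N (leqnn (k - l)%N) => d.
elim: d l lk => [|d IH] l lk le_d; rewrite /fkrow.
  rewrite index_iota_geq /=; last by lia.
  by apply/funext => a; rewrite /wprod /=; do ?case: ifP; lia.
have [kl|{}lk] := leqP k l.
  rewrite index_iota_geq //=.
  by apply/funext => a; rewrite /wprod /=; do ?case: ifP; lia.
rewrite rev_iota_ltn // map_rcons wprod_rcons IH //; last by lia.
by apply/funext => a /=; rewrite /adj_swap; do !case: ifP; lia.
Qed.

Lemma wprod_fkred k i x y : (i <= k)%N ->
  wprod (fkred k i x y) = fun a => if (i <= a <= k)%N then (k + i - a)%N else a.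
Proof.
move=> ik; move: {2}(k - i)%N (leqnn (k - i)%N) => d.
elim: d i ik => [|d IH] i ik le_d; rewrite /fkred.
  rewrite index_iota_geq /=; last by lia.
  by apply/funext => a; rewrite /wprod /=; case: ifP; lia.
have [ki|{}ik] := leqP k i.
  by rewrite index_iota_geq //=; apply/funext => a; rewrite /wprod /=; case: ifP; lia.
rewrite index_iota_ltn //= wprod_cat -/(fkred k i.+1 x y) IH //; last by lia.
rewrite wprod_fkrow; last by lia.
by apply/funext => a /=; do !case: ifP; lia.
Qed.

Lemma size_fkred k x y : size (fkred k 0 x y) = (\sum_(0 <= i < k) (k - i))%N.
Proof.
rewrite size_flatten /shape -map_comp sumnE big_map; apply: eq_bigr => i _ /=.
by rewrite size_map size_rev size_iota.
Qed.

Lemma bounded_fkred k x y : bounded_word k.+1 (fkred k 0 x y).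
Proof.
apply/allP => p /flattenP[s /mapP[i _ ->]] /mapP[j].
by rewrite mem_rev mem_index_iota => h -> /=; lia.
Qed.

Lemma perm_nat_w0 n a : perm_nat (perm_w0 n) a = if (a < n)%N then (n.-1 - a)%N else a.
Proof.
case: ltnP => h; last exact: perm_nat_geq.
by rewrite perm_nat_lt permE /=; lia.
Qed.

Lemma perm_len_w0 k : perm_len (perm_w0 k.+1) = (\sum_(0 <= i < k) (k - i))%N.
Proof.
transitivity (\sum_(a < k.+1) (k - a))%N; last first.
  by rewrite -(big_mkord xpredT (fun a => k - a)%N) big_nat_recr //= subnn addn0.
rewrite perm_lenE -sum1_card.
rewrite (eq_bigl (fun p : 'I_k.+1 * 'I_k.+1 => true && (p.1 < p.2)%N)); last first.
  move=> [a b]; rewrite inE /= !permE /=.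
  by have := ltn_ord a; have := ltn_ord b; lia.
rewrite -(pair_big_dep xpredT (fun a b : 'I_k.+1 => (a < b)%N) (fun _ _ => 1%N)) /=.
apply: eq_bigr => a _.
rewrite -(big_mkord (fun b => (a < b)%N) (fun _ => 1%N)).
rewrite -(@big_nat_widenl _ _ _ a.+1 0 k.+1 xpredT) //.
by rewrite sum_nat_const_nat muln1 subSS.
Qed.

Lemma fk_top k x y : actw (fkred k 0 x y) eid (perm_nat (perm_w0 k.+1)) =
  \prod_(i < k.+1) \prod_(j < k.+1 | (i.+1 + j.+1 <= k.+1)%N) (x i + y j - x i * y j).
Proof.
rewrite (actw_top (bounded_fkred k x y)); first last.
- by rewrite perm_len_w0 size_fkred.
- rewrite wprod_fkred //; apply/funext => a; rewrite perm_nat_w0.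
  by rewrite ltnS /=; case: ifP => //; lia.
rewrite -(big_mkord xpredT (fun i => \prod_(j < k.+1 | (i.+1 + j.+1 <= k.+1)%N) (x i + y j - x i * y j))).
rewrite big_nat_recr //= [X in _ * X]big1 ?mulr1; last by move=> j; lia.
rewrite /fkred; rewrite big_flatten big_map /=; apply: eq_big_nat => i /andP[_ ik].
rewrite /fkrow big_map (perm_big _ (permEl (perm_rev _))) /=.
rewrite -(big_mkord (fun j => (i.+1 + j.+1 <= k.+1)%N) (fun j => x i + y j - x i * y j)).
rewrite -{1}[i]add0n big_addn.
rewrite (@big_nat_widen _ _ _ 0 (k - i) k.+1); last by lia.
by apply: eq_big => j; [lia|rewrite addnK].
Qed.

End TopCoefficient.

(** * Double Grothendieck polynomials *)

(** Words take sequences of parameters indexed by all of [nat]; the value 0 from n on is neutral,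
    since a letter with parameter 0 acts as the identity. *)
Definition xvar n (k : nat) : {mpoly {mpoly int[n]}[n]} :=
  if insub k is Some a then 'X_a else 0.
Definition yvar n (k : nat) : {mpoly {mpoly int[n]}[n]} :=
  if insub k is Some a then ('X_a)%:MP else 0.

Definition pol2 n : idomainType := {mpoly {mpoly int[n]}[n]}.

Lemma xvar_ord n (a : 'I_n) : xvar n a = 'X_a.
Proof. by rewrite /xvar valK. Qed.

Lemma yvar_ord n (a : 'I_n) : yvar n a = ('X_a)%:MP.
Proof. by rewrite /yvar valK. Qed.

Lemma xvar1_neq0 n k : 1 - xvar n k != 0.
Proof.
apply/negP => /eqP/(congr1 (mcoeff 0%MM)).
rewrite mcoeffB mcoeff1 eqxx mcoeff0 /xvar; case: insubP => [a _ _|_]; last first.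
  by rewrite mcoeff0 subr0 => /eqP; rewrite oner_eq0.
by rewrite mcoeffX mnm1_eq0 subr0 => /eqP; rewrite oner_eq0.
Qed.

(* Deciding that both ring structures agree is slow by unification, and fast in the
   kernel. *)
Lemma xvar1_pol2 n k : 1 - (xvar n k : pol2 n) != 0.
Proof. exact_no_check (xvar1_neq0 n k). Qed.

Lemma yvar1_neq0 n k : 1 - yvar n k != 0.
Proof.
apply/negP => /eqP/(congr1 (fun p => (mcoeff 0%MM p)@_0%MM)).
rewrite mcoeffB mcoeff1 eqxx mcoeff0 /yvar; case: insubP => [a _ _|_]; last first.
  by rewrite !mcoeff0 subr0 mcoeff1 eqxx => /eqP; rewrite oner_eq0.
rewrite mcoeffC eqxx mulr1 mcoeffB mcoeff1 eqxx mcoeffX mnm1_eq0 subr0.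
by rewrite mcoeff0 => /eqP; rewrite oner_eq0.
Qed.

Lemma yvar1_pol2 n k : 1 - (yvar n k : pol2 n) != 0.
Proof. exact_no_check (yvar1_neq0 n k). Qed.

Lemma msym_tpermX (R : comNzRingType) n (s : 'S_n) (a : 'I_n) :
  msym s ('X_a : {mpoly R[n]}) = 'X_(s a).
Proof.
rewrite msymX; congr 'X_[_]; apply/mnmP => b; rewrite mnmE !mnm1E.
by rewrite (can2_eq (permK s) (permKV s)).
Qed.

Lemma msym_xvar n (i j : 'I_n) k : j = i.+1 :> nat ->
  msym (tperm i j) (xvar n k) = xvar n (adj_swap i k).
Proof.
move=> ji; have [nk|kn] := leqP n k.
  rewrite adj_swapD; first by rewrite /xvar insubF ?msym0 // ltnNge nk.
    by have := ltn_ord i; lia.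
  by have := ltn_ord j; lia.
rewrite -[k]/(val (Ordinal kn)) xvar_ord msym_tpermX -xvar_ord; congr xvar.
have := perm_nat_tperm 1%g ji; rewrite mulg1 => /(congr1 (fun f => f k)) /=.
rewrite perm_nat_lt => ->; rewrite /perm_nat; case: insubP => [a _ <-|]; rewrite ?perm1 //.
Qed.

Lemma msym_yvar n (s : 'S_n) k : msym s (yvar n k) = yvar n k.
Proof.
rewrite /yvar; case: insubP => [a _ _|_]; rewrite ?msym0 //.
by rewrite -alg_mpolyC linearZ /= rmorph1.
Qed.

Lemma xget_mull (R : idomainType) (a b g : R) : a != 0 -> a * g = b ->
  xget 0 [set h | a * h = b] = g.
Proof.
move=> nz gE; case: xgetP => [h _ /= hE|/(_ _ gE)//].
by apply: (mulfI nz); rewrite gE hE.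
Qed.

(** The hypotheses are [fkw_swap] read at w, where the ascent makes [hact] trivial, and at w s_i.
    Primes refer to w s_i and the letter s to exchanged variables; the conclusion is the equation
    that defines [isobaric]. *)
Lemma isobaric_solve (R : comNzRingType) (xi xj F F' Fs Fs' : R) : F = Fs ->
  (1 - xj) * F' + xj * F = (1 - xi) * Fs' + xi * Fs ->
  (xi - xj) * F = (1 - xj) * F' - (1 - xi) * Fs'.
Proof.
move=> eF; rewrite -eF => h.
rewrite -[(1 - xj) * F'](addrK (xj * F)) h; ring.
Qed.

Section GrothWord.
Variable k : nat.
Local Notation pol := {mpoly {mpoly int[k.+1]}[k.+1]}.

Definition fk_poly (w : nat -> nat) : pol :=
  actw (fkw k (xvar k.+1) (yvar k.+1)) (@eid _) w.

Lemma fk_poly_w0 : fk_poly (perm_nat (perm_w0 k.+1)) = groth_w0 k.+1.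
Proof.
rewrite /fk_poly /fkw fk_reduce fk_top /groth_w0.
by apply: eq_bigr => i _; apply: eq_bigr => j _; rewrite xvar_ord yvar_ord.
Qed.

Lemma fk_poly_msym (i j : 'I_k.+1) w : j = i.+1 :> nat ->
  msym (tperm i j) (fk_poly w) =
  actw (fkw k (xvar k.+1 \o adj_swap i) (yvar k.+1)) (@eid _) w.
Proof.
move=> ji; rewrite /fk_poly actw_morph /fkw mapw_cat; congr actw; last first.
  by apply/funext => u; rewrite /eid /= rmorph_nat.
rewrite /fkA /fkB /mapw !map_flatten -!map_comp.
congr (flatten _ ++ flatten _); apply: eq_map => a.
  by rewrite -[LHS]/(mapw _ (incw _ _ _)) mapw_inc /= msym_yvar.
by rewrite -[LHS]/(mapw _ (decw _ _ _)) mapw_dec /= msym_xvar.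
Qed.

Lemma fk_poly_isobaric (w : 'S_k.+1) (i j : 'I_k.+1) : j = i.+1 :> nat -> (w i < w j)%N ->
  isobaric i j (fk_poly (perm_nat (tperm i j * w))) = fk_poly (perm_nat w).
Proof.
move=> ji wij.
have nz : ('X_i - 'X_j : pol) != 0.
  rewrite subr_eq0; apply/negP => /eqP/(congr1 (mcoeff U_(i))).
  rewrite !mcoeffXU eqxx -val_eqE /= ji; case: eqP => [|_]; first lia.
  by move/eqP; rewrite oner_eq0.
pose Fs := actw (fkw k (xvar k.+1 \o adj_swap i) (yvar k.+1)) (@eid pol).
have E u : hact i 'X_j fk_poly u = hact i 'X_i Fs u.
  have ik : (i < k)%N by have := ltn_ord j; lia.
  rewrite -!xvar_ord {1}ji.
  exact_no_check (@fkw_swap (pol2 k.+1) k i _ (yvar k.+1) (@eid pol) u (xvar1_pol2 k.+1) ik).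
set w' := (tperm i j * w)%g.
have h1 : fk_poly (perm_nat w) = Fs (perm_nat w).
  have := E (perm_nat w); rewrite /hact -ji !perm_nat_ord ltnNge ltnW //.
have h2 : (1 - 'X_j) * fk_poly (perm_nat w') + 'X_j * fk_poly (perm_nat w) =
          (1 - 'X_i) * Fs (perm_nat w') + 'X_i * Fs (perm_nat w).
  have := E (perm_nat w'); rewrite /hact -ji !perm_nat_ord !permM tpermL tpermR wij.
  by rewrite /w' (perm_nat_tperm _ ji) adj_swapKf.
have h3 : ('X_i - 'X_j) * fk_poly (perm_nat w) = (1 - 'X_j) * fk_poly (perm_nat w') -
   (1 - 'X_i) * msym (tperm i j) (fk_poly (perm_nat w')).
  by rewrite fk_poly_msym // -/Fs; apply: isobaric_solve h1 h2.
exact_no_check (@xget_mull (pol2 k.+1) _ _ _ nz h3).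
Qed.

(** Each recursive call spends one unit of fuel and gains one inversion, so the sum is invariant. As
    there are at most (k+1)^2 inversions, the longest permutation is reached before the fuel is used
    up. *)
Lemma groth_recE f (w : 'S_k.+1) : (k.+1 * k.+1 < f + perm_len w)%N ->
  groth_rec f w = fk_poly (perm_nat w).
Proof.
elim: f w => [|f IH] w h.
  have : (perm_len w <= k.+1 * k.+1)%N.
    by rewrite perm_lenE -[X in (_ <= X * X)%N]card_ord -card_prod max_card.
  by lia.
rewrite /=; case: eqP => [->|nw0]; first by rewrite fk_poly_w0.
case: pickP => [[i j] /= /andP[/eqP ji /eqP hl]|none].
  rewrite IH; last by rewrite hl; lia.
  apply: fk_poly_isobaric => //; rewrite ltnNge; apply/negP => le.
  suff wij : (w j < w i)%N by have := perm_len_descent ji wij; lia.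
  rewrite ltn_neqAle le andbT; apply/negP => /eqP /val_inj/perm_inj e.
  by move: ji; rewrite e; lia.
exfalso; apply: nw0; apply: perm_ascent_exists => i j ji.
rewrite ltnNge; apply/negP => le.
have wij : (w i < w j)%N.
  rewrite ltn_neqAle le andbT; apply/negP => /eqP /val_inj/perm_inj e.
  by move: ji; rewrite e; lia.
by have := none (i, j); rewrite /= ji eqxx (perm_len_ascent ji wij) eqxx.
Qed.

Lemma grothE (w : 'S_k.+1) : groth w = fk_poly (perm_nat w).
Proof. by apply: groth_recE; rewrite /=; lia. Qed.

End GrothWord.

Lemma adj_swap_mono j a b : ~~ ((a == j) && (b == j.+1)) -> ~~ ((a == j.+1) && (b == j)) ->
  (adj_swap j a < adj_swap j b)%N = (a < b)%N.
Proof. by rewrite /adj_swap; do !case: eqP => //=; lia. Qed.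

(** * Inverses, reduction to 0/1-sequences, and removal of an inert prefix *)

Section Restriction.
Variable R : comNzRingType.
Implicit Types (W : seq (nat * R)) (f : (nat -> nat) -> R).

(* The word acts on the left of the unit by its first letter: this is the
   multiplication of w by s_i on the side of its values. *)
Lemma actw_cons_eid i (z : R) W (v v' : nat -> nat) : cancel v v' -> cancel v' v ->
  actw ((i, z) :: W) (@eid R) v =
  if (v' i.+1 < v' i)%N
  then (1 - z) * actw W (@eid R) v + z * actw W (@eid R) (adj_swap i \o v)
  else actw W (@eid R) v.
Proof.
elim/last_ind: W v v' => [|W [j y] IH] v v' vK v'K.
  rewrite /actw /= /hact.
  have swE : eid R (v \o adj_swap i) = eid R (adj_swap i \o v).
    congr (nat_of_bool _)%:R; apply/asboolP/asboolP => e; apply/funext => k /=.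
      have ee u : v u = adj_swap i u.
        by have := congr1 (fun g => g (adj_swap i u)) e; rewrite /= adj_swapK.
      by rewrite ee adj_swapK.
    have ee u : v u = adj_swap i u.
      by have := congr1 (fun g => adj_swap i (g u)) e; rewrite /= adj_swapK.
    by rewrite ee adj_swapK.
  rewrite swE; rewrite /eid; case: asboolP => [vid|nvid].
    have v'id u : v' u = u by have := congr1 v' (congr1 (fun g => g u) vid); rewrite vK.
    by rewrite vid !v'id /=.
  case: asboolP => [vs|nvs]; last by rewrite !mulr0 addr0; do 2!case: ifP.
  have ee u : v u = adj_swap i u.
    by have := congr1 (fun g => adj_swap i (g u)) vs; rewrite /= adj_swapK.
  have ee' u : v' u = adj_swap i u by rewrite -{1}[u](adj_swapK i) -ee vK.
  by rewrite !ee !ee'.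
rewrite -rcons_cons !actw_rcons /hact /=.
have sK : cancel (v \o adj_swap j) (adj_swap j \o v') by move=> u /=; rewrite vK adj_swapK.
have sK' : cancel (adj_swap j \o v') (v \o adj_swap j) by move=> u /=; rewrite adj_swapK v'K.
rewrite (IH _ _ vK v'K) (IH _ _ sK sK') /=.
(* The first two cases are those in which exchanging the values i, i + 1 and exchanging the
   positions j, j + 1 is the same operation. Otherwise neither exchange affects the descent tested
   by the other. *)
have [/andP[/eqP e1 /eqP e2]|h1] := boolP ((v' i == j) && (v' i.+1 == j.+1)).
  have e3 : v j = i by rewrite -e1 v'K.
  have e4 : v j.+1 = i.+1 by rewrite -e2 v'K.
  by rewrite e1 e2 e3 e4 !ltnNge !leqW.
have [/andP[/eqP e1 /eqP e2]|h2] := boolP ((v' i == j.+1) && (v' i.+1 == j)).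
  have e3 : v j = i.+1 by rewrite -e2 v'K.
  have e4 : v j.+1 = i by rewrite -e1 v'K.
  rewrite e1 e2 e3 e4 !adj_swapL !adj_swapR !ltnSn ![(_.+1 < _)%N]ltnNge !leqW //=.
  have -> : adj_swap i \o v = v \o adj_swap j.
    apply/funext => k /=; rewrite {2}/adj_swap; case: eqP => [->|kj].
      by rewrite e3 e4 adj_swapR.
    case: eqP => [->|kj1]; first by rewrite e3 e4 adj_swapL.
    rewrite adj_swapD //; apply/eqP => e; [apply: kj1|apply: kj].
      by rewrite -[k]vK e e1.
    by rewrite -[k]vK e e2.
  by ring.
have -> : (adj_swap j (v' i.+1) < adj_swap j (v' i))%N = (v' i.+1 < v' i)%N.
  by apply: adj_swap_mono; rewrite andbC.
have -> : (adj_swap i (v j.+1) < adj_swap i (v j))%N = (v j.+1 < v j)%N.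
  have vE a b : (v a == b) = (v' b == a) by apply/eqP/eqP => <-; rewrite ?vK ?v'K.
  by apply: adj_swap_mono; rewrite !vE // andbC.
rewrite compA; case: ifP => _; case: ifP => _ //; ring.
Qed.

(** Inversion of permutations is an anti-automorphism of the 0-Hecke algebra that fixes every u_i,
    so it reverses words. *)
Lemma actw_rev_eid W (v v' : nat -> nat) : cancel v v' -> cancel v' v ->
  actw W (@eid R) v = actw (rev W) (@eid R) v'.
Proof.
elim/last_ind: W v v' => [|W [i z] IH] v v' vK v'K.
  rewrite /actw /=; congr (nat_of_bool _)%:R; apply/asboolP/asboolP => e; apply/funext => k /=.
    by have := congr1 v' (congr1 (fun g => g k) e); rewrite vK.
  by have := congr1 v (congr1 (fun g => g k) e); rewrite v'K.
rewrite rev_rcons (actw_cons_eid _ _ _ v'K vK) actw_rcons /hact /=.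
rewrite !(IH _ _ vK v'K) (IH (v \o adj_swap i) (adj_swap i \o v')) //.
  by move=> u /=; rewrite vK adj_swapK.
by move=> u /=; rewrite adj_swapK v'K.
Qed.

Definition proj01 (p : nat) (u : nat -> nat) (k : nat) : nat := (p <= u k)%N.

Definition delta01 (p : nat) (v : nat -> nat) : R := `[< v = proj01 p id >]%:R.

(** The last hypothesis says that u is the shortest element of its coset for permutations of the
    values below p and of those from p on. At a descent of such a u the two values lie on different
    sides of p; hence u and its 0/1-sequence have the same descents, and exchanging the two values
    gives a shortest element again. *)
Lemma actw_proj01 p W (u u' : nat -> nat) : cancel u u' -> cancel u' u ->
  (forall a b, (a < b)%N -> (p <= u a)%N = (p <= u b)%N -> (u a < u b)%N) ->
  actw W (@eid R) u = actw W (delta01 p) (proj01 p u).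
Proof.
elim/last_ind: W u u' => [|W [j z] IH] u u' uK u'K umin.
  rewrite /actw /=; congr (nat_of_bool _)%:R; apply/asboolP/asboolP => [->//|e].
  have cl k : (p <= u k)%N = (p <= k)%N.
    by have := congr1 (fun g => g k) e; rewrite /proj01 /=; case: (p <= u k)%N; case: (p <= k)%N.
  apply/funext => k /=; have [d] := ubnP k; elim: d k => // d IHd k kd.
  case: (ltngtP (u k) k) => // lt; exfalso.
    have := IHd (u k) (leq_trans lt kd) => /(congr1 u').
    by rewrite !uK => e'; move: lt; rewrite e' ltnn.
  have [mk|mk|mk] := ltngtP (u' k) k.
  - have := IHd (u' k) (leq_trans mk kd); rewrite u'K => e'.
    by move: mk; rewrite -e' ltnn.
  - have := umin _ _ mk; rewrite u'K cl => /(_ erefl); lia.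
  - by move: lt; rewrite -{2}mk u'K ltnn.
rewrite !actw_rcons /hact /=.
have -> : (proj01 p u j.+1 < proj01 p u j)%N = (u j.+1 < u j)%N.
  rewrite /proj01; have := umin j j.+1 (ltnSn j).
  by case: (leqP p (u j)); case: (leqP p (u j.+1)) => h1 h2 /= h; try lia;
     have := h erefl; lia.
rewrite (IH _ _ uK u'K umin); case: ifP => // dsc.
rewrite (IH (u \o adj_swap j) (adj_swap j \o u')) //.
- by move=> x /=; rewrite uK adj_swapK.
- by move=> x /=; rewrite adj_swapK u'K.
move=> a b ab /=.
have [/andP[/eqP -> /eqP ->]|h1] := boolP ((a == j) && (b == j.+1)).
  rewrite adj_swapL adj_swapR => cl.
  by have := umin _ _ (ltnSn j) (esym cl); lia.
by apply: umin; rewrite adj_swap_mono //; lia.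
Qed.

Lemma actw_nonzero W f : actw W f = actw [seq p <- W | p.2 != 0] f.
Proof.
elim/last_ind: W => // W [i z] IH; rewrite filter_rcons actw_rcons IH /=.
by case: eqP => [->|_] /=; rewrite ?hact0 ?actw_rcons.
Qed.

Definition lift_nat (s : nat) (g : nat -> nat) (w : nat -> nat) (k : nat) : nat :=
  if (k < s)%N then g k else w (k - s)%N.

Definition shiftw s W := [seq ((p.1 - s)%N, p.2) | p <- W & (s <= p.1)%N].

Lemma adj_swap_lift s g w i : (s <= i)%N ->
  lift_nat s g w \o adj_swap i = lift_nat s g (w \o adj_swap (i - s)).
Proof.
move=> si; apply/funext => k; rewrite /lift_nat /= /adj_swap.
by do !case: ifP => //; try lia; move=> *; congr w; lia.
Qed.

(** [P] is an invariant of the tail that rules out descents inside the prefix and at its junction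
    with the tail. Letters below s then act trivially and the others act on the tail. *)
Lemma actw_shift s g W f w (P : (nat -> nat) -> Prop) :
  (forall u i, P u -> P (u \o adj_swap i)) ->
  (forall u i, P u -> (i < s)%N -> (lift_nat s g u i <= lift_nat s g u i.+1)%N) ->
  P w -> actw W f (lift_nat s g w) = actw (shiftw s W) (f \o lift_nat s g) w.
Proof.
move=> Psw Pasc; elim/last_ind: W w => // W [i z] IH w Pw.
rewrite /shiftw filter_rcons actw_rcons /hact /=.
have [si|is_] := leqP s i; last by rewrite ltnNge Pasc //= IH.
rewrite map_rcons actw_rcons /hact /= -/(shiftw s W) IH // adj_swap_lift // IH; last exact: Psw.
by rewrite /lift_nat !ltnNge si leqW //= subSn.
Qed.

Lemma shiftw_cat s W V : shiftw s (W ++ V) = shiftw s W ++ shiftw s V.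
Proof. by rewrite /shiftw filter_cat map_cat. Qed.

Lemma shiftw_flatten s (T : Type) (F : T -> seq (nat * R)) t :
  shiftw s (flatten [seq F j | j <- t]) = flatten [seq shiftw s (F j) | j <- t].
Proof. by elim: t => //= a t IH; rewrite shiftw_cat IH. Qed.

Lemma shiftw_inc s k j (z : R) : (j <= s)%N -> shiftw s (incw k j z) = incw (k - s) 0 z.
Proof.
move=> js; rewrite /shiftw /incw filter_map -map_comp /=.
have [ks|sk] := leqP k s.
  rewrite (index_iota_geq (_ : k - s <= 0)%N) /=; last by lia.
  rewrite (_ : filter _ _ = [::]) //; apply/eqP; rewrite -(negbK (_ == _)) -has_filter.
  by apply/hasPn => i; rewrite mem_index_iota /= => h; lia.
have -> : index_iota j k = index_iota j s ++ index_iota s k.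
  by rewrite /index_iota -{2}(subnKC js) -iotaD; congr iota; lia.
rewrite filter_cat (_ : filter _ (index_iota j s) = [::]); last first.
  apply/eqP; rewrite -(negbK (_ == _)) -has_filter.
  by apply/hasPn => i; rewrite mem_index_iota /= => h; lia.
rewrite (_ : filter _ _ = index_iota s k); last first.
  by apply/all_filterP/allP => i; rewrite mem_index_iota /=; lia.
have -> : index_iota s k = map (addn s) (index_iota 0 (k - s)).
  by rewrite /index_iota subn0 -iotaDl addn0.
rewrite -map_comp /=.
by apply: eq_map => i /=; rewrite addKn.
Qed.

Lemma rev_incw k j (z : R) : rev (incw k j z) = decw k j z.
Proof. by rewrite /incw /decw map_rev. Qed.

Lemma rev_decw k j (z : R) : rev (decw k j z) = incw k j z.
Proof. by rewrite -rev_incw revK. Qed.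

Lemma shiftw_dec s k j (z : R) : (j <= s)%N -> shiftw s (decw k j z) = decw (k - s) 0 z.
Proof.
by move=> js; rewrite -!rev_incw /shiftw filter_rev map_rev -(shiftw_inc _ _ js).
Qed.

Lemma weq_dec0 k j : weq (decw k j (0 : R)) [::].
Proof.
move=> f; rewrite actw_nonzero (_ : filter _ _ = [::]) //.
apply/eqP; rewrite -(negbK (_ == _)) -has_filter.
by apply/hasPn => p /mapP[i _ ->] /=; rewrite eqxx.
Qed.

Lemma weq_inc0 k j : weq (incw k j (0 : R)) [::].
Proof.
move=> f; rewrite actw_nonzero (_ : filter _ _ = [::]) //.
apply/eqP; rewrite -(negbK (_ == _)) -has_filter.
by apply/hasPn => p /mapP[i _ ->] /=; rewrite eqxx.
Qed.

End Restriction.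

(** * Coefficients of products after renaming variables *)

Section Substitution.
Variables (R : comNzRingType).

Definition ivar N (k : nat) : {mpoly R[N]} := if insub k is Some a then 'X_a else 0.

Lemma mmap1_ivar n N (s : nat -> nat) (m : 'X_{1..n}) :
  mmap1 (fun i : 'I_n => ivar N (s i)) m =
  if [forall i : 'I_n, (s i < N)%N || (m i == 0%N)]
  then 'X_[ [multinom (\sum_(i < n | s i == k) m i)%N | k < N] ] else 0.
Proof.
case: ifP => [/forallP good|/negbT]; last first.
  rewrite negb_forall => /existsP[i]; rewrite negb_or -leqNgt => /andP[Ns mi].
  rewrite /mmap1 (bigD1 i) //= /ivar insubF; last by rewrite ltnNge Ns.
  by rewrite expr0n (negbTE mi) mul0r.
pose u (i : 'I_n) : 'X_{1..N} := if insub (s i) is Some k then (U_(k) *+ m i)%MM else 0%MM.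
rewrite /mmap1 (eq_bigr (fun i => 'X_[u i])); last first.
  move=> i _; rewrite /ivar /u; case: insubP => [k _ _|]; first by rewrite -mpolyXn.
  by have := good i; case: ltnP => //= _ /eqP ->; rewrite expr0 mpolyX0.
rewrite -(big_morph _ (@mpolyXD _ _) (@mpolyX0 _ _)); congr 'X_[_].
apply/mnmP => k; rewrite mnm_sumE mnmE [RHS]big_mkcond /=; apply: eq_bigr => i _.
rewrite /u; case: insubP => [j _ jE|].
  by rewrite mulmnE mnm1E -jE -val_eqE /=; case: eqP => _; rewrite ?mul1n ?mul0n.
by rewrite mnm0E -leqNgt; case: eqP => // ->; rewrite leqNgt ltn_ord.
Qed.

Lemma mcoeff_mmap1_ivarM n1 n2 N (s1 s2 : nat -> nat) (m : 'X_{1..n1}) (q : 'X_{1..n2})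
    (a1 a2 c : nat -> nat) :
  (forall i j : 'I_n1, s1 i = s1 j -> i = j) ->
  (forall i j : 'I_n2, s2 i = s2 j -> i = j) ->
  (forall (i : 'I_n1) (j : 'I_n2), s1 i <> s2 j) ->
  (forall k, (k < N)%N -> (exists i : 'I_n1, s1 i = k) \/ (exists i : 'I_n2, s2 i = k)) ->
  (forall k, (N <= k)%N -> c k = 0%N) ->
  (forall i : 'I_n1, c (s1 i) = a1 i) -> (forall i : 'I_n2, c (s2 i) = a2 i) ->
  (mmap1 (fun i : 'I_n1 => ivar N (s1 i)) m * mmap1 (fun i : 'I_n2 => ivar N (s2 i)) q)
    @_[multinom c i | i < N] =
  ((m == [multinom a1 i | i < n1]) && (q == [multinom a2 i | i < n2]))%:R.
Proof.
move=> inj1 inj2 dis cov cN c1 c2; rewrite !mmap1_ivar.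
case: ifP => [/forallP good1|/negbT]; last first.
  rewrite negb_forall => /existsP[i]; rewrite negb_or -leqNgt => /andP[Ns mi].
  rewrite mul0r mcoeff0; case: eqP => //= e.
  by move: mi; rewrite e mnmE -c1 cN.
case: ifP => [/forallP good2|/negbT]; last first.
  rewrite negb_forall => /existsP[i]; rewrite negb_or -leqNgt => /andP[Ns mi].
  rewrite mulr0 mcoeff0 andbC; case: eqP => //= e.
  by move: mi; rewrite e mnmE -c2 cN.
rewrite -mpolyXD mcoeffX; congr (nat_of_bool _)%:R.
have val1 (i : 'I_n1) : (\sum_(j < n1 | s1 j == s1 i) m j = m i)%N.
  by rewrite (big_pred1 i) // => j; apply/eqP/eqP => [/inj1|->].
have val2 (i : 'I_n2) : (\sum_(j < n2 | s2 j == s2 i) q j = q i)%N.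
  by rewrite (big_pred1 i) // => j; apply/eqP/eqP => [/inj2|->].
have val12 (i : 'I_n1) : (\sum_(j < n2 | s2 j == s1 i) q j = 0)%N.
  by rewrite big_pred0 // => j; apply/eqP => /esym; apply: dis.
have val21 (i : 'I_n2) : (\sum_(j < n1 | s1 j == s2 i) m j = 0)%N.
  by rewrite big_pred0 // => j; apply/eqP; apply: dis.
apply/eqP/andP => [e|[/eqP -> /eqP ->] {val1 val2 val12 val21}].
  split; apply/eqP/mnmP => i; rewrite mnmE.
    have := good1 i; case: ltnP => [lt _|le /= /eqP ->]; last by rewrite -c1 cN.
    have := congr1 (fun h : 'X_{1..N} => h (Ordinal lt)) e.
    by rewrite mnmDE !mnmE /= val1 val12 addn0 c1.
  have := good2 i; case: ltnP => [lt _|le /= /eqP ->]; last by rewrite -c2 cN.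
  have := congr1 (fun h : 'X_{1..N} => h (Ordinal lt)) e.
  by rewrite mnmDE !mnmE /= val2 val21 add0n c2.
apply/mnmP => k; rewrite mnmDE !mnmE.
under eq_bigr do rewrite mnmE.
under [X in (_ + X)%N]eq_bigr do rewrite mnmE.
have [[i ik]|[i ik]] := cov k (ltn_ord k); rewrite -ik.
  rewrite (big_pred1 i); last by move=> j; apply/eqP/eqP => [/inj1|->].
  by rewrite big_pred0 ?addn0 // => j; apply/eqP => /esym; apply: dis.
rewrite big_pred0 ?add0n; last by move=> j; apply/eqP; apply: dis.
by rewrite (big_pred1 i) ?c2 // => j; apply/eqP/eqP => [/inj2|->].
Qed.

Lemma sum_msupp_coeff (R1 : comNzRingType) (phi : {rmorphism R1 -> R}) n (F : {mpoly R1[n]}) a :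
  \sum_(m <- msupp F) phi F@_m * (m == a)%:R = phi F@_a.
Proof.
have [aF|aF] := boolP (a \in msupp F).
  rewrite (bigD1_seq a) ?msupp_uniq //= eqxx mulr1 big1 ?addr0 // => m /negbTE ->.
  by rewrite mulr0.
rewrite memN_msupp_eq0 // rmorph0 big_seq big1 // => m mF.
by case: eqP => [ma|_]; [rewrite -ma mF in aF|rewrite mulr0].
Qed.

Variables (R1 R2 : comNzRingType) (phi1 : {rmorphism R1 -> R}) (phi2 : {rmorphism R2 -> R}).

(** The two families of variables are put at disjoint places that together cover the indices below
    N, so a monomial splits in exactly one way. Variables sent to N or beyond become 0, in
    accordance with c vanishing there. *)
Lemma mcoeff_mmap_ivarM n1 n2 N (s1 s2 : nat -> nat) (a1 a2 c : nat -> nat)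
    (F : {mpoly R1[n1]}) (G : {mpoly R2[n2]}) :
  (forall i j : 'I_n1, s1 i = s1 j -> i = j) ->
  (forall i j : 'I_n2, s2 i = s2 j -> i = j) ->
  (forall (i : 'I_n1) (j : 'I_n2), s1 i <> s2 j) ->
  (forall k, (k < N)%N -> (exists i : 'I_n1, s1 i = k) \/ (exists i : 'I_n2, s2 i = k)) ->
  (forall k, (N <= k)%N -> c k = 0%N) ->
  (forall i : 'I_n1, c (s1 i) = a1 i) -> (forall i : 'I_n2, c (s2 i) = a2 i) ->
  (mmap (@mpolyC N R \o phi1) (fun i : 'I_n1 => ivar N (s1 i)) F *
   mmap (@mpolyC N R \o phi2) (fun i : 'I_n2 => ivar N (s2 i)) G)@_[multinom c i | i < N] =
  phi1 F@_[multinom a1 i | i < n1] * phi2 G@_[multinom a2 i | i < n2].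
Proof.
move=> inj1 inj2 dis cov cN c1 c2.
rewrite /mmap big_distrlr /= raddf_sum /=.
rewrite -(sum_msupp_coeff phi1) -(sum_msupp_coeff phi2) big_distrlr /=.
apply: eq_bigr => m _; rewrite raddf_sum; apply: eq_bigr => q _ /=.
rewrite mulrACA -mpolyCM mcoeffCM (mcoeff_mmap1_ivarM _ _ inj1 inj2 dis cov cN c1 c2).
by rewrite -mulnb natrM mulrACA.
Qed.
End Substitution.

(** * Stable limits *)

Section FullWords.
Variable R : comNzRingType.
Implicit Types (W : seq (nat * R)) (f : (nat -> nat) -> R) (x y : nat -> R).

Definition decs (k M : nat) x := flatten [seq decw k 0 (x j) | j <- iota 0 M].
Definition incs (k M : nat) x := flatten [seq incw k 0 (x j) | j <- rev (iota 0 M)].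

Lemma actw_monotone_comp h W f u : {homo h : a b / (a < b)%N} ->
  actw W f (h \o u) = actw W (fun v => f (h \o v)) u.
Proof.
move=> hh; elim/last_ind: W u => // W [i z] IH u; rewrite !actw_rcons /hact /=.
have -> : (h (u i.+1) < h (u i))%N = (u i.+1 < u i)%N.
  have [lt|le] := ltnP (u i.+1) (u i); first by rewrite hh.
  by apply/negbTE; rewrite -leqNgt; move: le; rewrite leq_eqVlt => /orP[/eqP ->|/hh/ltnW].
by rewrite -compA !IH.
Qed.

Lemma fkA_trunc k M x : (forall j, (M <= j)%N -> x j = 0) -> (M <= k.+1)%N ->
  weq (fkA k 0 x) (flatten [seq decw k j (x j) | j <- iota 0 M]).
Proof.
move=> x0 Mk; rewrite /fkA /index_iota subn0 -(subnKC Mk) iotaD map_cat flatten_cat.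
rewrite -[X in weq _ X]cats0; apply: weq_catl; rewrite add0n.
have z d : forall j, (M <= j)%N -> weq (flatten [seq decw k j (x j) | j <- iota j d]) [::].
  elim: d => // d IH j Mj /=; rewrite x0 //.
  by apply: (weq_trans (weq_catr _ (weq_dec0 k j))); apply: IH; lia.
exact: z.
Qed.

Lemma fkB_trunc k M y : (forall j, (M <= j)%N -> y j = 0) -> (M <= k)%N ->
  weq (fkB k 0 y) (flatten [seq incw k j (y j) | j <- rev (iota 0 M)]).
Proof.
move=> y0 Mk.
have -> : fkB k 0 y = flatten [seq incw k j (y j) | j <- rev (index_iota 0 k)].
  by congr flatten; apply: eq_map => j; rewrite subn0.
rewrite /index_iota subn0 -{2}(subnKC Mk) iotaD rev_cat map_cat flatten_cat.
rewrite -[X in weq _ X]cat0s; apply: weq_catr; rewrite add0n.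
have z d : forall j, (M <= j)%N -> weq (flatten [seq incw k j (y j) | j <- rev (iota j d)]) [::].
  elim: d => // d IH j Mj /=; rewrite rev_cons map_rcons flatten_rcons y0 //.
  by apply: (weq_trans (weq_catl _ (weq_inc0 k j))); rewrite cats0; apply: IH; lia.
exact: z.
Qed.

(** The first m values are fixed and smaller than all others, so letters below m act trivially. Only
    blocks j < M with M <= m have a nonzero parameter, and what survives of each of them is a full
    block. *)
Lemma actw_one_times m k M x y (u : nat -> nat) :
  (forall j, (M <= j)%N -> x j = 0) -> (forall j, (M <= j)%N -> y j = 0) ->
  (M <= m)%N -> (M <= k)%N ->
  actw (fkw k x y) (@eid R) (lift_nat m id (fun i => (m + u i)%N)) =
  actw (incs (k - m) M y ++ decs (k - m) M x) (@eid R) u.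
Proof.
move=> x0 y0 Mm Mk.
rewrite /fkw (weq_cat (fkB_trunc y0 Mk) (fkA_trunc x0 (leqW Mk))).
rewrite (@actw_shift _ m id _ _ _ (fun v => forall i, (m <= v i)%N)); first last.
- by move=> i; rewrite leq_addr.
- move=> v i vm im; rewrite /lift_nat im; case: ifP => [|_]; first by [].
  by apply: leq_trans (vm _); apply: ltnW.
- by move=> v i vm j /=.
rewrite shiftw_cat !shiftw_flatten.
rewrite (_ : [seq shiftw m (incw k j (y j)) | j <- rev (iota 0 M)] =
  [seq incw (k - m) 0 (y j) | j <- rev (iota 0 M)]); last first.
  by apply/eq_in_map => j; rewrite mem_rev mem_iota => h; rewrite shiftw_inc //; lia.
rewrite (_ : [seq shiftw m (decw k j (x j)) | j <- iota 0 M] =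
  [seq decw (k - m) 0 (x j) | j <- iota 0 M]); last first.
  by apply/eq_in_map => j; rewrite mem_iota => h; rewrite shiftw_dec //; lia.
rewrite -[(fun i => m + u i)%N]/(addn m \o u) actw_monotone_comp; last by move=> a b; rewrite ltn_add2l.
congr actw; apply/funext => v; congr (nat_of_bool _)%:R.
apply/asboolP/asboolP => [e|->]; apply/funext => i /=.
  have := congr1 (fun g => g (m + i)%N) e; rewrite /lift_nat ltnNge leq_addr /= addKn => /addnI.
  by [].
by rewrite /lift_nat; case: ltnP => //= h; rewrite subnKC.
Qed.

End FullWords.

Definition cf N (f : {mpoly {mpoly int[N]}[N]}) (a b : nat -> nat) : int :=
  (f@_[multinom a i | i < N])@_[multinom b i | i < N].

Definition ren_coef n N (s : nat -> nat) : {mpoly int[n]} -> {mpoly int[N]} :=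
  mmap (@mpolyC N int \o idfun) (fun i : 'I_n => ivar int N (s i)).
HB.instance Definition _ n N s := GRing.RMorphism.on (@ren_coef n N s).

(** The renaming acts on x and y at once and kills variables sent to N or beyond; for [s = id] it is
    a truncation. *)
Definition ren n N (s : nat -> nat) :
    {mpoly {mpoly int[n]}[n]} -> {mpoly {mpoly int[N]}[N]} :=
  mmap (@mpolyC N {mpoly int[N]} \o ren_coef N s) (fun i : 'I_n => ivar {mpoly int[N]} N (s i)).
HB.instance Definition _ n N s := GRing.RMorphism.on (@ren n N s).

Lemma yvarE n k : yvar n k = (ivar int n k)%:MP.
Proof. by rewrite /yvar /ivar; case: insubP => // _; rewrite mpolyC0. Qed.

Lemma ren_xvar n N s k : (k < n)%N -> ren N s (xvar n k) = xvar N (s k).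
Proof.
by move=> kn; rewrite -[k]/(val (Ordinal kn)) xvar_ord /ren mmapX mmap1U.
Qed.

Lemma ren_yvar n N s k : (k < n)%N -> ren N s (yvar n k) = yvar N (s k).
Proof.
move=> kn; rewrite -[k]/(val (Ordinal kn)) yvar_ord /ren mmapC /= /ren_coef mmapX mmap1U.
by rewrite yvarE.
Qed.

Lemma var_out n k : (n <= k)%N -> xvar n k = 0 /\ yvar n k = 0.
Proof. by move=> nk; rewrite /xvar /yvar insubF // ltnNge nk. Qed.

Lemma cf_renM n1 n2 N (s1 s2 : nat -> nat) (a1 a2 c b1 b2 d : nat -> nat) f g :
  (forall i j : 'I_n1, s1 i = s1 j -> i = j) ->
  (forall i j : 'I_n2, s2 i = s2 j -> i = j) ->
  (forall (i : 'I_n1) (j : 'I_n2), s1 i <> s2 j) ->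
  (forall k, (k < N)%N -> (exists i : 'I_n1, s1 i = k) \/ (exists i : 'I_n2, s2 i = k)) ->
  (forall k, (N <= k)%N -> c k = 0%N) -> (forall k, (N <= k)%N -> d k = 0%N) ->
  (forall i : 'I_n1, c (s1 i) = a1 i) -> (forall i : 'I_n2, c (s2 i) = a2 i) ->
  (forall i : 'I_n1, d (s1 i) = b1 i) -> (forall i : 'I_n2, d (s2 i) = b2 i) ->
  cf (@ren n1 N s1 f * @ren n2 N s2 g) c d = cf f a1 b1 * cf g a2 b2.
Proof.
move=> inj1 inj2 dis cov cN dN c1 c2 d1 d2; rewrite /cf /ren.
rewrite (mcoeff_mmap_ivarM _ _ _ _ inj1 inj2 dis cov cN c1 c2).
by rewrite (mcoeff_mmap_ivarM _ _ _ _ inj1 inj2 dis cov dN d1 d2).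
Qed.

Lemma perm_nat_one_times m n (w : 'S_n) :
  perm_nat (one_times m w) = lift_nat m id (fun i => (m + perm_nat w i)%N).
Proof.
elim: m => [|m IH]; first by apply/funext => k; rewrite /lift_nat subn0.
apply/funext => k; have [nk|kn] := leqP (m.+1 + n)%N k.
  rewrite perm_nat_geq // /lift_nat ifF; last by lia.
  by rewrite perm_nat_geq; lia.
rewrite perm_nat_lt /=; case: k kn => [|k] kn.
  by rewrite (_ : Ordinal kn = ord0) ?lift_perm_id; last exact/val_inj.
have kn' : (k < m + n)%N by lia.
have -> : Ordinal kn = fintype.lift ord0 (Ordinal kn') by apply/val_inj; rewrite /= /bump.
rewrite lift_perm_lift /= /bump add1n -perm_nat_lt IH /lift_nat ltnS subSS.
by case: ifP; rewrite ?addSn.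
Qed.

Lemma cf_trunc n N (f : {mpoly {mpoly int[n]}[n]}) (a b : nat -> nat) : (N <= n)%N ->
  (forall k, (N <= k)%N -> a k = 0%N) -> (forall k, (N <= k)%N -> b k = 0%N) ->
  cf f a b = cf (@ren n N id f) a b.
Proof.
(* The constant 1 in no variables serves as second factor, which makes truncation a case of
   [cf_renM]. *)
move=> Nn aN bN; pose o : {mpoly {mpoly int[0]}[0]} := 1.
rewrite -[@ren n N id f]mulr1 -(rmorph1 (@ren 0 N id)).
rewrite (@cf_renM n 0 N id id a a a b b b) //.
- have e (c : nat -> nat) : [multinom c i | i < 0] = 0%MM by apply/mnmP; case.
  by rewrite /cf !e mcoeff1 eqxx mcoeff1 eqxx mulr1.
- by move=> i j /val_inj.
- by case.
- by move=> i [].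
- by move=> k kN; left; exists (Ordinal (leq_trans kN Nn)).
Qed.

Lemma ren_actw n N s W f w : ren N s (actw W f w) =
  actw (mapw (@ren n N s) W) (@ren n N s \o f) w.
Proof. exact_no_check (actw_morph (@ren n N s) W f w). Qed.

Lemma mapw_fkw (R S : comNzRingType) (phi : R -> S) k x y x' y' :
  (forall j, phi (x j) = x' j) -> (forall j, phi (y j) = y' j) ->
  mapw phi (fkw k x y) = fkw k x' y'.
Proof.
move=> hx hy; rewrite /fkw /fkA /fkB mapw_cat /mapw !map_flatten -!map_comp.
congr (flatten _ ++ flatten _); apply: eq_map => j.
  by rewrite -[LHS]/(mapw _ (incw _ _ _)) mapw_inc hy.
by rewrite -[LHS]/(mapw _ (decw _ _ _)) mapw_dec hx.
Qed.

Lemma monom_ltP N (a : monom) : monom_lt N a -> forall k, (N <= k)%N -> a k = 0%N.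
Proof. by move=> aN k Nk; apply/eqP; apply: contraLR Nk => /eqP/aN; rewrite -ltnNge. Qed.

Lemma monom_lt_leq N N' a : (N <= N')%N -> monom_lt N a -> monom_lt N' a.
Proof. by move=> NN' aN i /aN h; apply: leq_trans NN'. Qed.

(** For monomials in the first M variables the coefficient is already constant for m > M. The n - 1
    generators of S_n remain as range of the blocks. *)
Lemma stable_grothE n (w : 'S_n) (a b : monom) M : monom_lt M a -> monom_lt M b ->
  stable_groth w a b =
  cf (actw (incs n.-1 M (yvar M) ++ decs n.-1 M (xvar M)) (@eid _) (perm_nat w)) a b.
Proof.
move=> aM bM; set v0 := cf _ _ _.
have key m : (M < m)%N -> poly_series (groth (one_times m w)) a b = v0.
  case: m => // m; rewrite ltnS => Mm.
  have N_ge : (M <= m.+1 + n)%N by lia.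
  rewrite /poly_series ifT; last first.
    by apply/asboolP; split; [apply: monom_lt_leq aM|apply: monom_lt_leq bM].
  rewrite -/(cf _ a b) (cf_trunc _ N_ge (monom_ltP aM) (monom_ltP bM)).
  rewrite (@grothE (m + n)) /v0; congr (cf _ a b).
  rewrite /fk_poly ren_actw.
  rewrite (@mapw_fkw _ _ (@ren (m + n).+1 M id) _ _ _ (xvar M) (yvar M)); first last.
  - move=> j; have [jn|nj] := ltnP j (m + n).+1; first exact: ren_yvar.
    by rewrite (var_out nj).2 rmorph0 (@var_out M j _).2 //; lia.
  - move=> j; have [jn|nj] := ltnP j (m + n).+1; first exact: ren_xvar.
    by rewrite (var_out nj).1 rmorph0 (@var_out M j _).1 //; lia.
  rewrite (_ : _ \o _ = @eid _); last by apply/funext => u; rewrite /eid /= rmorph_nat.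
  rewrite (perm_nat_one_times m.+1 w) (@actw_one_times _ m.+1 (m + n) M); first last.
  - by lia.
  - by lia.
  - by move=> j jM; rewrite (var_out jM).2.
  - by move=> j jM; rewrite (var_out jM).1.
  by rewrite (_ : (m + n - m.+1 = n.-1)%N) //; lia.
rewrite /stable_groth; case: xgetP => [v _ [m0 /= h]|/(_ v0) h].
  by rewrite -(h (maxn m0 M.+1)) ?key //; lia.
by case: h; exists M.+1 => m; exact: key.
Qed.

Lemma rev_decs (R : comNzRingType) k M (x : nat -> R) : rev (decs k M x) = incs k M x.
Proof.
rewrite /decs /incs rev_flatten map_rev; congr flatten; congr rev.
by rewrite -map_comp; apply: eq_map => j /=; rewrite rev_decw.
Qed.

Lemma rev_incs (R : comNzRingType) k M (x : nat -> R) : rev (incs k M x) = decs k M x.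
Proof. by rewrite -rev_decs revK. Qed.

(** * Lattice paths *)

(* A lattice path, read from its bottom left end: [false] is a vertical step. The rows
   of the partition above the path are listed from the longest to the shortest. *)
Fixpoint rows (s : seq bool) : seq nat :=
  match s with
  | [::] => [::]
  | false :: s' => rcons (rows s') 0%N
  | true :: s' => map succn (rows s')
  end.

(** The default continues the path by horizontal steps for ever, matching [proj01] of a permutation
    that fixes all large numbers. *)
Definition vseq (s : seq bool) (k : nat) : nat := nth true s k.

Lemma size_rows s : size (rows s) = count negb s.
Proof. by elim: s => // -[] s IH /=; rewrite ?size_map ?size_rcons IH. Qed.

Lemma pairwise_rows s : pairwise geq (rows s).
Proof.
elim: s => // -[] s IH /=.
  by rewrite pairwise_map; apply: sub_pairwise IH => x y /=.
by rewrite pairwise_rcons IH andbT; apply/allP => x _; apply: leq0n.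
Qed.

Lemma rows_bound s : all (fun x => x <= count id s)%N (rows s).
Proof.
elim: s => // -[] s IH /=.
  by rewrite all_map; apply: sub_all IH => x /=; rewrite add1n ltnS.
by rewrite all_rcons leq0n; apply: sub_all IH => x; rewrite add0n.
Qed.

Lemma rows_exists a l : pairwise geq l -> all (fun x => x <= a)%N l ->
  exists s, rows s = l /\ size s = (size l + a)%N.
Proof.
have [d] := ubnP (size l + a); elim: d l a => // d IH l a.
case: (lastP l) => [|l' x] hd.
  by move=> _ _; exists (nseq a true); rewrite size_nseq; split => //; elim: (a) => //= ? ->.
rewrite pairwise_rcons all_rcons => /andP[l'x sl] /andP[xa al].
case: x hd l'x xa => [|x] hd l'x xa.
  have [|s [sE sz]] := IH l' a _ sl al; first by move: hd; rewrite size_rcons; lia.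
  by exists (false :: s); rewrite /= sE size_rcons sz.
case: a hd al xa => // a hd al xa.
have pos y : y \in rcons l' x.+1 -> (0 < y)%N.
  rewrite mem_rcons inE => /orP[/eqP -> //|yl].
  by have /= := allP l'x y yl; apply: leq_trans.
have [|||s [sE sz]] := IH (map predn (rcons l' x.+1)) a.
- by rewrite size_map; move: hd; lia.
- rewrite pairwise_map; have : pairwise geq (rcons l' x.+1) by rewrite pairwise_rcons l'x.
  by apply: sub_pairwise => u v /= uv; lia.
- rewrite all_map; apply/allP => y yl /=.
  have : (y <= a.+1)%N by move: yl; rewrite mem_rcons inE => /orP[/eqP -> //|/(allP al)].
  by lia.
exists (true :: s); rewrite /= sE sz size_map -map_comp; split; last by lia.
by apply: map_id_in => y /pos /= ?; lia.
Qed.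

(** The right side lists the values w_lambda(i) = i + lambda_(p+1-i), with i counted from 0: the
    vertical steps stand at the values that w_lambda takes on its first p positions. *)
Lemma zerosE s : [seq k <- iota 0 (size s) | ~~ nth true s k] =
  mkseq (fun i => i + nth 0 (rows s) (size (rows s) - i.+1))%N (size (rows s)).
Proof.
elim: s => // x s IH.
have -> : iota 0 (size (x :: s)) = 0%N :: map succn (iota 0 (size s)).
  by rewrite /= -[1%N]addn0 iotaDl.
rewrite /= filter_map (eq_filter (a2 := fun k => ~~ nth true s k)) // IH.
case: x => /=.
  rewrite size_map /mkseq -map_comp; apply/eq_in_map => i; rewrite mem_iota => h /=.
  by rewrite (nth_map 0%N) ?addnS //; lia.
rewrite size_rcons /mkseq /= -[1%N]addn0 iotaDl -!map_comp.
rewrite subSS subn0 nth_rcons ltnn eqxx; congr cons.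
apply/eq_in_map => i; rewrite mem_iota => h /=.
by rewrite nth_rcons add1n subSS ifT ?addSn //; lia.
Qed.

Lemma vseq_zero s k : vseq s k = 0%N <->
  exists2 i, (i < size (rows s))%N & k = (i + nth 0 (rows s) (size (rows s) - i.+1))%N.
Proof.
have E : vseq s k = 0%N <-> k \in [seq k <- iota 0 (size s) | ~~ nth true s k].
  rewrite mem_filter mem_iota /= add0n /vseq; case: ltnP => h; rewrite ?andbT ?andbF.
    by case: nth.
  by rewrite nth_default.
rewrite E zerosE; split => [/mapP[i]|[i ir ->]]; first by rewrite mem_iota => ? ->; exists i.
by apply/mapP; exists i => //; rewrite mem_iota.
Qed.

Lemma perm_rows_exists s n : size s = n ->
  exists w : 'S_n,
    (forall i : 'I_n, (i < size (rows s))%N ->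
       w i = (i + nth 0 (rows s) (size (rows s) - i.+1))%N :> nat) /\
    (forall i j : 'I_n, j = i.+1 :> nat -> i.+1 <> size (rows s) -> (w i < w j)%N).
Proof.
move=> sn; pose z := [seq k <- iota 0 n | ~~ nth true s k].
pose o := [seq k <- iota 0 n | nth true s k].
have pe : perm_eq (z ++ o) (iota 0 n).
  by rewrite perm_sym -(perm_filterC (nth true s)) perm_catC.
have sz : size (z ++ o) = n by rewrite (perm_size pe) size_iota.
have lt (i : 'I_n) : (nth 0 (z ++ o) i < n)%N.
  have : nth 0%N (z ++ o) i \in z ++ o by rewrite mem_nth // sz.
  by rewrite (perm_mem pe) mem_iota.
have inj : injective (fun i : 'I_n => Ordinal (lt i)).
  move=> i j /(congr1 val) /= /eqP; rewrite nth_uniq ?sz //; first by move/eqP/val_inj.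
  by rewrite (perm_uniq pe) iota_uniq.
have zE : z = mkseq (fun i => i + nth 0 (rows s) (size (rows s) - i.+1))%N (size (rows s)).
  by rewrite -zerosE sn.
have szz : size z = size (rows s) by rewrite zE size_mkseq.
exists (perm inj); split=> [i ir|i j ji ir]; rewrite !permE /=.
  by rewrite nth_cat szz ir zE nth_mkseq.
have srt (l : seq nat) u : sorted ltn l -> (u.+1 < size l)%N -> (nth 0 l u < nth 0 l u.+1)%N.
  by move=> sl ul; apply: (sorted_ltn_nth ltn_trans) => //; rewrite inE; lia.
have jn : (i.+1 < n)%N by rewrite -ji.
rewrite ji.
rewrite !nth_cat; case: (ltnP i (size z)) => h1; case: (ltnP i.+1 (size z)) => h2.
- by apply: srt => //; rewrite /z (sorted_filter ltn_trans) ?iota_ltn_sorted.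
- by move: h1 h2 ir; rewrite szz; lia.
- by move: h1 h2; lia.
rewrite subSn //; apply: srt; first by rewrite /o (sorted_filter ltn_trans) ?iota_ltn_sorted.
by move: sz; rewrite size_cat; lia.
Qed.

Lemma part_pairwise (l : part) : pairwise geq l.
Proof.
case: l => s /= /andP[srt _]; rewrite -sorted_pairwise //.
by move=> u v w /= h1 h2; apply: leq_trans h2 h1.
Qed.

Lemma part_pos (l : part) : all (ltn 0) l.
Proof. by case: l => s /= /andP[]. Qed.

Lemma part_bound_head (l : part) : all (fun x => x <= head 0 l)%N l.
Proof.
have := part_pairwise l; case: (part_seq l) => //= x t /andP[/allP h _].
by rewrite leqnn; apply/allP => y /h.
Qed.

Lemma perm_partP (l : part) :
  (forall i : 'I_(size l + head 0%N l), (i < size l)%N ->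
     perm_part l i = (i + nth 0 l (size l - i.+1))%N :> nat) /\
  (forall i j : 'I_(size l + head 0%N l), j = i.+1 :> nat -> i.+1 <> size l ->
     (perm_part l i < perm_part l j)%N).
Proof.
rewrite /perm_part; case: xgetP => [w _ //|] h.
have [s [sE sz]] := rows_exists (part_pairwise l) (part_bound_head l).
by have [w] := perm_rows_exists sz; rewrite sE => /h.
Qed.

Lemma perm_natK n (w : 'S_n) : cancel (perm_nat w) (perm_nat w^-1).
Proof.
move=> k; have [nk|kn] := leqP n k; first by rewrite !perm_nat_geq // perm_nat_geq.
by rewrite (perm_nat_lt _ kn) perm_nat_ord permK.
Qed.

Lemma perm_natKV n (w : 'S_n) : cancel (perm_nat w^-1) (perm_nat w).
Proof. by have := perm_natK w^-1; rewrite invgK. Qed.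

Lemma vseq_le1 s k : (vseq s k <= 1)%N.
Proof. by rewrite /vseq; case: nth. Qed.

(** The steps of the path are indexed by the values of the permutation, hence the inverse. *)
Lemma proj01_perm_part (l : part) s : rows s = l ->
  proj01 (size l) (perm_nat (perm_part l)^-1) = vseq s.
Proof.
move=> sl; have [wlt _] := perm_partP l; apply/funext => k.
set w := perm_part l in wlt *.
suff E : (perm_nat w^-1 k < size l)%N <-> vseq s k = 0%N.
  have := vseq_le1 s k; rewrite /proj01.
  case: (leqP (size l)) => [le|/(proj1 E) -> //].
  by move: (proj2 E); case: (vseq s k) => [|[]] // h; have := h erefl; lia.
have wE i (il : (i < size l)%N) : perm_nat w i = (i + nth 0 l (size l - i.+1))%N.
  have ilt : (i < size l + head 0%N l)%N by lia.
  by rewrite (perm_nat_lt _ ilt) wlt.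
rewrite vseq_zero sl; split => [lt|[i il ->]]; last by rewrite -wE // perm_natK.
by exists (perm_nat w^-1 k); rewrite // -wE // perm_natKV.
Qed.

Lemma perm_part_inv_increasing (l : part) (u := perm_nat (perm_part l)^-1) a b :
  (a < b)%N -> (size l <= u a)%N = (size l <= u b)%N -> (u a < u b)%N.
Proof.
move=> ab cl; have [_ wlt] := perm_partP l.
move: cl; rewrite {}/u; move: wlt; set n := (size l + head 0 l)%N; move: (perm_part l) => w wlt cl.
have step k : k.+1 <> size l -> (perm_nat w k < perm_nat w k.+1)%N.
  move=> kl; have [nk|kn] := leqP n k.
    by rewrite !perm_nat_geq //; lia.
  have [nk1|k1n] := leqP n k.+1.
    rewrite (perm_nat_geq _ nk1) (perm_nat_lt _ kn).
    by apply: leq_trans (ltn_ord _) _.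
  by rewrite (perm_nat_lt _ kn) (perm_nat_lt _ k1n) wlt.
have incr d i : (size l <= i)%N = (size l <= (d + i))%N -> (perm_nat w i <= perm_nat w (d + i))%N.
  elim: d => // d IH h; apply: leq_trans (IH _) _; first by lia.
  by rewrite addSn ltnW // step //; lia.
rewrite ltnNge; apply/negP => le.
have := incr (perm_nat w^-1 a - perm_nat w^-1 b)%N (perm_nat w^-1 b); rewrite subnK // !perm_natKV -cl => /(_ erefl).
by rewrite leqNgt ab.
Qed.

Section Window.
Variable R : comNzRingType.
Implicit Types (W : seq (nat * R)) (f : (nat -> nat) -> R) (x y : nat -> R).

Lemma actw_upper n W f v : (forall k, (v k <= 1)%N) -> (forall k, (n <= k)%N -> v k = 1%N) ->
  actw W f v = actw [seq p <- W | (p.1.+1 < n)%N] f v.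
Proof.
elim/last_ind: W v => // W [i z] IH v v1 vn.
rewrite filter_rcons actw_rcons /hact /= IH //; case: (ltnP i.+1 n) => ni; last first.
  by rewrite ltnNge (vn i.+1 ni) v1.
rewrite actw_rcons /hact /=; case: ifP => // _; rewrite (IH (v \o _)) //.
  by move=> k; apply: v1.
by move=> k nk /=; rewrite adj_swapD ?vn //; lia.
Qed.

Lemma filter_incw n K (z : R) : (n.-1 <= K)%N ->
  [seq p <- incw K 0 z | (p.1.+1 < n)%N] = incw n.-1 0 z.
Proof.
move=> nK; rewrite /incw filter_map /index_iota !subn0 -(subnKC nK) iotaD filter_cat.
rewrite (_ : [seq i <- iota 0 n.-1 | _] = iota 0 n.-1); last first.
  by apply/all_filterP/allP => i; rewrite mem_iota /=; lia.
rewrite (_ : [seq i <- iota _ (K - _) | _] = [::]) ?cats0 //.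
apply/eqP; rewrite -(negbK (_ == _)) -has_filter.
by apply/hasPn => i; rewrite mem_iota /=; lia.
Qed.

Lemma filter_flatten_map (T S : Type) (P : pred S) (F : T -> seq S) t :
  [seq p <- flatten [seq F j | j <- t] | P p] = flatten [seq [seq p <- F j | P p] | j <- t].
Proof. by elim: t => //= a t IH; rewrite filter_cat IH. Qed.

Lemma filter_incs n K M x : (n.-1 <= K)%N ->
  [seq p <- incs K M x | (p.1.+1 < n)%N] = incs n.-1 M x.
Proof.
move=> nK; rewrite /incs filter_flatten_map; congr flatten.
by apply: eq_map => j; rewrite filter_incw.
Qed.

Lemma filter_decs n K M x : (n.-1 <= K)%N ->
  [seq p <- decs K M x | (p.1.+1 < n)%N] = decs n.-1 M x.
Proof. by move=> nK; rewrite -!rev_incs filter_rev filter_incs. Qed.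

Lemma rows_trailing s : exists e s1,
  s = nseq e false ++ s1 /\ rows s1 = [seq x <- rows s | 0 < x]%N.
Proof.
elim: s => [|[] s [e [s1 [sE rE]]]]; first by exists 0%N, [::].
  exists 0%N, (true :: s); split => //=.
  by rewrite filter_map (eq_filter (a2 := xpredT)) ?filter_predT.
by exists e.+1, s1; rewrite /= filter_rcons -rE sE.
Qed.

Lemma shiftw_incs e K M x : shiftw e (incs K M x) = incs (K - e) M x.
Proof.
by rewrite /incs shiftw_flatten; congr flatten; apply: eq_map => j; rewrite shiftw_inc.
Qed.

Lemma shiftw_decs e K M x : shiftw e (decs K M x) = decs (K - e) M x.
Proof.
by rewrite /decs shiftw_flatten; congr flatten; apply: eq_map => j; rewrite shiftw_dec.
Qed.

(** This is the reverse of the word in [stable_grothE], because the path belongs to the inverse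
    permutation; x therefore sits on the increasing blocks. *)
Definition Gword K M x y := incs K M x ++ decs K M y.

(** Initial vertical steps are rows of length 0 and final horizontal steps are empty columns. No
    letter meets a descent there, so the path of a partition in any rectangle that contains it
    computes the same G. *)
Lemma actw_window (l : part) s M x y :
  [seq z <- rows s | 0 < z]%N = l ->
  exists2 s1, rows s1 = l &
  actw (Gword (size s).-1 M x y) (@delta01 R (size (rows s))) (vseq s) =
  actw (Gword (size l + head 0 l).-1 M x y) (@delta01 R (size l)) (vseq s1).
Proof.
have [e [s1 [sE <-]]] := rows_trailing s => s1l; exists s1 => //.
have vE : vseq s = lift_nat e (fun=> 0%N) (vseq s1).
  apply/funext => k; rewrite sE /vseq /lift_nat nth_cat size_nseq.
  by case: ltnP => // h; rewrite nth_nseq h.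
have sr : size (rows s) = (e + size l)%N.
  by rewrite size_rows sE count_cat count_nseq mul1n -size_rows s1l.
rewrite vE (@actw_shift _ e _ _ _ _ (fun=> True)) //; last first.
  by move=> u i _ ie; rewrite /lift_nat ie.
have -> : @delta01 R (size (rows s)) \o lift_nat e (fun=> 0%N) = @delta01 R (size l).
  apply/funext => u; rewrite /delta01 /= sr; congr (nat_of_bool _)%:R.
  apply/asboolP/asboolP => [E|->]; apply/funext => k.
    have := congr1 (fun g => g (e + k)%N) E; rewrite /lift_nat /proj01 ltnNge leq_addr addKn /= => ->.
    by rewrite leq_add2l.
  by rewrite /lift_nat /proj01 /=; case: ltnP => h; lia.
rewrite /Gword shiftw_cat shiftw_incs shiftw_decs.
set n := (size l + head 0 l)%N.
have ns1 : (n <= size s1)%N.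
  rewrite /n; case lE: (part_seq l) => [|x0 t] //=.
  have : vseq s1 (size t + x0)%N = 0%N.
    by apply/vseq_zero; exists (size t); rewrite s1l lE /= ?subnn.
  by rewrite /vseq; case: ltnP => // h; rewrite nth_default //; lia.
rewrite (@actw_upper n); first last.
- move=> k nk; have := vseq_le1 s1 k; case E: (vseq s1 k) => [|[]] // _.
  move/vseq_zero: E; rewrite s1l => -[i il ki].
  have /allP/(_ _ (mem_nth 0%N (_ : (size l - i.+1 < size l)%N))) := part_bound_head l.
  move=> /(_ ltac:(lia)) h; rewrite /n in nk; move: h ki nk.
  by move: (nth _ _ _) (head _ _) => A B h ki nk; lia.
- exact: vseq_le1.
rewrite filter_cat filter_incs ?filter_decs //;
  by move: ns1; rewrite sE size_cat size_nseq; lia.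
Qed.

End Window.

Lemma G_partE (l : part) s (a b : monom) M : monom_lt M a -> monom_lt M b ->
  [seq z <- rows s | 0 < z]%N = l ->
  G_part l a b =
  cf (actw (Gword (size s).-1 M (xvar M) (yvar M)) (delta01 _ (size (rows s))) (vseq s)) a b.
Proof.
move=> aM bM sl; rewrite /G_part (stable_grothE _ aM bM); congr (cf _ a b).
have [s1 s1l ->] := actw_window M (xvar M) (yvar M) sl.
rewrite (actw_rev_eid _ (@perm_natK _ _) (@perm_natKV _ _)) rev_cat rev_decs rev_incs.
rewrite (actw_proj01 _ (@perm_natKV _ _) (@perm_natK _ _) (@perm_part_inv_increasing l)).
by rewrite (proj01_perm_part s1l).
Qed.

(** * The coproduct of a rectangle *)

(* Nonzero exactly when the partition above [t] is obtained from the one above [s] by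
   adding a rook strip; the boxes added are the places where 01 is replaced by 10. *)
Fixpoint rook_sign (s t : seq bool) : int :=
  match s, t with
  | [::], [::] => 1
  | x :: s', y :: t' =>
      if x == y then rook_sign s' t' else
      match x, s', t' with
      | false, true :: s'', false :: t'' => - rook_sign s'' t''
      | _, _, _ => 0
      end
  | _, _ => 0
  end.

Fixpoint swapb (i : nat) (s : seq bool) : seq bool :=
  match i, s with
  | 0%N, x :: y :: s' => y :: x :: s'
  | i'.+1, x :: s' => x :: swapb i' s'
  | _, _ => s
  end.

Fixpoint descb (i : nat) (s : seq bool) : bool :=
  match i, s with
  | 0%N, x :: y :: _ => x && ~~ y
  | i'.+1, _ :: s' => descb i' s'
  | _, _ => false
  end.

Fixpoint ascb (i : nat) (s : seq bool) : bool :=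
  match i, s with
  | 0%N, x :: y :: _ => ~~ x && y
  | i'.+1, _ :: s' => ascb i' s'
  | _, _ => false
  end.

(** This is the entry at (s, t) of the identity expressing that u_i is moved from one side of the
    sign matrix to the other. As [rook_sign] consumes one or two letters at a time, i and i + 1 are
    treated together; the base cases are a finite check on the first three or four letters. *)
Lemma rook_sign_adjoint i s t :
  (if ascb i t then rook_sign s (swapb i t) else 0) - (if descb i t then rook_sign s t else 0) =
  (if descb i s then rook_sign (swapb i s) t else 0) - (if ascb i s then rook_sign s t else 0).
Proof.
suff H i' : (forall s t,
  (if ascb i' t then rook_sign s (swapb i' t) else 0) - (if descb i' t then rook_sign s t else 0) =
  (if descb i' s then rook_sign (swapb i' s) t else 0) - (if ascb i' s then rook_sign s t else 0)) /\
  (forall s t,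
  (if ascb i'.+1 t then rook_sign s (swapb i'.+1 t) else 0) - (if descb i'.+1 t then rook_sign s t else 0) =
  (if descb i'.+1 s then rook_sign (swapb i'.+1 s) t else 0) - (if ascb i'.+1 s then rook_sign s t else 0)).
  by have [] := H i.
elim: i' => [|i' [IH0 IH1]] {s t}.
  split=> s t.
    case: s => [|a [|b [|c s]]]; case: t => [|a' [|b' [|c' t]]] //=;
    rewrite ?subrr //;
    do ?[case: a]; do ?[case: b]; do ?[case: c]; do ?[case: a']; do ?[case: b']; do ?[case: c'];
    rewrite /= ?subr0 ?sub0r ?opprK ?subrr //.
  case: s => [|a [|b [|c [|d s]]]]; case: t => [|a' [|b' [|c' [|d' t]]]] //=;
    rewrite ?subrr //;
    do ?[case: a]; do ?[case: b]; do ?[case: c]; do ?[case: d];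
    do ?[case: a']; do ?[case: b']; do ?[case: c']; do ?[case: d'];
    rewrite /= ?subr0 ?sub0r ?opprK ?subrr ?oppr0 //.
split=> // s t; case: s => [|x s]; case: t => [|y t] //=.
- by do 2!case: ifP.
- by do 2!case: ifP.
have [_|xy] := eqVneq x y; first exact: IH1.
case: x y xy => -[] // _; first by do 4!case: ifP.
case: s => [|[] s]; case: t => [|[] t] /=; try by do 4?case: ifP.
have := IH0 s t.
by do 4!case: ifP => _; rewrite ?subr0 ?sub0r ?opprK ?subrr ?oppr0 //; lia.
Qed.

(** No box can be added to the full rectangle. *)
Lemma rook_sign_full a m t :
  rook_sign (nseq a true ++ nseq m false) t = (t == nseq a true ++ nseq m false)%:R.
Proof.
elim: a t => [|a IH] t /=; last by case: t => [|[] t] //=; rewrite IH.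
elim: m t => [|m IH] [|[] t] //; first by case: m IH.
by rewrite [LHS]/= IH.
Qed.

Lemma size_swapb i s : size (swapb i s) = size s.
Proof. by elim: i s => [|i IH] [|x [|y s]] //=; rewrite ?IH. Qed.

Lemma swapbK i : involutive (swapb i).
Proof. by elim: i => [|i IH] [|x [|y s]] //=; rewrite IH. Qed.

Lemma descb_swapb i s : descb i (swapb i s) = ascb i s.
Proof. by elim: i s => [|i IH] [|x [|y s]] //=; rewrite ?IH // andbC. Qed.

Lemma descbE i s : (i.+1 < size s)%N -> descb i s = (vseq s i.+1 < vseq s i)%N.
Proof.
by elim: i s => [|i IH] [|x [|y s]] //= h; [case: x; case: y|rewrite IH].
Qed.

Lemma ascbE i s : (i.+1 < size s)%N -> ascb i s = (vseq s i < vseq s i.+1)%N.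
Proof.
by elim: i s => [|i IH] [|x [|y s]] //= h; [case: x; case: y|rewrite IH].
Qed.

Lemma vseq_swapb i s : (i.+1 < size s)%N -> vseq (swapb i s) = vseq s \o adj_swap i.
Proof.
move=> h; apply/funext => k /=; elim: i s h k => [|i IH] [|x [|y s]] //= h k.
  by case: k => [|[|k]] //.
case: k => [|k] //; rewrite -[LHS]/(vseq (swapb i (y :: s)) k) IH //.
by rewrite /adj_swap !eqSS; case: eqP => _ //; case: eqP.
Qed.

Lemma swapb_tupleP n i (t : n.-tuple bool) : size (swapb i t) == n.
Proof. by rewrite size_swapb size_tuple. Qed.
Canonical swapb_tuple n i (t : n.-tuple bool) := Tuple (swapb_tupleP i t).

Section Duality.
Variables (R : comNzRingType) (n : nat).
Implicit Types (g : (nat -> nat) -> R) (W : seq (nat * R)).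

(** Reversing the path in the first argument replaces a partition by its rotated complement; this is
    the origin of the rotated tau and of the index n - 2 - i of the adjoint generator. *)
Definition dual_form g1 g2 : R :=
  \sum_(s : n.-tuple bool) \sum_(t : n.-tuple bool)
     (rook_sign s t)%:~R * (g1 (vseq (rev s)) * g2 (vseq t)).

Definition heckeb i g (t : seq bool) : R :=
  if descb i t then g (vseq (swapb i t)) - g (vseq t) else 0.

Lemma hact_vseq i z g (t : n.-tuple bool) : (i.+1 < n)%N ->
  hact i z g (vseq t) = g (vseq t) + z * heckeb i g t.
Proof.
move=> ni; rewrite /hact /heckeb -descbE ?size_tuple // -vseq_swapb ?size_tuple //.
by case: ifP => _; ring.
Qed.

Lemma vseq_rev k (t : n.-tuple bool) : (k < n)%N -> vseq (rev t) k = vseq t (n - k.+1).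
Proof. by move=> kn; rewrite /vseq nth_rev size_tuple. Qed.

Lemma swapb_rev i (t : n.-tuple bool) : (i.+1 < n)%N ->
  swapb (n - i.+2) (rev t) = rev (swapb i t).
Proof.
move=> ni; apply: (@eq_from_nth _ true).
  by rewrite size_swapb !size_rev size_swapb.
move=> k; rewrite size_swapb size_rev size_tuple => kn.
have natb_inj : injective nat_of_bool by do 2!case.
apply: natb_inj.
rewrite -[LHS]/(vseq _ k) -[RHS]/(vseq _ k) vseq_swapb ?size_rev ?size_tuple /=; last by lia.
rewrite (@vseq_rev k (swapb_tuple i t)) // /= vseq_swapb ?size_tuple //=.
rewrite vseq_rev; last by rewrite /adj_swap; do !case: eqP; lia.
by congr vseq; rewrite /adj_swap; do !case: eqP; lia.
Qed.

Lemma descb_rev i (t : n.-tuple bool) : (i.+1 < n)%N -> descb (n - i.+2) (rev t) = ascb i t.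
Proof.
move=> ni; rewrite descbE ?size_rev ?size_tuple; last by lia.
rewrite ascbE ?size_tuple // !vseq_rev; try by lia.
by congr (vseq _ _ < vseq _ _)%N; lia.
Qed.

Lemma dual_form_hact i z g1 g2 : (i.+1 < n)%N ->
  dual_form g1 (hact i z g2) = dual_form (hact (n - i.+2) z g1) g2.
Proof.
move=> ni.
have L : dual_form g1 (hact i z g2) = dual_form g1 g2 + z *
  \sum_(s : n.-tuple bool) \sum_(t : n.-tuple bool)
     (rook_sign s t)%:~R * (g1 (vseq (rev s)) * heckeb i g2 t).
  rewrite /dual_form mulr_sumr -big_split; apply: eq_bigr => s _ /=.
  rewrite mulr_sumr -big_split; apply: eq_bigr => t _ /=.
  by rewrite hact_vseq //; ring.
have Rr : dual_form (hact (n - i.+2) z g1) g2 = dual_form g1 g2 + z *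
  \sum_(s : n.-tuple bool) \sum_(t : n.-tuple bool)
     (rook_sign s t)%:~R * (heckeb (n - i.+2) g1 (rev s) * g2 (vseq t)).
  rewrite /dual_form mulr_sumr -big_split; apply: eq_bigr => s _ /=.
  rewrite mulr_sumr -big_split; apply: eq_bigr => t _ /=.
  rewrite -[rev s]/(tval (rev_tuple s)) hact_vseq //; last by lia.
  by rewrite /=; ring.
rewrite {}L {}Rr; congr (_ + _ * _).
pose D b (x : int) : R := (if b then x else 0)%:~R.
have L s : \sum_(t : n.-tuple bool) (rook_sign s t)%:~R * (g1 (vseq (rev s)) * heckeb i g2 t) =
    \sum_(t : n.-tuple bool) (D (ascb i t) (rook_sign s (swapb i t)) -
         D (descb i t) (rook_sign s t)) * (g1 (vseq (rev s)) * g2 (vseq t)).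
  transitivity (\sum_(t : n.-tuple bool) (D (descb i t) (rook_sign s t) *
      (g1 (vseq (rev s)) * g2 (vseq (swapb i t))) -
      D (descb i t) (rook_sign s t) * (g1 (vseq (rev s)) * g2 (vseq t)))).
    by apply: eq_bigr => t _; rewrite /heckeb /D; case: ifP => _; rewrite ?rmorph0; ring.
  under [RHS]eq_bigr do rewrite mulrBl.
  rewrite !sumrB; congr (_ - _).
  rewrite (reindex_inj (h := @swapb_tuple n i)); last first.
    by apply: can_inj => t; apply/val_inj/swapbK.
  by apply: eq_bigr => t _ /=; rewrite descb_swapb swapbK.
under eq_bigr do rewrite L.
under [RHS]eq_bigr do under eq_bigr do rewrite mulrCA.
rewrite [LHS]exchange_big [RHS]exchange_big /=; apply: eq_bigr => t _.
transitivity (\sum_(s : n.-tuple bool) (D (descb i s) (rook_sign (swapb i s) t) -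
         D (ascb i s) (rook_sign s t)) * (g1 (vseq (rev s)) * g2 (vseq t))).
  apply: eq_bigr => s _; congr (_ * _).
  by rewrite /D -!rmorphB /= rook_sign_adjoint.
transitivity (\sum_(s : n.-tuple bool) (D (ascb i s) (rook_sign s t) *
      (g1 (vseq (rev (swapb i s))) * g2 (vseq t)) -
      D (ascb i s) (rook_sign s t) * (g1 (vseq (rev s)) * g2 (vseq t)))).
  under eq_bigr do rewrite mulrBl.
  rewrite !sumrB; congr (_ - _).
  rewrite [RHS](reindex_inj (h := @swapb_tuple n i)) /=; last first.
    by apply: can_inj => s; apply/val_inj/swapbK.
  by apply: eq_bigr => s _; rewrite -descb_swapb !swapbK.
apply: eq_bigr => s _; rewrite /heckeb descb_rev // swapb_rev // /D.
by case: ifP => _; rewrite ?rmorph0; ring.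
Qed.

Definition flipw W := rev [seq ((n - p.1.+2)%N, p.2) | p <- W].

Lemma dual_form_actw W g1 g2 : bounded_word n W ->
  dual_form g1 (actw W g2) = dual_form (actw (flipw W) g1) g2.
Proof.
elim/last_ind: W g1 => // W [i z] IH g1.
rewrite /bounded_word all_rcons => /andP[/= ni bW].
rewrite actw_rcons /= dual_form_hact // IH // /flipw map_rcons rev_rcons.
by rewrite actw_cons.
Qed.

End Duality.

Section Blocks.
Variable R : comNzRingType.
Implicit Types (L : seq (bool * R)) (x y : nat -> R).

Definition block K (p : bool * R) := if p.1 then incw K 0 p.2 else decw K 0 p.2.
Definition blocks K L := flatten (map (block K) L).
Definition gblocks M x y :=
  [seq (true, x j) | j <- rev (iota 0 M)] ++ [seq (false, y j) | j <- iota 0 M].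

Lemma blocks_cat K L L' : blocks K (L ++ L') = blocks K L ++ blocks K L'.
Proof. by rewrite /blocks map_cat flatten_cat. Qed.

Lemma GwordE K M x y : Gword K M x y = blocks K (gblocks M x y).
Proof. by rewrite blocks_cat /blocks -!map_comp. Qed.

Lemma bounded_blocks n L : bounded_word n (blocks n.-1 L).
Proof.
apply: all_flatten_map => -[[] z] _; apply/allP => p;
  by move=> /mapP[j]; rewrite ?mem_rev mem_index_iota => h -> /=; lia.
Qed.

Lemma flipw_cat n (W V : seq (nat * R)) : flipw n (W ++ V) = flipw n V ++ flipw n W.
Proof. by rewrite /flipw map_cat rev_cat. Qed.

(** Reflecting the indices exchanges increasing and decreasing words, and so does reversal: a full
    block is its own adjoint. *)
Lemma flipw_block n p : flipw n (block n.-1 p) = block n.-1 p.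
Proof.
case: p => b z; rewrite /flipw /block /=.
have E : rev [seq ((n - i.+2)%N, z) | i <- index_iota 0 n.-1] = incw n.-1 0 z.
  rewrite /incw /index_iota subn0.
  apply: (@eq_from_nth _ (0%N, z)); first by rewrite size_rev !size_map.
  move=> i; rewrite size_rev size_map size_iota => ni.
  rewrite nth_rev ?size_map ?size_iota // !(nth_map 0%N) ?size_iota //; last by lia.
  by rewrite !nth_iota //; try lia; congr (_, _); lia.
case: b; first by rewrite {1}/incw -map_comp; exact: E.
rewrite -[RHS]rev_incw -E revK -rev_incw map_rev revK.
by rewrite /incw -map_comp.
Qed.

Lemma flipw_blocks n L : flipw n (blocks n.-1 L) = blocks n.-1 (rev L).
Proof.
elim: L => // p L IH; rewrite -cat1s blocks_cat flipw_cat IH rev_cat blocks_cat; congr (_ ++ _).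
by rewrite /blocks /= cats0 flipw_block.
Qed.

Lemma delta01_vseq m a (s : seq bool) : size s = (m + a)%N ->
  delta01 R m (vseq s) = (s == nseq m false ++ nseq a true)%:R.
Proof.
move=> sz; congr (nat_of_bool _)%:R; apply/asboolP/eqP => [E|->].
  apply: (@eq_from_nth _ true); first by rewrite size_cat !size_nseq.
  have natb_inj : injective nat_of_bool by do 2!case.
  move=> k; rewrite sz => kn; apply: natb_inj.
  rewrite -[LHS]/(vseq s k) E /proj01 nth_cat size_nseq !nth_nseq.
  by case: ltnP => //; case: ifP.
apply/funext => k; rewrite /vseq /proj01 nth_cat size_nseq !nth_nseq.
by case: ltnP => //; case: ifP.
Qed.

Lemma dual_form_delta m a (g : (nat -> nat) -> R) :
  dual_form (m + a) (delta01 R m) g = g (vseq (nseq a true ++ nseq m false)).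
Proof.
have sz : size (nseq a true ++ nseq m false) == (m + a)%N.
  by rewrite size_cat !size_nseq addnC.
pose T := Tuple sz.
have revT (s : (m + a).-tuple bool) : (rev s == nseq m false ++ nseq a true) = (s == T).
  rewrite -(inj_eq (inv_inj revK)) revK rev_cat; congr (_ == _ ++ _).
    by apply: (@eq_from_nth _ true); rewrite ?size_rev ?size_nseq // => k kn;
       rewrite nth_rev ?size_nseq // !nth_nseq; do 2!case: ifP => //; lia.
  by apply: (@eq_from_nth _ true); rewrite ?size_rev ?size_nseq // => k kn;
     rewrite nth_rev ?size_nseq // !nth_nseq; do 2!case: ifP => //; lia.
rewrite /dual_form (bigD1 T) //= [X in _ + X]big1 ?addr0; last first.
  move=> s sT; rewrite big1 // => t _.
  by rewrite (@delta01_vseq m a) ?size_rev ?size_tuple // revT (negbTE sT) mul0r mulr0.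
rewrite (bigD1 T) //= [X in _ + X]big1 ?addr0; last first.
  move=> t tT; rewrite rook_sign_full.
  by rewrite -[nseq a true ++ _]/(tval T) (inj_eq val_inj) (negbTE tT) mul0r.
rewrite (@delta01_vseq m a) ?size_rev ?(eqP sz) // (revT T) eqxx.
by rewrite rook_sign_full eqxx !mul1r.
Qed.

End Blocks.

Section BlocksIdomain.
Variable R : idomainType.
Implicit Types (L : seq (bool * R)) (x y : nat -> R).

Lemma weq_block K (p q : bool * R) : 1 - p.2 != 0 -> 1 - q.2 != 0 ->
  weq (block K p ++ block K q) (block K q ++ block K p).
Proof.
case: p q => [[] z] [[] u] /= z1 u1; rewrite /block /=.
- exact: weq_inc_inc.
- exact: weq_sym (weq_dec_inc _ _ _ _).
- exact: weq_dec_inc.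
- exact: weq_dec_dec.
Qed.

Lemma weq_blocks_rot K p L : 1 - p.2 != 0 -> all (fun q => 1 - q.2 != 0) L ->
  weq (block K p ++ blocks K L) (blocks K L ++ block K p).
Proof.
move=> p1; elim: L => [|q L IH] /=; first by rewrite cats0.
move=> /andP[q1 L1]; rewrite -[blocks K (q :: L)]/(block K q ++ blocks K L).
rewrite catA; apply: weq_trans (weq_catr _ (weq_block K p1 q1)) _.
by rewrite -!catA; apply: weq_catl; apply: IH.
Qed.

Lemma weq_blocks_perm K L L' : perm_eq L L' -> all (fun q => 1 - q.2 != 0) L ->
  weq (blocks K L) (blocks K L').
Proof.
elim: L L' => [|p L IH] L'; first by rewrite perm_sym => /perm_nilP ->.
move=> pL /= /andP[p1 L1].
have pL' : p \in L' by rewrite -(perm_mem pL) mem_head.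
case/splitPr: pL' pL => A B; rewrite perm_sym perm_catC /= perm_cons perm_catC perm_sym => pL.
have [A1 B1] : all (fun q : bool * R => 1 - q.2 != 0) A /\
   all (fun q : bool * R => 1 - q.2 != 0) B.
  by apply/andP; rewrite -all_cat -(perm_all _ pL).
apply: weq_trans (weq_catl (block K p) (IH _ pL L1)) _.
rewrite !blocks_cat -[blocks K (p :: B)]/(block K p ++ blocks K B) !catA.
by apply: weq_catr; apply: weq_blocks_rot.
Qed.

(** By [dual_form_delta] the left side is a value of the form with a delta function as first
    argument. Moving L2 across reverses the order of its blocks, and their commutation restores
    it. *)
Lemma rect_coproduct m a L1 L2 : all (fun q => 1 - q.2 != 0) L2 ->
  actw (blocks (m + a).-1 (L1 ++ L2)) (delta01 R m) (vseq (nseq a true ++ nseq m false)) =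
  dual_form (m + a) (actw (blocks (m + a).-1 L2) (delta01 R m))
                    (actw (blocks (m + a).-1 L1) (delta01 R m)).
Proof.
move=> L21; rewrite -dual_form_delta blocks_cat actw_cat dual_form_actw; last exact: bounded_blocks.
rewrite flipw_blocks (@weq_blocks_perm (m + a).-1 (rev L2) L2) ?all_rev //.
exact/permPl/perm_rev.
Qed.

End BlocksIdomain.

Lemma iota_double M : perm_eq (iota 0 M.*2)
  ([seq j.*2 | j <- iota 0 M] ++ [seq j.*2.+1 | j <- iota 0 M]).
Proof.
elim: M => // M IH.
have -> : iota 0 M.+1.*2 = iota 0 M.*2 ++ [:: M.*2; M.*2.+1].
  by rewrite doubleS -addn2 iotaD.
have -> : iota 0 M.+1 = iota 0 M ++ [:: M] by rewrite -addn1 iotaD.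
rewrite !map_cat /= (perm_trans (perm_cat IH (perm_refl _))) // -!catA perm_cat2l /=.
by rewrite -[[:: M.*2; M.*2.+1]]cat1s perm_catCA.
Qed.

Lemma gblocks_double (R : comNzRingType) M (x y : nat -> R) :
  perm_eq (gblocks M.*2 x y)
   (gblocks M (x \o double) (y \o double) ++
    gblocks M (fun j => x j.*2.+1) (fun j => y j.*2.+1)).
Proof.
have E (T : eqType) (f : nat -> T) : perm_eq [seq f j | j <- iota 0 M.*2]
    ([seq f j.*2 | j <- iota 0 M] ++ [seq f j.*2.+1 | j <- iota 0 M]).
  by have := perm_map f (iota_double M); rewrite map_cat -!map_comp.
have Er (T : eqType) (f : nat -> T) k : perm_eq [seq f j | j <- rev (iota 0 k)] [seq f j | j <- iota 0 k].
  by apply: perm_map; apply/permPl/perm_rev.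
have G (x' y' : nat -> R) k : perm_eq (gblocks k x' y')
   ([seq (true, x' j) | j <- iota 0 k] ++ [seq (false, y' j) | j <- iota 0 k]).
  by apply: perm_cat => //; apply: Er.
apply: (perm_trans (G _ _ _)).
rewrite perm_sym; apply: (perm_trans (perm_cat (G _ _ _) (G _ _ _))).
rewrite perm_sym; apply: (perm_trans (perm_cat (E _ (fun j => (true, x j))) (E _ (fun j => (false, y j))))).
by rewrite -!catA perm_cat2l perm_catCA.
Qed.

Lemma rect_coproduct_double (R : idomainType) m a M (x y : nat -> R) :
  (forall j, 1 - x j != 0) -> (forall j, 1 - y j != 0) ->
  actw (Gword (m + a).-1 M.*2 x y) (delta01 R m) (vseq (nseq a true ++ nseq m false)) =
  dual_form (m + a)
   (actw (Gword (m + a).-1 M (fun j => x j.*2.+1) (fun j => y j.*2.+1)) (delta01 R m))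
   (actw (Gword (m + a).-1 M (x \o double) (y \o double)) (delta01 R m)).
Proof.
move=> x1 y1.
have all1 M' (x' y' : nat -> R) : (forall j, 1 - x' j != 0) -> (forall j, 1 - y' j != 0) ->
    all (fun q => 1 - q.2 != 0) (gblocks M' x' y').
  move=> x1' y1'; rewrite all_cat !all_map; apply/andP.
  by split; apply/allP => j _ /=; rewrite ?x1' ?y1'.
rewrite !GwordE (@weq_blocks_perm _ _ _ _ (gblocks_double M x y) _ (delta01 R m)); last exact: all1.
by rewrite rect_coproduct //; apply: all1 => j.
Qed.

Lemma cf_sum N I (r : seq I) (c : I -> int) (f : I -> {mpoly {mpoly int[N]}[N]}) a b :
  cf (\sum_(i <- r) (c i)%:~R * f i) a b = \sum_(i <- r) c i * cf (f i) a b.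
Proof.
rewrite /cf !raddf_sum; apply: eq_bigr => i _ /=.
by rewrite mulrzl !raddfMz mulrzz mulrC.
Qed.

Lemma ren_Gword M N s K p v :
  actw (Gword K M (xvar N \o s) (yvar N \o s)) (delta01 _ p) v =
  ren N s (actw (Gword K M (xvar M) (yvar M)) (delta01 _ p) v).
Proof.
rewrite ren_actw; congr (actw _ _ v); last first.
  by apply/funext => u; rewrite /delta01 /= rmorph_nat.
rewrite /Gword /incs /decs mapw_cat /mapw !map_flatten -!map_comp.
congr (flatten _ ++ flatten _); apply/eq_in_map => j; rewrite ?mem_rev mem_iota => /= jM.
  by rewrite -[RHS]/(mapw _ (incw _ _ _)) mapw_inc ren_xvar.
by rewrite -[RHS]/(mapw _ (decw _ _ _)) mapw_dec ren_yvar.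
Qed.

Definition gpoly M m n (t : seq bool) : {mpoly {mpoly int[M]}[M]} :=
  actw (Gword n.-1 M (xvar M) (yvar M)) (delta01 _ m) (vseq t).

Lemma gpoly_rect m a M :
  gpoly M.*2 m (m + a) (nseq a true ++ nseq m false) =
  \sum_(s : (m + a).-tuple bool) \sum_(t : (m + a).-tuple bool)
    (rook_sign s t)%:~R * (ren M.*2 (fun j => j.*2.+1) (gpoly M m (m + a) (rev s)) *
                           ren M.*2 double (gpoly M m (m + a) t)).
Proof.
transitivity (dual_form (m + a)
   (actw (Gword (m + a).-1 M (fun j => xvar M.*2 j.*2.+1) (fun j => yvar M.*2 j.*2.+1))
      (delta01 {mpoly {mpoly int[M.*2]}[M.*2]} m))
   (actw (Gword (m + a).-1 M (xvar M.*2 \o double) (yvar M.*2 \o double))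
      (delta01 {mpoly {mpoly int[M.*2]}[M.*2]} m))).
  exact_no_check (@rect_coproduct_double (pol2 M.*2) m a M _ _
     (xvar1_pol2 M.*2) (yvar1_pol2 M.*2)).
rewrite /dual_form; apply: eq_bigr => s _; apply: eq_bigr => t _.
congr (_ * (_ * _)); last exact: ren_Gword.
exact: (ren_Gword M M.*2 (fun j => j.*2.+1)).
Qed.

Lemma interleaveE (a a' : monom) k :
  interleave a a' k = if odd k then a' k./2 else a k./2.
Proof.
rewrite /interleave fsfunE; case: ifPn => // kn.
case: ifPn => ok; apply/esym/eqP/negPn/negP => nz; move/negP: kn; apply;
  rewrite in_fsetU; apply/orP; [right|left]; apply/imfsetP; exists k./2 => //=.
- by rewrite mem_finsupp.
- by rewrite -[LHS]odd_double_half ok.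
- by rewrite mem_finsupp.
by rewrite -[LHS]odd_double_half (negbTE ok).
Qed.

Lemma monom_bound (a : monom) : exists M, monom_lt M a.
Proof.
exists (\max_(i <- finsupp a) i).+1 => i ai; rewrite ltnS.
apply: (@leq_bigmax_seq _ _ xpredT id) => //.
by rewrite mem_finsupp; apply/eqP.
Qed.

Lemma monom_bounds (s : seq monom) : exists M, forall a, a \in s -> monom_lt M a.
Proof.
elim: s => [|a s [M IH]]; first by exists 0%N.
have [M' aM'] := monom_bound a; exists (maxn M M') => b.
rewrite inE => /orP[/eqP ->|/IH bM]; first exact: monom_lt_leq (leq_maxr _ _) aM'.
exact: monom_lt_leq (leq_maxl _ _) bM.
Qed.

(** Letters only permute the steps of a path, so its number of vertical steps is an invariant. This
    restricts the sums over all tuples to paths in the rectangle. *)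
Lemma gpoly_count m a M (t : (m + a).-tuple bool) : count negb t != m -> gpoly M m (m + a) t = 0.
Proof.
rewrite /gpoly GwordE; have := bounded_blocks (m + a) (gblocks M (xvar M) (yvar M)).
elim/last_ind: (blocks _ _) t => [|W [i z] IH] t.
  move=> _ tm; rewrite /actw /= (@delta01_vseq _ m a) ?size_tuple //.
  case: eqP => // e; move: tm; rewrite e count_cat !count_nseq /=.
  by rewrite mul0n addn0 mul1n eqxx.
rewrite /bounded_word all_rcons => /andP[/= ni bW] tm.
rewrite actw_rcons hact_vseq // /heckeb IH // add0r; case: ifP => _; rewrite ?mulr0 //.
rewrite -[swapb i t]/(tval (swapb_tuple i t)) IH ?subr0 ?mulr0 //=.
have -> // : forall s, count negb (swapb i s) = count negb s.
by elim: i {ni} => [|i IHi] [|x [|y s]] //=; rewrite ?IHi //; lia.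
Qed.

Lemma is_part_rows s : is_part [seq z <- rows s | 0 < z]%N.
Proof.
rewrite /is_part filter_all andbT sorted_pairwise; last by move=> u v w /= h1 h2; apply: leq_trans h2 h1.
exact/pairwise_filter/pairwise_rows.
Qed.

Definition part_above (s : seq bool) : part := Part (is_part_rows s).

Lemma rows_rect m a : rows (nseq a true ++ nseq m false) = nseq m a.
Proof.
elim: a => [|a /= ->]; last by rewrite map_nseq.
elim: m => //= m ->; by elim: m => //= m ->.
Qed.

Lemma G_part_rect_interleave m a (u u' v v' : monom) :
  G_part (rect m a) (interleave u u') (interleave v v') =
  \sum_(s : (m + a).-tuple bool | count negb s == m)
   \sum_(t : (m + a).-tuple bool | count negb t == m)
    rook_sign s t * (G_part (part_above t) u v * G_part (part_above (rev s)) u' v').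
Proof.
have [M bd] := monom_bounds [:: u; u'; v; v'].
have [uM u'M vM v'M] : [/\ monom_lt M u, monom_lt M u', monom_lt M v & monom_lt M v'].
  by split; apply: bd; rewrite !inE eqxx ?orbT.
have il w w' : monom_lt M w -> monom_lt M w' -> monom_lt M.*2 (interleave w w').
  by move=> wM w'M i; rewrite interleaveE; case: ifP => oi; [move/w'M|move/wM]; lia.
have sz : size (nseq a true ++ nseq m false) = (m + a)%N by rewrite size_cat !size_nseq addnC.
rewrite (@G_partE _ (nseq a true ++ nseq m false) _ _ _ (il _ _ uM u'M) (il _ _ vM v'M)); last first.
  rewrite rows_rect /=; case: eqP => [->|]; first by elim: m {sz} => //= m ->.
  by case: a {sz} => // a _; apply/all_filterP; rewrite all_nseq orbT.
rewrite sz rows_rect size_nseq -/(gpoly M.*2 m (m + a) _) gpoly_rect.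
rewrite pair_big /= [RHS]pair_big_dep /= (cf_sum _ (fun p : (m + a).-tuple bool * (m + a).-tuple bool => rook_sign p.1 p.2)) [RHS]big_mkcond /=.
apply: eq_bigr => -[s t] _ /=.
have Gt (r : (m + a).-tuple bool) w w' : monom_lt M w -> monom_lt M w' ->
    cf (gpoly M m (m + a) r) w w' = if count negb r == m then G_part (part_above r) w w' else 0.
  move=> wM w'M; case: eqP => [rm|/eqP rm]; last by rewrite gpoly_count // /cf !mcoeff0.
  by rewrite (@G_partE _ r _ _ M wM w'M) // size_rows rm size_tuple.
(* The primed variables stand at the odd indices and go with the first argument of the form, so they
   come first here. *)
rewrite (@cf_renM M M M.*2 _ _ u' u (interleave u u') v' v (interleave v v')).
- rewrite -[rev s]/(tval (rev_tuple s)) !Gt //= count_rev.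
  by case: eqP => _; case: eqP => _ /=; rewrite ?mulr0 ?mul0r ?mulr0 // [X in _ * X]mulrC.
- by move=> i j [] /double_inj/val_inj.
- by move=> i j /double_inj/val_inj.
- by move=> i j; lia.
- move=> k kM; have k2 : (k./2 < M)%N by lia.
  by case ok: (odd k); [left|right]; exists (Ordinal k2); rewrite /= -[RHS]odd_double_half ok.
- by move=> k kM; apply: monom_ltP (il _ _ uM u'M) _ kM.
- by move=> k kM; apply: monom_ltP (il _ _ vM v'M) _ kM.
- by move=> i; rewrite interleaveE /= odd_double /= uphalf_double.
- by move=> i; rewrite interleaveE odd_double doubleK.
- by move=> i; rewrite interleaveE /= odd_double /= uphalf_double.
- by move=> i; rewrite interleaveE odd_double doubleK.
Qed.

(** * Linear independence *)

(* The terms z^k (1 - z)^j f(o) of a full decreasing block, for (k, j, o) in the list. *)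
Fixpoint branch (c : bool) (v : seq bool) : seq (nat * nat * seq bool) :=
  match v with
  | [::] => [:: (0%N, 0%N, [:: c])]
  | d :: v' =>
      if c && ~~ d then
        [seq (p.1.1, p.1.2.+1, c :: p.2) | p <- branch d v'] ++
        [seq (p.1.1.+1, p.1.2, d :: p.2) | p <- branch c v']
      else [seq (p.1.1, p.1.2, c :: p.2) | p <- branch d v']
  end.

Section BranchSum.
Variable R : comNzRingType.

Lemma actw_shift_geq s g (W : seq (nat * R)) f w : all (fun p => s <= p.1)%N W ->
  actw W f (lift_nat s g w) = actw (shiftw s W) (f \o lift_nat s g) w.
Proof.
elim/last_ind: W w => // W [i z] IH w; rewrite all_rcons => /andP[/= si sW].
rewrite /shiftw filter_rcons /= si map_rcons !actw_rcons /hact /= -/(shiftw s W).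
rewrite IH // adj_swap_lift // IH //.
by rewrite /lift_nat !ltnNge si leqW //= subSn.
Qed.

Lemma actw_decw_cons K (z : R) f (b : bool) v :
  actw (decw K.+1 1 z) f (vseq (b :: v)) = actw (decw K 0 z) (fun u => f (lift_nat 1 (fun=> nat_of_bool b) u)) (vseq v).
Proof.
have -> : vseq (b :: v) = lift_nat 1 (fun=> nat_of_bool b) (vseq v).
  by apply/funext => -[|k] //=; rewrite /lift_nat /= subn1.
rewrite actw_shift_geq; first by rewrite shiftw_dec // subSS subn0.
by apply/allP => p /decw_bound /andP[].
Qed.

Lemma actw_branch (z : R) f c v :
  actw (decw (size v) 0 z) f (vseq (c :: v)) =
  \sum_(p <- branch c v) z ^+ p.1.1 * (1 - z) ^+ p.1.2 * f (vseq p.2).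
Proof.
have vE (b : bool) u : lift_nat 1 (fun=> nat_of_bool b) (vseq u) = vseq (b :: u).
  by apply/funext => -[|k] //=; rewrite /lift_nat /= subn1.
elim: v c f => [|d v IH] c f.
  by rewrite /= decw_geq // big_seq1 /= !expr0 !mul1r.
rewrite /= decw_ltn // actw_rcons /hact /=.
have -> : vseq [:: c, d & v] \o adj_swap 0 = vseq [:: d, c & v].
  by rewrite -(@vseq_swapb 0 [:: c, d & v]).
rewrite !actw_decw_cons !IH.
have -> : (vseq [:: c, d & v] 1 < vseq [:: c, d & v] 0)%N = c && ~~ d by case: c; case: d.
case: ifP => _; last first.
  by rewrite big_map; apply: eq_bigr => p _; rewrite /= vE.
rewrite big_cat !big_map !mulr_sumr; congr (_ + _); apply: eq_bigr => p _ /=; rewrite vE exprS; ring.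
Qed.

End BranchSum.

Fixpoint inversions (v : seq bool) : nat :=
  match v with
  | [::] => 0%N
  | true :: u => (count negb u + inversions u)%N
  | false :: u => inversions u
  end.

Fixpoint first_col (v : seq bool) : nat :=
  match v with
  | [::] => 0%N
  | true :: u => count negb u
  | false :: u => first_col u
  end.

(** The first column lies above the first horizontal step; moving this step to the end deletes the
    column and keeps the length of the path. *)
Fixpoint drop_col (v : seq bool) : seq bool :=
  match v with
  | [::] => [::]
  | true :: u => rcons u true
  | false :: u => false :: drop_col u
  end.

Lemma count_drop_col v : count negb (drop_col v) = count negb v.
Proof. by elim: v => // -[] v /= IH; rewrite ?IH // -cats1 count_cat /=; lia. Qed.

Lemma size_drop_col v : size (drop_col v) = size v.
Proof. by elim: v => // -[] v /= IH; rewrite ?IH // size_rcons. Qed.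

Lemma first_col_le v : (first_col v <= count negb v)%N.
Proof. by elim: v => // -[] v //= IH; apply: leq_trans IH _; apply: leq_addl. Qed.

Lemma drop_col_inj v w : first_col v = first_col w -> drop_col v = drop_col w -> v = w.
Proof.
elim: v w => [|[] v IH] [|[] w] //=.
- by move=> _ /(congr1 size); rewrite size_rcons.
- by move=> _ /(congr1 size); rewrite size_rcons.
- by move=> _ /rcons_inj[->].
- move=> h e; have := congr1 (count negb) e.
  by rewrite /= count_drop_col -cats1 count_cat /=; have := first_col_le w; lia.
- move=> h e; have := congr1 (count negb) e.
  by rewrite /= count_drop_col -cats1 count_cat /=; have := first_col_le v; lia.
- by move=> h [e]; rewrite (IH w).
Qed.

Lemma branch_count c v p : p \in branch c v ->
  size p.2 = (size v).+1 /\ count negb p.2 = count negb (c :: v).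
Proof.
elim: v c p => [|d v IH] c p /=; first by rewrite inE => /eqP ->.
case: ifP => [/andP[cT dF]|_]; last by move=> /mapP[q /IH[s1 s2] ->] /=; rewrite s1 s2.
rewrite mem_cat => /orP[] /mapP[q /IH[s1 s2] ->] /=; rewrite s1 s2 //=; split => //; lia.
Qed.

Lemma branch_inversions c v p : p \in branch c v ->
  inversions (c :: v) = (inversions p.2 + p.1.1)%N.
Proof.
elim: v c p => [|d v IH] c p /=.
  by rewrite inE => /eqP -> /=; case: c.
case: ifP => [/andP[]|]; case: c => //; case: d => // _.
- move=> _; rewrite mem_cat => /orP[] /mapP[q qb ->] /=;
  have := IH _ _ qb; have [_] := branch_count qb; rewrite /=; lia.
- move=> /mapP[q qb ->] /=; have := IH _ _ qb; have [_] := branch_count qb; rewrite /=; lia.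
- by move=> /mapP[q qb ->] /=; have := IH _ _ qb.
- by move=> /mapP[q qb ->] /=; have := IH _ _ qb.
Qed.

(** Each vertical step after the first horizontal one gives at most one factor: z if the carried
    step passes it, 1 - z if the carried step stops there. *)
Lemma branch_le c v p : p \in branch c v -> (p.1.1 + p.1.2 <= first_col (c :: v))%N.
Proof.
elim: v c p => [|d v IH] c p /=; first by rewrite inE => /eqP ->.
case: ifP => [/andP[]|]; case: c => //; case: d => // _.
- move=> _; rewrite mem_cat => /orP[] /mapP[q qb ->] /=;
  have := IH _ _ qb; rewrite /=; have := first_col_le v; lia.
- by move=> /mapP[q qb ->] /=; have := IH _ _ qb.
- by move=> /mapP[q qb ->] /=; have := IH _ _ qb.
- by move=> /mapP[q qb ->] /=; have := IH _ _ qb.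
Qed.

(** All these factors are z only if the first horizontal step is carried to the very end. *)
Lemma branch_top c v :
  [seq p <- branch c v | p.1.1 == first_col (c :: v)] =
  [:: (first_col (c :: v), 0%N, drop_col (c :: v))].
Proof.
elim: v c => [|d v IH] c; first by case: c.
rewrite [branch _ _]/=; case: ifP => [/andP[]|]; case: c => //; case: d => // _.
- move=> _; rewrite filter_cat !filter_map.
  rewrite (_ : filter _ (branch false v) = [::]) /=; last first.
    apply/eqP; rewrite -(negbK (_ == _)) -has_filter; apply/hasPn => p /branch_le /=.
    by have := first_col_le v; lia.
  by rewrite (eq_filter (a2 := fun p => p.1.1 == count negb v)) // (IH true).
- by rewrite filter_map (IH true).
- by rewrite filter_map (IH true).
- by rewrite filter_map (IH false).
Qed.

Definition decws (T : comNzRingType) K (ys : seq T) := flatten [seq decw K 0 y | y <- ys].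

Definition branch_coef (K : nat) (p : nat * nat * seq bool) : int :=
  ('X^(p.1.1) * (1 - 'X) ^+ p.1.2 : {poly int})`_K.

Lemma branch_coef_neq0 K p : branch_coef K p != 0 -> (p.1.1 <= K <= p.1.1 + p.1.2)%N.
Proof.
rewrite /branch_coef coefXnM; case: ltnP => // kK; apply: contraNT => h.
rewrite nth_default //; apply: (@leq_trans p.1.2.+1); last by lia.
apply: leq_trans (size_poly_exp_leq _ _) _.
suff -> : (size (1 - 'X : {poly int})).-1 = 1%N by rewrite mul1n.
by rewrite -size_polyN opprB size_XsubC.
Qed.

Lemma branch_coef_top K o : branch_coef K (K, 0%N, o) = 1.
Proof. by rewrite /branch_coef expr0 mulr1 coefXn eqxx. Qed.

Lemma branch_coef_intr (T : comNzRingType) K p (g : T) :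
  ('X^(p.1.1) * (1 - 'X) ^+ p.1.2 * g%:P)`_K = (branch_coef K p)%:~R * g.
Proof.
rewrite coefMC /branch_coef -(coef_map (intmul 1 : int -> T)) /=; congr (_`_K * _).
by rewrite rmorphM !rmorphXn rmorphB rmorph1 /= map_polyX.
Qed.

Definition branches (v : seq bool) := if v is c :: u then branch c u else [::].

Lemma inversions_first_col v : (0 < inversions v)%N -> (0 < first_col v)%N.
Proof.
elim: v => // -[] v IH //=.
have [c0|] := posnP (count negb v); last by lia.
have : (inversions v <= count negb v * size v)%N; last by rewrite c0; lia.
by elim: v {IH c0} => // -[] v /= IH; nia.
Qed.

Lemma inversions0 v : inversions v = 0%N ->
  v = nseq (count negb v) false ++ nseq (count id v) true.
Proof.
elim: v => // -[] v IH /=; last by move=> /IH {1}->.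
move=> /eqP; rewrite addn_eq0 => /andP[/eqP c0 /eqP /IH vE].
by rewrite c0 /= {1}vE c0.
Qed.

(** Arithmetic for the next lemma: i0 = d and iv count the boxes of v0 and v, i those of v0 without
    its first column, K is the length of that column, (k, j) are the exponents of a branch from v to
    the shortened v0, and fc is the first column of v. *)
Lemma squeeze_level (d i0 i iv K k j fc : nat) :
  i0 = d -> i0 = (i + K)%N -> iv = (i + k)%N -> (d <= iv)%N ->
  (k <= K <= k + j)%N -> (k + j <= fc)%N ->
  iv = d /\ ((fc <= K)%N -> k = fc /\ fc = K).
Proof. by move=> *; split; [lia|move=> ?; split; lia]. Qed.

(* Among the paths with c t != 0 and the fewest inversions (boxes), take those with the
   longest first column K.  The coefficient of z^K in one full decreasing block removes
   their first column, which gives a relation with fewer inversions. *)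
Lemma full_blocks_independent n m (c : n.-tuple bool -> int) :
  (forall t, c t != 0 -> count negb t = m) ->
  (forall (T : comNzRingType) (ys : seq T),
     \sum_t (c t)%:~R * actw (decws n.-1 ys) (delta01 T m) (vseq t) = 0) ->
  forall t, c t = 0.
Proof.
suff H d : forall c : n.-tuple bool -> int,
  (forall t, c t != 0 -> count negb t = m) ->
  (forall (T : comNzRingType) (ys : seq T),
     \sum_t (c t)%:~R * actw (decws n.-1 ys) (delta01 T m) (vseq t) = 0) ->
  forall t : n.-tuple bool, (inversions t < d)%N -> c t = 0.
  by move=> h1 h2 t; apply: (H (inversions t).+1).
elim: d => // d IH {}c cm c0 t1; rewrite ltnS leq_eqVlt => /orP[/eqP t1d|]; last exact: IH.
apply/eqP; apply: contraT => ct1; exfalso.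
have cd t : c t != 0 -> (d <= inversions t)%N.
  by move=> ct; rewrite leqNgt; apply: contra ct => td; rewrite (IH c cm c0).
have csz t : c t != 0 -> size t = (m + (n - m))%N.
  by move/cm => <-; have := count_size negb t; rewrite size_tuple; lia.
have cid t : c t != 0 -> count id t = (n - m)%N.
  move/cm => <-; have := count_predC negb t; rewrite size_tuple.
  by rewrite (@eq_count _ (predC negb) id) => [|[]//]; lia.
(* If d = 0, the relation with no block at all isolates the value of c at the path without boxes. *)
have [d0|dpos] := posnP d.
  have t1E : tval t1 = nseq m false ++ nseq (n - m) true.
    by rewrite {1}(@inversions0 t1) ?(cm _ ct1) ?(cid _ ct1) // t1d.
  have := c0 int [::]; rewrite (bigD1 t1) //= [X in _ + X]big1 ?addr0.
    by rewrite /actw /= (@delta01_vseq _ m (n - m)) ?csz // {1}t1E eqxx mulr1 intz => /eqP; apply/negP.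
  move=> t tt1; rewrite /actw /=.
  have [->|ct] := eqVneq (c t) 0; first by rewrite mul0r.
  rewrite (@delta01_vseq _ m (n - m)) ?csz // -t1E.
  by rewrite (inj_eq val_inj) (negbTE tt1) mulr0.
pose P t := (c t != 0) && (inversions (tval t) == d).
have Pt1 : P t1 by rewrite /P ct1 t1d eqxx.
case: (@arg_maxnP _ t1 P (fun t => first_col (tval t)) Pt1) => v0 /andP[cv0 /eqP v0d] v0max.
set K := first_col v0 in v0max.
have npos : (0 < n)%N.
  by rewrite -(size_tuple v0); case: (tval v0) v0d => // d0; move: dpos; rewrite -d0.
(* These are the coefficients of the relation obtained by appending a block with an indeterminate as
   parameter and extracting the coefficient of its K-th power. *)
pose c' (o : n.-tuple bool) : int :=
  \sum_v c v * \sum_(p <- branches (tval v) | p.2 == o) branch_coef K p.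
have brP (v : n.-tuple bool) p : p \in branches (tval v) ->
    [/\ size p.2 = n, count negb p.2 = count negb v,
        inversions v = (inversions p.2 + p.1.1)%N & (p.1.1 + p.1.2 <= first_col v)%N].
  case: v => -[|b v] /= sv // pb; have [s1 s2] := branch_count pb.
  by split; rewrite ?s1 ?s2 ?(eqP sv) //; [exact: branch_inversions pb|exact: branch_le pb].
have c'm o : c' o != 0 -> count negb o = m.
  move=> c'o; apply/eqP; apply: contraNT c'o => om; rewrite /c' big1 // => v _.
  have [->|cv] := eqVneq (c v) 0; first by rewrite mul0r.
  rewrite big_seq_cond big1 ?mulr0 // => p /andP[/brP[_ pc _ _] /eqP po].
  by move: om; rewrite -(cm _ cv) -pc po eqxx.
have c'0 (T : comNzRingType) (ys : seq T) :
    \sum_t (c' t)%:~R * actw (decws n.-1 ys) (delta01 T m) (vseq t) = 0.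
  set g := actw (decws n.-1 ys) (delta01 T m).
  have := congr1 (fun q : {poly T} => q`_K) (c0 {poly T} (rcons (map polyC ys) 'X)).
  rewrite coef0 coef_sum => cK; rewrite -[RHS]cK.
  transitivity (\sum_v \sum_(p <- branches (tval v)) (c v)%:~R * ((branch_coef K p)%:~R * g (vseq p.2))).
    transitivity (\sum_(o : n.-tuple bool) \sum_(v : n.-tuple bool) \sum_(p <- branches (tval v) | p.2 == tval o)
       (c v)%:~R * ((branch_coef K p)%:~R * g (vseq p.2))).
      apply: eq_bigr => o _; rewrite /c' rmorph_sum mulr_suml; apply: eq_bigr => v _.
      rewrite rmorphM rmorph_sum -mulrA mulr_suml mulr_sumr; apply: eq_bigr => p /eqP -> //.
    rewrite exchange_big; apply: eq_bigr => v _ /=.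
    under eq_bigr do rewrite big_mkcond.
    rewrite exchange_big /= big_seq [RHS]big_seq; apply: eq_bigr => p /brP[/eqP sp _ _ _].
    rewrite -big_mkcond (big_pred1 (Tuple sp)) //.
  apply: eq_bigr => v _.
  have gE u : actw (decws n.-1 (map polyC ys)) (delta01 {poly T} m) u = (g u)%:P.
    rewrite actw_morph; congr (actw _ _ u).
      rewrite /decws /mapw map_flatten -!map_comp; congr flatten; apply: eq_map => y /=.
      by rewrite -[RHS]/(mapw _ (decw _ _ _)) mapw_dec.
    by apply/funext => w; rewrite /delta01 /= rmorph_nat.
  rewrite /decws map_rcons flatten_rcons actw_cat -/(decws _ _) (funext gE).
  have E (A : {poly T}) : ((c v)%:~R * A)`_K = (c v)%:~R * A`_K.
    by rewrite !mulrzl -[LHS]/(coefp K _) raddfMz.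
  rewrite E -mulr_sumr; congr (_ * _).
  case: v {E} => -[|b u] /= sv.
    by move: npos; rewrite -(eqP sv).
  rewrite -[n.-1](_ : size u = _); last by rewrite -(eqP sv).
  by rewrite actw_branch coef_sum; apply: eq_bigr => p _; rewrite branch_coef_intr.
have topE : [seq p <- branches (tval v0) | p.1.1 == K] = [:: (K, 0%N, drop_col v0)].
  by rewrite /K; case: (tval v0) (size_tuple v0) => [n0|b u _]; [rewrite -n0 in npos|exact: branch_top].
have topP (v : n.-tuple bool) (_ : (0 < n)%N) p : p \in branches (tval v) ->
    p.1.1 = first_col v -> p = (first_col v, 0%N, drop_col v).
  case: v => -[|b u] /= sv // pb pk; have := branch_top b u.
  have : p \in [seq p <- branch b u | p.1.1 == first_col (b :: u)] by rewrite mem_filter pb pk /= eqxx.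
  by move=> /[swap] ->; rewrite inE => /eqP.
have invK : inversions v0 = (inversions (drop_col v0) + K)%N.
  have : (K, 0%N, drop_col v0) \in [seq p <- branches (tval v0) | p.1.1 == K] by rewrite topE inE.
  by rewrite mem_filter => /andP[_ /brP[]].
have o0P : size (drop_col v0) == n by rewrite size_drop_col size_tuple.
pose o0 : n.-tuple bool := Tuple o0P.
(* No other v contributes: minimality of d forces k = K and d boxes for v, and maximality of K then
   forces its first column to be K, so that v shortens to the same path and equals v0. *)
have c'v : c' o0 = c v0.
  rewrite /c' (bigD1 v0) //= [X in _ + X]big1 ?addr0; last first.
    move=> v vv0; have [->|cv] := eqVneq (c v) 0; first by rewrite mul0r.
    rewrite big_seq_cond big1 ?mulr0 // => -[[k j] o] /andP[pb /eqP /= po].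
    have [_ _ /= pinv /= pfc] := brP v _ pb.
    apply/eqP; apply: contraNT vv0 => /branch_coef_neq0 /= kK.
    rewrite po in pinv.
    have [vd sq] := squeeze_level v0d invK pinv (cd _ cv) kK pfc.
    have Pv : P v by rewrite /P cv vd eqxx.
    have [pk fcK] := sq (v0max _ Pv).
    have [_ _ oE] := topP v npos _ pb pk.
    have vE : v = v0 by apply/val_inj/drop_col_inj => //; rewrite -oE.
    by rewrite vE eqxx.
  rewrite -[RHS]mulr1; congr (_ * _).
  rewrite big_seq_cond.
  rewrite (eq_bigl (fun p => (p \in branches (tval v0)) && (p.1.1 == K))); last first.
    move=> p; case pb : (p \in _) => //=; apply/eqP/eqP => [po|pk].
      by have [_ _ pinv _] := brP v0 p pb; rewrite po /= in pinv; apply: (@addnI (inversions (drop_col v0))); rewrite -pinv -invK.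
    by rewrite (topP v0 npos p pb pk).
  rewrite -big_seq_cond -big_filter topE big_seq1; exact: branch_coef_top.
have Kpos : (0 < K)%N by apply: inversions_first_col; rewrite v0d.
case/eqP: cv0; rewrite -c'v; apply: IH c'm c'0 _ _.
by rewrite /= -v0d invK -addn1 leq_add2l.
Qed.

Lemma rows_inj s t : size s = size t -> rows s = rows t -> s = t.
Proof.
elim: s t => [|x s IH] [|y t] //= [st].
case: x; case: y => h.
- by rewrite (IH t) //; apply: inj_map h => ? ? [].
- have : 0%N \in rcons (rows t) 0%N by rewrite mem_rcons mem_head.
  by rewrite -h => /mapP[].
- have : 0%N \in rcons (rows s) 0%N by rewrite mem_rcons mem_head.
  by rewrite h => /mapP[].
by move: h => /rcons_inj[h]; rewrite (IH t).
Qed.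

Lemma rows_pad s : rows s = [seq z <- rows s | 0 < z]%N ++ nseq (count negb s - size [seq z <- rows s | 0 < z]%N) 0%N.
Proof.
rewrite -size_rows; elim: (rows s) (pairwise_rows s) => //= x l IH /andP[xl pl].
case: ifP => [x0|/negbT]; first by rewrite /= subSS -IH.
rewrite -leqNgt leqn0 => /eqP x0; rewrite x0 in xl *.
have l0 : l = nseq (size l) 0%N.
  by apply/all_pred1P/allP => y yl; have /= := allP xl y yl; rewrite leqn0.
have -> : [seq z <- l | 0 < z]%N = [::] by rewrite l0; elim: (size l).
by rewrite /= -l0.
Qed.

Lemma part_above_inj n (s t : n.-tuple bool) : count negb s = count negb t ->
  part_above s = part_above t -> s = t.
Proof.
move=> st /(congr1 part_seq) /= e; apply/val_inj/rows_inj; first by rewrite !size_tuple.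
by rewrite rows_pad e st -rows_pad.
Qed.

Lemma path_exists m a (l : part) : (size l <= m)%N -> (all (fun x => x <= a)%N l) ->
  exists t : (m + a).-tuple bool, [/\ count negb t = m, rows t = l ++ nseq (m - size l) 0%N
    & part_above t = l].
Proof.
move=> lm la.
have sz : size (l ++ nseq (m - size l) 0%N) = m by rewrite size_cat size_nseq subnKC.
have [||s [sE ss]] := @rows_exists a (l ++ nseq (m - size l) 0%N).
- have pw k : pairwise geq (nseq k 0%N).
    by elim: k => //= k ->; rewrite andbT; apply/allP => x /nseqP[-> _].
  rewrite pairwise_cat part_pairwise pw !andbT.
  by apply/allrelP => x y _ /nseqP[-> _]; apply: leq0n.
- by rewrite all_cat la all_nseq orbT.
rewrite sz in ss; exists (Tuple (introT eqP ss)); split => //=.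
  by rewrite -size_rows sE sz.
apply/val_inj; rewrite /= sE filter_cat (all_filterP (part_pos l)).
by rewrite (_ : [seq z <- nseq _ _ | _]%N = [::]) ?cats0 //; elim: (m - size l)%N.
Qed.

Lemma monom_exists M (g : nat -> nat) : exists2 u : monom, monom_lt M u &
  forall i, (i < M)%N -> u i = g i.
Proof.
exists [fsfun k in [fset i in iota 0 M]%fset => g k].
  move=> i; rewrite fsfunE; case: ifP => // h _.
  by move: h; rewrite !inE /= mem_iota.
by move=> i iM; rewrite fsfunE !inE /= mem_iota iM.
Qed.

Lemma cf_eq0 M (f : {mpoly {mpoly int[M]}[M]}) :
  (forall u v : monom, monom_lt M u -> monom_lt M v -> cf f u v = 0) -> f = 0.
Proof.
move=> h; apply/mpolyP => A; apply/mpolyP => B; rewrite !mcoeff0.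
have [u uM uA] := monom_exists M (fun i => if insub i is Some k then A k else 0%N).
have [v vM vB] := monom_exists M (fun i => if insub i is Some k then B k else 0%N).
have EA : [multinom u i | i < M] = A by apply/mnmP => i; rewrite mnmE uA // valK.
have EB : [multinom v i | i < M] = B by apply/mnmP => i; rewrite mnmE vB // valK.
by have := h u v uM vM; rewrite /cf EA EB.
Qed.

Section Evaluation.
Variables (T : comNzRingType) (M : nat) (y : nat -> T).

(** At x = 0 the increasing blocks become the identity, which leaves the decreasing blocks required
    by [full_blocks_independent]. *)
Definition yeval : {mpoly {mpoly int[M]}[M]} -> T :=
  mmap (mmap (intmul 1 : int -> T) (fun i : 'I_M => y i)) (fun _ : 'I_M => 0).
HB.instance Definition _ := GRing.RMorphism.on yeval.

Lemma yeval_xvar k : yeval (xvar M k) = 0.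
Proof.
rewrite /xvar; case: insubP => [i _ _|_]; last exact: rmorph0.
by rewrite /yeval (mmapX _ (mmap (intmul 1 : int -> T) (fun i : 'I_M => y i))) mmap1U.
Qed.

Lemma yeval_yvar k : (k < M)%N -> yeval (yvar M k) = y k.
Proof.
by move=> kM; rewrite -[k]/(val (Ordinal kM)) yvar_ord /yeval (mmapC _ (mmap (intmul 1 : int -> T) (fun i : 'I_M => y i))) /= mmapX mmap1U.
Qed.

Lemma yeval_actw W f w : yeval (actw W f w) = actw (mapw yeval W) (yeval \o f) w.
Proof. exact_no_check (actw_morph yeval W f w). Qed.

Lemma yeval_gpoly m n t : yeval (gpoly M m n t) =
  actw (decs n.-1 M y) (delta01 T m) (vseq t).
Proof.
rewrite /gpoly yeval_actw (_ : yeval \o _ = delta01 T m); last first.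
  by apply/funext => u; rewrite /delta01 /= rmorph_nat.
have E s : actw (mapw yeval (flatten [seq incw n.-1 0 (xvar M j) | j <- s])) (delta01 T m) = delta01 T m.
  by elim: s => // j s IH; rewrite /= mapw_cat actw_cat mapw_inc yeval_xvar weq_inc0.
rewrite /Gword mapw_cat actw_cat E; congr (actw _ _ _).
rewrite /decs /mapw map_flatten -map_comp; congr flatten.
apply/eq_in_map => j; rewrite mem_iota => /= jM.
by rewrite -[LHS]/(mapw _ (decw _ _ _)) mapw_dec yeval_yvar.
Qed.

End Evaluation.

(** All partitions of the list are drawn in one rectangle. A relation between the series is then one
    between the polynomials [gpoly] in any number of variables, and the values of y may be chosen in
    any ring. *)
Lemma G_part_independent (ls : seq part) (c : part -> int) : uniq ls ->
  (forall u v, \sum_(l <- ls) c l * G_part l u v = 0) -> {in ls, forall l, c l = 0}.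
Proof.
move=> uls h.
pose m := \max_(l <- ls) size l; pose a := \max_(l <- ls) head 0%N l.
have ex l : l \in ls -> exists t : (m + a).-tuple bool, [/\ count negb t = m,
    rows t = l ++ nseq (m - size l) 0%N & part_above t = l].
  move=> lls; apply: path_exists; first exact: leq_bigmax_seq.
  apply: sub_all (part_bound_head l) => x /leq_trans; apply.
  by apply: (@leq_bigmax_seq _ _ xpredT (fun l : part => head 0%N l)).
pose c' (t : (m + a).-tuple bool) : int :=
  if (count negb t == m) && (part_above t \in ls) then c (part_above t) else 0.
have c'm t : c' t != 0 -> count negb t = m.
  by rewrite /c'; case: (eqVneq (count negb t) m) => //= _; rewrite eqxx.
have poly0 M : \sum_t (c' t)%:~R * gpoly M m (m + a) (tval t) = 0.
  apply: cf_eq0 => u v uM vM; rewrite cf_sum -[RHS](h u v).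
  transitivity (\sum_(t : (m + a).-tuple bool) \sum_(l <- ls)
     if (count negb t == m) && (part_above t == l) then c l * G_part l u v else 0).
    apply: eq_bigr => t _; rewrite /c'; case: eqP => tm /=; last first.
      by rewrite mul0r big1.
    case: ifP => tls.
      rewrite (bigD1_seq (part_above t)) //= eqxx big1 => [|l /negbTE tl]; last by rewrite eq_sym tl.
      by rewrite addr0 (@G_partE _ t _ _ M uM vM) // size_tuple size_rows tm.
    rewrite mul0r big_seq big1 // => l ll; case: eqP => // tl.
    by move: tls; rewrite tl ll.
  rewrite exchange_big /= big_seq [RHS]big_seq; apply: eq_bigr => l /ex[t0 [t0m _ t0l]].
  rewrite (bigD1 t0) //= t0m t0l !eqxx big1 ?addr0 // => t tt0.
  case: ifP => // /andP[/eqP tm /eqP tl]; case/eqP: tt0; apply: part_above_inj.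
    by rewrite tm t0m.
  by rewrite tl t0l.
have c'0 : forall t, c' t = 0.
  apply: full_blocks_independent c'm _ => T ys.
  have := congr1 (yeval (nth 0 ys)) (poly0 (size ys)).
  rewrite rmorph0 rmorph_sum => E; rewrite -[RHS]E; apply: eq_bigr => t _ /=.
  rewrite rmorphM /= rmorph_int; congr (_ * _).
  rewrite yeval_gpoly /decws /decs; congr (actw (flatten _) _ _).
  by rewrite -{1}(mkseq_nth 0 ys) /mkseq -map_comp.
move=> l lls; have [t [tm _ tl]] := ex l lls.
by have := c'0 t; rewrite /c' tm tl eqxx lls.
Qed.

(** * Rook strips and diagrams *)

(** A pair holds the lengths of one row before and after adding boxes. When two rows both grow,
    equal new lengths mean new boxes in the same column. *)
Definition small_step (p : nat * nat) := (p.1 <= p.2 <= p.1.+1)%N.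
Definition column_free (p q : nat * nat) :=
  ~~ [&& p.2 == p.1.+1, q.2 == q.1.+1 & p.2 == q.2].
Definition rook_pairs z := all small_step z && pairwise column_free z.

Lemma rook_pairs_rcons0 z : rook_pairs (rcons z (0%N, 0%N)) = rook_pairs z.
Proof.
rewrite /rook_pairs all_rcons pairwise_rcons /=; congr (_ && _).
rewrite (_ : all _ z = true) //; apply/allP => p _.
by rewrite /column_free /= andbF.
Qed.

Lemma rook_pairs_succ z : rook_pairs [seq (p.1.+1, p.2.+1) | p <- z] = rook_pairs z.
Proof. by rewrite /rook_pairs all_map pairwise_map. Qed.

Lemma rook_pairs_rcons1 z :
  rook_pairs (rcons [seq (p.1.+1, p.2.+1) | p <- z] (0%N, 1%N)) = rook_pairs z.
Proof.
rewrite /rook_pairs all_rcons pairwise_rcons /= -[RHS]/(rook_pairs z) -(rook_pairs_succ z).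
rewrite (_ : all (column_free^~ _) _ = true) //.
by rewrite all_map; apply/allP => p _; rewrite /column_free /= !eqSS; case: p => k [|l] //=; rewrite ?andbF.
Qed.

Lemma zip_succ (u v : seq nat) :
  zip (map succn u) (map succn v) = [seq (p.1.+1, p.2.+1) | p <- zip u v].
Proof. by elim: u v => [|x u IH] [|y v] //=; rewrite IH. Qed.

Lemma sumn_succ u : sumn (map succn u) = (sumn u + size u)%N.
Proof. by elim: u => //= x u ->; lia. Qed.

Lemma sumn_rook_pairs u v : size u = size v -> all small_step (zip u v) -> (sumn u <= sumn v)%N.
Proof.
elim: u v => [|x u IH] [|y v] //= [suv] /andP[/andP[/= xy _] h].
exact: leq_add xy (IH _ suv h).
Qed.

(** Equal first steps shift all rows together or add a last row (0, 0). Replacing 01 by 10 adds the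
    last row (0, 1), whose box is the only new one in the first column. Every other beginning
    shrinks a row, adds two boxes to a row or puts two boxes into the first column. *)
Lemma rook_signE s t : size s = size t -> count negb s = count negb t ->
  rook_sign s t = if rook_pairs (zip (rows s) (rows t))
                  then (-1) ^+ (sumn (rows t) - sumn (rows s)) else 0.
Proof.
have [d] := ubnP (size s); elim: d s t => // d IH [|x s] [|y t] //= sd [sz].
case: x; case: y => /=.
- move=> [ct]; rewrite IH // zip_succ rook_pairs_succ !sumn_succ !size_rows.
  by case: ifP => // _; congr (_ ^+ _); lia.
- rewrite add0n add1n => ct.
  have [l [z lE]] : exists l z, rows s = rcons l z.
    by case: (lastP (rows s)) (size_rows s) => [|l z _]; [rewrite ct|exists l, z].
  rewrite lE map_rcons zip_rcons; last first.
    by have := size_rows s; rewrite lE size_rcons ct size_map size_rows; lia.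
  by rewrite /rook_pairs all_rcons.
- case: s sd sz => [|[] s] sd sz.
  + by case: t sz => // _ /=; lia.
  + case: t sz => [|[] t] sz //=.
      rewrite !add0n add1n => ct.
      have [l [z lE]] : exists l z, rows t = rcons l z.
        by case: (lastP (rows t)) (size_rows t) => [|l z _]; [rewrite -ct|exists l, z].
      rewrite lE !map_rcons zip_rcons; last first.
        by have := size_rows t; rewrite lE size_rcons -ct !size_map size_rows; lia.
      by rewrite /rook_pairs all_rcons /small_step /=.
    rewrite !add0n !add1n => -[ct]; rewrite IH //; try by move: sz sd => /= []; lia.
    rewrite map_rcons zip_rcons; last by rewrite !size_map !size_rows.
    rewrite zip_succ rook_pairs_rcons1 -!cats1 !sumn_cat !sumn_succ !size_rows /=.
    case: ifP => [/andP[h _]|_]; last by rewrite oppr0.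
    have := sumn_rook_pairs _ h; rewrite !size_rows => /(_ ct) le.
    transitivity ((-1 : int) ^+ (sumn (rows t) - sumn (rows s)).+1); first by rewrite exprS mulN1r.
    by congr (_ ^+ _); rewrite ct; lia.
  + rewrite /= !add0n !add1n => ct.
    have [l [z [z' lE]]] : exists l z z', rows t = rcons (rcons l z) z'.
      case: (lastP (rows t)) (size_rows t) => [|l' z'].
        by rewrite /= -ct.
      case: (lastP l') => [|l z]; first by rewrite /= -ct.
      by exists l, z, z'.
    rewrite lE !map_rcons !zip_rcons.
    * rewrite /rook_pairs !all_rcons !pairwise_rcons all_rcons /small_step /=.
      rewrite !ltnS !leqn0 /column_free /=.
      by case: z lE => [|z] lE; case: z' lE => [|z'] lE; rewrite /= ?andbF.
    * by have := size_rows t; rewrite lE !size_rcons -ct size_map size_rows; lia.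
    * by have := size_rows t; rewrite lE !size_rcons -ct size_map size_rows; lia.
move=> [ct]; rewrite IH // zip_rcons ?size_rows // rook_pairs_rcons0.
by rewrite -!cats1 !sumn_cat /= !addn0.
Qed.

Lemma rook_pairsP u v : size u = size v ->
  reflect ((forall i, (i < size u)%N -> (nth 0 u i <= nth 0 v i <= (nth 0 u i).+1)%N) /\
           (forall i j, (i < j < size u)%N -> nth 0 v i = (nth 0 u i).+1 :> nat ->
              nth 0 v j = (nth 0 u j).+1 :> nat -> nth 0 v i <> nth 0 v j :> nat))
          (rook_pairs (zip u v)).
Proof.
move=> suv; have sz : size (zip u v) = size u by rewrite size_zip suv minnn.
have nz i : nth (0%N, 0%N) (zip u v) i = (nth 0%N u i, nth 0%N v i) by rewrite nth_zip.
apply: (iffP andP) => [[/(all_nthP (0%N, 0%N)) h1 /(pairwiseP (0%N, 0%N)) h2]|[h1 h2]]; split.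
- by move=> i iu; have := h1 i; rewrite sz nz => /(_ iu).
- move=> i j /andP[ij ju] vi vj e.
  have /= := h2 i j; rewrite !inE sz !nz => /(_ (ltn_trans ij ju) ju ij).
  by rewrite /column_free /= -vi -vj e !eqxx.
- by apply/(all_nthP (0%N, 0%N)) => i; rewrite sz nz => /h1.
apply/(pairwiseP (0%N, 0%N)) => i j; rewrite !inE sz !nz => iu ju ij.
apply/negP => /and3P[/= /eqP vi /eqP vj /eqP e].
by apply: (h2 i j) => //; rewrite ij.
Qed.

Lemma nth_part_above s i : nth 0%N (part_above s) i = nth 0%N (rows s) i.
Proof.
rewrite [in RHS]rows_pad nth_cat; case: ltnP => // h.
by rewrite nth_nseq nth_default //; case: ifP.
Qed.

Lemma sumn_part_above s : sumn (part_above s) = sumn (rows s).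
Proof. by rewrite [in RHS]rows_pad sumn_cat sumn_nseq mul0n addn0. Qed.

Lemma rows_rcons_true s : rows (rcons s true) = rows s.
Proof. by elim: s => // -[] s /= ->. Qed.

Lemma rows_rcons_false s : rows (rcons s false) = count id s :: rows s.
Proof. by elim: s => // -[] s /= ->. Qed.

Lemma rows_rev s : rows (rev s) = rev [seq (count id s - x)%N | x <- rows s].
Proof.
elim: s => // -[] s IH; rewrite rev_cons /=.
  by rewrite rows_rcons_true IH -map_comp; congr rev; apply: eq_map => x /=; rewrite add1n subSS.
rewrite rows_rcons_false IH map_rcons rev_rcons subn0 add0n; congr (_ :: _).
by rewrite count_rev.
Qed.

Definition rect_split m a (sigma tau : part) : Prop :=
  [/\ diagram sigma `<=` rect_diagram m a,
      diagram tau `<=` rect_diagram m a,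
      diagram sigma `|` rotated m a tau = rect_diagram m a &
      rook_strip (diagram sigma `&` rotated m a tau)].

Section RectSplit.
Variables (m a : nat) (s t : (m + a).-tuple bool).
Hypotheses (sm : count negb s = m) (tm : count negb t = m).

Lemma count_true (r : (m + a).-tuple bool) : count negb r = m -> count id r = a.
Proof.
move=> rm; have := count_predC negb r; rewrite size_tuple rm => /addnI e.
by rewrite -[RHS]e; apply: eq_count => -[].
Qed.

Lemma part_above_in_rect (r : (m + a).-tuple bool) : count negb r = m ->
  diagram (part_above r) `<=` rect_diagram m a.
Proof.
move=> rm [i j]; rewrite /diagram /rect_diagram /= nth_part_above => h.
have ir : (i < size (rows r))%N by rewrite ltnNge; apply/negP => le; rewrite nth_default in h.
rewrite -{1}rm -size_rows; split => //; apply: leq_trans h _.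
by have /allP/(_ _ (mem_nth 0%N ir)) := rows_bound r; rewrite count_true.
Qed.

Lemma rotated_part_above : rotated m a (part_above (rev s)) =
  rect_diagram m a `\` diagram (part_above s).
Proof.
have E i j : (i < m)%N -> (j < a)%N ->
    ((a - j).-1 < nth 0 (part_above (rev s)) (m - i).-1)%N = (nth 0 (part_above s) i <= j)%N.
  move=> im ja; rewrite !nth_part_above rows_rev nth_rev size_map size_rows sm; last by lia.
  rewrite (nth_map 0%N) ?size_rows ?sm ?count_true //; last by lia.
  rewrite (_ : (m - (m - i).-1.+1 = i)%N); last by lia.
  by move: (nth _ _ _) => k; lia.
apply/seteqP; split=> -[i j]; rewrite /rotated /rect_diagram /diagram /=.
  by move=> [[im ja]]; rewrite E // => h; split=> //; apply/negP; rewrite -leqNgt.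
by move=> [[im ja] /negP]; rewrite -leqNgt => h; split=> //; rewrite E.
Qed.

(** By [rotated_part_above] the rotated tau is the complement of the partition of s. So covering the
    rectangle means that s lies inside t, and the intersection is the skew diagram between them. *)
Lemma rect_splitP : rect_split m a (part_above t) (part_above (rev s)) <->
  rook_pairs (zip (rows s) (rows t)).
Proof.
have szst : size (rows s) = size (rows t) by rewrite !size_rows sm tm.
have revm : count negb (rev_tuple s) = m by rewrite /= count_rev.
have tle i : (nth 0 (rows t) i <= a)%N.
  have [h|h] := ltnP i (size (rows t)); last by rewrite nth_default.
  by have /allP/(_ _ (mem_nth 0%N h)) := rows_bound t; rewrite count_true.
have sle i : (nth 0 (rows s) i <= a)%N.
  have [h|h] := ltnP i (size (rows s)); last by rewrite nth_default.
  by have /allP/(_ _ (mem_nth 0%N h)) := rows_bound s; rewrite count_true.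
rewrite /rect_split rotated_part_above; split.
  move=> [_ _ cover [_ strip]]; apply/rook_pairsP => //.
  have cov i j : (i < m)%N -> (j < a)%N -> (j < nth 0 (rows t) i)%N \/ (nth 0 (rows s) i <= j)%N.
    move=> im ja; have : rect_diagram m a (i, j) by [].
    rewrite -cover => -[|[_]]; rewrite /diagram /= nth_part_above; first by left.
    by move/negP; rewrite -leqNgt; right.
  have mem i j : (i < m)%N -> (nth 0 (rows s) i <= j < nth 0 (rows t) i)%N ->
      (diagram (part_above t) `&` (rect_diagram m a `\` diagram (part_above s))) (i, j).
    move=> im /andP[h1 h2]; rewrite /diagram /rect_diagram /= !nth_part_above.
    split => //; split; first by split=> //; apply: leq_trans h2 (tle i).
    by apply/negP; rewrite -leqNgt.
  have le i : (i < m)%N -> (nth 0 (rows s) i <= nth 0 (rows t) i)%N.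
    move=> im; rewrite leqNgt; apply/negP => lt.
    have ja : (nth 0 (rows t) i < a)%N by apply: leq_trans lt (sle i).
    by case: (cov i _ im ja); [rewrite ltnn|rewrite leqNgt lt].
  rewrite size_rows sm; split=> [i im|i j /andP[ij jm] ti tj e].
    rewrite le //= leqNgt; apply/negP => lt.
    have e : (i, nth 0%N (rows s) i) = (i, (nth 0%N (rows s) i).+1).
      by apply: strip; [apply: mem => //; lia|apply: mem => //; lia|left].
    by case: e; lia.
  have im := ltn_trans ij jm.
  have [e' _] : (i, nth 0%N (rows s) i) = (j, nth 0%N (rows s) j).
    by apply: strip; [apply: mem; rewrite // leqnn ti /=|apply: mem; rewrite // leqnn tj /=|right => /=; apply: succn_inj; rewrite -ti -tj].
  by move: ij; rewrite e' ltnn.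
move/(rook_pairsP szst); rewrite size_rows sm => -[step cols].
have sE i j : (diagram (part_above t) `&` (rect_diagram m a `\` diagram (part_above s))) (i, j) ->
    (i < m)%N /\ (j = nth 0 (rows s) i /\ nth 0 (rows t) i = (nth 0 (rows s) i).+1)%N.
  rewrite /diagram /rect_diagram /= !nth_part_above => -[h1 [[im ja] /negP]].
  by rewrite -leqNgt => h2; split=> //; have := step i im; lia.
split.
- exact: part_above_in_rect.
- exact: part_above_in_rect revm.
- apply/seteqP; split=> [[i j] [|[]//]|[i j] [im ja]]; first exact: part_above_in_rect.
  have [h|h] := ltnP j (nth 0%N (rows s) i).
    by left; rewrite /diagram /= nth_part_above; apply: leq_trans h _; have := step i im; lia.
  by right; split=> //; rewrite /diagram /= nth_part_above; apply/negP; rewrite -leqNgt.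
split.
  exists (part_above t), (part_above s); split.
    move=> [i j] h; have [im _] := part_above_in_rect sm h.
    move: h; rewrite /diagram /= !nth_part_above => h; apply: leq_trans h _.
    by have := step i im; lia.
  apply/seteqP; split=> -[i j]; first by move=> [h1 [_ h2]].
  by move=> [h1 h2]; split=> //; split=> //; apply: part_above_in_rect h1.
move=> [i j] [i' j'] /sE[im [-> ti]] /sE[im' [-> ti']] /= [->//|e].
suff -> : i = i' by [].
have tt : nth 0%N (rows t) i = nth 0%N (rows t) i' by rewrite ti ti' e.
case: (ltngtP i i') => // lt; exfalso.
  by apply: (cols i i') => //; rewrite lt.
by apply: (cols i' i) => //; rewrite lt.
Qed.

End RectSplit.

(** * The coefficients of the coproduct *)

Section FreegSums.
Variable K : choiceType.
Implicit Types (D : {freeg K / int}) (F : K -> int).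

Lemma sum_dom_widenZ (V : lmodType int) D (F : K -> V) r : uniq r -> {subset dom D <= r} ->
  \sum_(x <- dom D) coeff x D *: F x = \sum_(x <- r) coeff x D *: F x.
Proof.
move=> ur sub; rewrite [RHS](bigID (fun x => x \in dom D)) /= [X in _ + X]big1 ?addr0.
  rewrite -[RHS]big_filter; apply: perm_big; apply: uniq_perm.
  - exact: uniq_dom.
  - exact: filter_uniq.
  - by move=> x; rewrite mem_filter; case xD: (x \in dom D) => //=; rewrite sub.
by move=> x xD; rewrite coeff_outdom // scale0r.
Qed.

Lemma sum_dom_widen D F r : uniq r -> {subset dom D <= r} ->
  \sum_(x <- dom D) coeff x D * F x = \sum_(x <- r) coeff x D * F x.
Proof. exact: (@sum_dom_widenZ int^o). Qed.

Lemma coeff_sum_lin I (s : seq I) (c : I -> int) (x : I -> K) y :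
  coeff y (\sum_(i <- s) c i *: << x i >>) = \sum_(i <- s) c i * (x i == y)%:R.
Proof. by rewrite raddf_sum; apply: eq_bigr => i _; rewrite /= coeffZ coeffU mul1r. Qed.

Lemma sum_dom_lin (I : eqType) (s : seq I) (c : I -> int) (x : I -> K) F :
  \sum_(y <- dom (\sum_(i <- s) c i *: << x i >>))
     coeff y (\sum_(i <- s) c i *: << x i >>) * F y = \sum_(i <- s) c i * F (x i).
Proof.
rewrite (@sum_dom_widen _ F (undup [seq x i | i <- s])) ?undup_uniq //; last first.
  move=> y; rewrite mem_undup mem_dom; apply: contraR => ys.
  rewrite coeff_sum_lin big_seq big1 // => i si.
  by case: eqP => [xi|]; rewrite ?mulr0 //; case/negP: ys; rewrite -xi map_f.
under eq_bigr do rewrite coeff_sum_lin mulr_suml.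
rewrite exchange_big /= big_seq [RHS]big_seq; apply: eq_bigr => i si.
rewrite (bigD1_seq (x i)) ?undup_uniq ?mem_undup ?map_f //= eqxx mulr1 big1 ?addr0 // => y yx.
by rewrite eq_sym (negbTE yx) mulr0 mul0r.
Qed.

End FreegSums.

(** Independence of the G is applied once for each set of variables: with fixed exponents u', v' it
    yields [inner], to which it is applied again. *)
Lemma coprod_unique (nu : part) (d : {freeg (part * part)%type}) :
  (forall u u' v v' : monom, G_part nu (interleave u u') (interleave v v') =
    \sum_(lm <- dom d) coeff lm d * (G_part lm.1 u v * G_part lm.2 u' v')) ->
  coprod nu = d.
Proof.
move=> dP; rewrite /coprod; case: xgetP => [e _ /= eP|/(_ d) /= /(_ dP) []].
pose ls := undup [seq p.1 | p <- dom e ++ dom d].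
pose ms := undup [seq p.2 | p <- dom e ++ dom d].
pose r := [seq (l, k) | l <- ls, k <- ms].
have ur : uniq r by apply: allpairs_uniq; rewrite ?undup_uniq // => -[? ?] [? ?].
have sub (f : {freeg (part * part)%type}) : {subset dom f <= dom e ++ dom d} -> {subset dom f <= r}.
  move=> s [l k] /s h; apply: (allpairs_f pair); rewrite mem_undup; apply/mapP.
    by exists (l, k).
  by exists (l, k).
have subs : {subset dom (e - d) <= dom e ++ dom d} by exact: domB.
have rel0 u u' v v' : \sum_(p <- r) coeff p (e - d) * (G_part p.1 u v * G_part p.2 u' v') = 0.
  have := eP u u' v v'; rewrite dP.
  rewrite !(@sum_dom_widen _ _ (fun p : part * part => G_part p.1 u v * G_part p.2 u' v') r) //;
    try by apply: sub => x xd; rewrite mem_cat xd ?orbT.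
  move/eqP; rewrite eq_sym -subr_eq0 -sumrB => /eqP E; rewrite -[RHS]E.
  by apply: eq_bigr => p _; rewrite coeffB mulrBl.
have inner l u' v' : l \in ls -> \sum_(k <- ms) coeff (l, k) (e - d) * G_part k u' v' = 0.
  move=> ll; apply: (@G_part_independent ls
     (fun l => \sum_(k <- ms) coeff (l, k) (e - d) * G_part k u' v')) => //.
    exact: undup_uniq.
  move=> u v; rewrite -[RHS](rel0 u u' v v') big_allpairs; apply: eq_bigr => l' _.
  by rewrite mulr_suml; apply: eq_bigr => k _ /=; rewrite -mulrA [G_part k _ _ * _]mulrC.
apply/eqP; rewrite -subr_eq0 -dom_eq0 -size_eq0 -leqn0 leqNgt; apply/negP.
case E: (dom (e - d)) => [|[l k] w] // _.
have lkd : (l, k) \in dom (e - d) by rewrite E mem_head.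
have := sub _ subs _ lkd => /allpairsP[[l' k'] /= [ll kk [? ?]]]; subst l' k'.
move: lkd; rewrite mem_dom.
rewrite (@G_part_independent ms (fun k => coeff (l, k) (e - d)) (undup_uniq _) _ k kk) ?eqxx //.
by move=> u v; apply: inner.
Qed.

Definition rect_pairs m a : seq ((m + a).-tuple bool * (m + a).-tuple bool) :=
  [seq p : (m + a).-tuple bool * (m + a).-tuple bool
     <- enum {: (m + a).-tuple bool * (m + a).-tuple bool} |
     (count negb p.1 == m) && (count negb p.2 == m)].

Lemma coprod_rect m a : coprod (rect m a) =
  \sum_(p <- rect_pairs m a)
    rook_sign (tval p.1) (tval p.2) *: << (part_above (tval p.2), part_above (rev (tval p.1))) >>.
Proof.
apply: coprod_unique => u u' v v'.
pose T := ((m + a).-tuple bool * (m + a).-tuple bool)%type.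
rewrite (sum_dom_lin _ (fun p : T => rook_sign p.1 p.2) (fun p : T => (part_above p.2, part_above (rev p.1)))
   (fun lm => G_part lm.1 u v * G_part lm.2 u' v')).
by rewrite G_part_rect_interleave pair_big_dep /= big_filter big_enum_cond.
Qed.

Lemma sumn_rows_rev a s : count id s = a ->
  (sumn (rows (rev s)) + sumn (rows s) = count negb s * a)%N.
Proof.
move=> sa; rewrite rows_rev sumn_rev -size_rows sa.
have := rows_bound s; rewrite sa; elim: (rows s) => //= x l IH /andP[xa /IH]; lia.
Qed.

Lemma diagram_in_rect m a (l : part) : diagram l `<=` rect_diagram m a ->
  (size l <= m)%N /\ all (fun x => x <= a)%N l.
Proof.
move=> h; split.
  rewrite leqNgt; apply/negP => ml.
  have := allP (part_pos l) _ (mem_nth 0%N ml) => pos.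
  by have [] := h (m, 0%N) pos; rewrite ltnn.
apply/(all_nthP 0%N) => i il; rewrite leqNgt; apply/negP => lt.
by have [_ /=] := h (i, a) lt; rewrite ltnn.
Qed.

Lemma coprod_rect_coeff m a (sigma tau : part) :
  coeff (sigma, tau) (coprod (rect m a)) =
  if `[< rect_split m a sigma tau >]
  then (-1) ^ ((sumn sigma)%:Z + (sumn tau)%:Z - (m * a)%:Z) else 0.
Proof.
rewrite coprod_rect coeff_sum_lin.
have mem_pairs (p : (m + a).-tuple bool * (m + a).-tuple bool) :
    p \in rect_pairs m a = (count negb p.1 == m) && (count negb p.2 == m).
  by rewrite mem_filter mem_enum andbT.
case: asboolP => [sp|nsp]; last first.
  rewrite big_seq big1 // => -[s t]; rewrite mem_pairs /= => /andP[/eqP sm /eqP tm].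
  case: eqP => [[st tt]|]; rewrite ?mulr0 // mulr1 rook_signE ?size_tuple ?sm ?tm //.
  by case: ifP => // rp; case: nsp; rewrite -st -tt; apply/(rect_splitP sm tm).
have [/diagram_in_rect[ss sa] /diagram_in_rect[ts ta] _ _] := sp.
have [t [tm _ tE]] := path_exists ss sa.
have [s' [s'm _ s'E]] := path_exists ts ta.
pose s : (m + a).-tuple bool := rev_tuple s'.
have sm : count negb s = m by rewrite /= count_rev.
have sE : part_above (rev s) = tau by rewrite /= revK.
have uniq_pairs : uniq (rect_pairs m a) by apply: filter_uniq; apply: enum_uniq.
rewrite (bigD1_seq (s, t)) ?uniq_pairs ?mem_pairs ?sm ?tm ?eqxx //.
rewrite /= -/(tval s) tE sE eqxx mulr1 big_seq_cond big1 ?addr0; last first.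
  move=> -[s1 t1]; rewrite mem_pairs /= => /andP[/andP[/eqP s1m /eqP t1m] ne].
  case: eqP => [[t1E s1E]|]; rewrite ?mulr0 //.
  case/eqP: ne; congr (_, _); last by apply: part_above_inj; rewrite ?t1m ?tm ?t1E.
  apply/val_inj/(inv_inj revK); rewrite /= revK.
  have := @part_above_inj _ (rev_tuple s1) s'; rewrite /= count_rev s1m s'm s1E s'E.
  by move=> /(_ erefl erefl) <-.
rewrite rook_signE ?size_tuple ?sm ?tm //.
have rp : rook_pairs (zip (rows s) (rows t)) by apply/(rect_splitP sm tm); rewrite tE sE.
rewrite rp exprnP; congr (_ ^ _).
(* The rook strip has |t| - |s| boxes, where |t| = |sigma| and |s| = ma - |tau|. *)
have := sumn_rows_rev (count_true sm); rewrite -sumn_part_above sE sm.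
have le := sumn_rook_pairs _ (andP rp).1; rewrite !size_rows sm tm in le.
have {}le := le erefl; rewrite -tE sumn_part_above => e.
by rewrite -subzn // -e !PoszD; ring.
Qed.

(** * Sequences that are partitions *)

Section TruncatedPoly.
Variable R : comNzRingType.
Implicit Types f g : {poly R}.

(** Congruence modulo t^(k+1): in this sense [geom] is inverse to 1 - xt. *)
Definition eq_upto k f g := forall j, (j <= k)%N -> f`_j = g`_j.

Lemma eq_upto_mul k f g f' g' : eq_upto k f f' -> eq_upto k g g' -> eq_upto k (f * g) (f' * g').
Proof.
move=> hf hg j jk; rewrite !coefM; apply: eq_bigr => i _.
by rewrite hf ?hg //; have := ltn_ord i; lia.
Qed.

Lemma eq_upto_prod k I (r : seq I) (P : pred I) (f g : I -> {poly R}) :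
  (forall i, P i -> eq_upto k (f i) (g i)) ->
  eq_upto k (\prod_(i <- r | P i) f i) (\prod_(i <- r | P i) g i).
Proof.
move=> h; elim: r => [|i r IH]; first by rewrite !big_nil.
by rewrite !big_cons; case: ifP => // /h hi; apply: eq_upto_mul.
Qed.

Definition geom (K : nat) (x : R) : {poly R} := \poly_(a < K.+1) x ^+ a.

Lemma eq_upto_geom k K x : (k <= K)%N -> eq_upto k (geom k x) (geom K x).
Proof. by move=> kK j jk; rewrite !coef_poly !ltnS jk (leq_trans jk kK). Qed.

Lemma eq_upto_geom_inv K x : eq_upto K (geom K x * (1 - x *: 'X)) 1.
Proof.
move=> j jK; rewrite mulrBr mulr1 coefB -scalerAr coefZ coefMX !coef_poly !ltnS jK.
rewrite coef1; case: j jK => [|j] jK /=; first by rewrite mulr0 subr0 expr0.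
by rewrite ifT ?exprS ?subrr //; lia.
Qed.

Lemma coef_geom_pow K x i k : (i <= k <= K)%N ->
  ((1 - 'X) ^+ i * geom K x)`_k = x ^+ (k - i) * (x - 1) ^+ i.
Proof.
elim: i k => [|i IH] k /andP[ik kK].
  by rewrite expr0 mul1r subn0 mulr1 coef_poly ltnS kK.
rewrite exprS -mulrA mulrBl mul1r coefB coefXM.
case: k ik kK => // k ik kK; rewrite /= !IH; try lia.
by rewrite subSS subSn // !exprS; ring.
Qed.

End TruncatedPoly.

Section Alternants.
Variable N : nat.
Local Notation Rn := {mpoly int[N]}.

Definition other_factors (p : 'I_N) : {poly Rn} := \prod_(q < N | q != p) (1 - ('X_q : Rn) *: 'X).
(* Multiplying by [elem_mx] cancels the factors 1 / (1 - x_q t) with q != p, which turns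
   the determinant [calG] into an alternant. *)
Definition elem_mx : 'M[Rn]_N := \matrix_(j, p) (other_factors p)`_(N.-1 - j).
Definition alt_mx (l : part) : 'M[Rn]_N :=
  \matrix_(i, p) ('X_p ^+ (nth 0%N l i + N.-1 - i) * ('X_p - 1) ^+ i).

Lemma size_other_factors p : (size (other_factors p) <= N)%N.
Proof.
have h1 (q : 'I_N) : (size (1 - ('X_q : Rn) *: 'X)%R <= 2)%N.
  apply: leq_trans (size_polyD _ _) _; rewrite geq_max size_poly1 /= size_polyN.
  by apply: leq_trans (size_scale_leq _ _) _; rewrite size_polyX.
apply: leq_trans (size_poly_prod_leq _ _) _.
have -> : #|(fun q : 'I_N => q != p)| = N.-1.
  by have := cardC1 p; rewrite card_ord => <-; apply: eq_card.
rewrite leq_subLR; apply: (@leq_trans (N.-1 * 2).+1); last by have := ltn_ord p; lia.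
rewrite ltnS; have <- : #|(fun q : 'I_N => q != p)| = N.-1.
  by have := cardC1 p; rewrite card_ord => <-; apply: eq_card.
by rewrite -sum_nat_const; apply: leq_sum.
Qed.

(** An entry of the product is a convolution, the coefficient of degree l_i + N - 1 in
    [F * other_factors p]; it is complete since [other_factors p] has degree less than N. Modulo
    higher powers that product is (1 - t)^i / (1 - x_p t). *)
Lemma calG_mx_mul (l : part) :
  (\matrix_(i < N, j < N) hcomp N i (nth 0%N l i + j)%:Z) *m elem_mx = alt_mx l.
Proof.
apply/matrixP => i p; rewrite !mxE.
set K := (nth 0%N l i + N.-1)%N.
pose F : {poly Rn} := (1 - 'X) ^+ i * \prod_(q < N) geom K ('X_q : Rn).
have iN := ltn_ord i.
have FE j : (j < N)%N -> hcomp N i (nth 0%N l i + j)%:Z = F`_(nth 0%N l i + j).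
  move=> jN; rewrite /hcomp /F; apply: eq_upto_mul (leqnn _) => //.
  by apply: eq_upto_prod => q _; apply: eq_upto_geom; rewrite /K; lia.
transitivity ((F * other_factors p)`_K).
  rewrite coefM /K.
  have -> : (nth 0%N l i + N.-1).+1 = (nth 0%N l i + N)%N by lia.
  rewrite [RHS]big_split_ord /= [X in _ = X + _]big1 ?add0r; last first.
    move=> j _; rewrite [X in _ * X]nth_default ?mulr0 //.
    by apply: leq_trans (size_other_factors p) _; have := ltn_ord j; lia.
  apply: eq_bigr => j _; rewrite !mxE -[X in X * _]/(hcomp N i (nth 0 l i + j)%N%:Z) FE //; congr (_ * _`_ _).
  by have := ltn_ord j; lia.
have -> : (F * other_factors p)`_K = ((1 - 'X) ^+ i * geom K ('X_p : Rn))`_K.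
  rewrite /F (bigD1 p) //= -!mulrA; apply: eq_upto_mul (leqnn _) => //.
  rewrite -[X in eq_upto _ _ X]mulr1; apply: eq_upto_mul => //.
  rewrite /other_factors -big_split /=.
  move=> k kK; transitivity ((\prod_(q < N | q != p) (1 : {poly Rn}))`_k); last by rewrite big1_eq.
  by apply: eq_upto_prod kK => q _; apply: eq_upto_geom_inv.
by rewrite coef_geom_pow // /K; lia.
Qed.

Lemma mcoeff_prod_horner (g : 'I_N -> {poly int}) (m : 'X_{1..N}) :
  (\prod_(p < N) (map_poly (@mpolyC N int) (g p)).['X_p])@_m = \prod_(p < N) (g p)`_(m p).
Proof.
pose B := (\sum_(p < N) (size (g p) + m p)).+1.
have leB p : (size (g p) + m p < B)%N by rewrite ltnS (bigD1 p) //= leq_addr.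
have hE p : (map_poly (@mpolyC N int) (g p)).['X_p] = \sum_(k < B) ((g p)`_k)%:MP * 'X_p ^+ k.
  rewrite (@horner_coef_wide _ B); last first.
    by apply: leq_trans (size_poly _ _) _; apply: ltnW; apply: leq_ltn_trans (leq_addr _ _) (leB p).
  by apply: eq_bigr => k _; rewrite coef_map.
under eq_bigr do rewrite hE.
rewrite bigA_distr_bigA /= raddf_sum /=.
have mB p : (m p < B)%N by apply: leq_ltn_trans (leq_addl _ _) (leB p).
pose f0 : {ffun 'I_N -> 'I_B} := [ffun p => Ordinal (mB p)].
have fE (f : {ffun 'I_N -> 'I_B}) : (\prod_(p < N) (((g p)`_(f p))%:MP * 'X_p ^+ (f p)))@_m =
    (\prod_(p < N) (g p)`_(f p)) * (f == f0)%:R.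
  rewrite big_split /= -rmorph_prod /= mcoeffCM; congr (_ * _).
  have -> : \prod_(p < N) 'X_p ^+ (f p) = 'X_[ [multinom (f p : nat) | p < N] ] :> Rn.
    by rewrite [RHS]mpolyXE_id; apply: eq_bigr => p _; rewrite mnmE.
  rewrite mcoeffX; congr (nat_of_bool _)%:R; apply/eqP/eqP => [e|->].
    by apply/ffunP => p; apply/val_inj; rewrite ffunE /= -[in RHS]e mnmE.
  by apply/mnmP => p; rewrite mnmE ffunE.
under eq_bigr do rewrite fE.
rewrite (bigD1 f0) //= eqxx mulr1 [X in _ + X]big1 ?addr0; last by move=> f /negbTE ->; rewrite mulr0.
by apply: eq_bigr => p _; rewrite ffunE.
Qed.

Definition alt_coef (b i : nat) : {poly int} := 'X^b * ('X - 1) ^+ i.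

Lemma alt_coef_low b i k : (k < b)%N -> (alt_coef b i)`_k = 0.
Proof. by move=> kb; rewrite /alt_coef coefXnM kb. Qed.

Lemma alt_coef_lead b i : (alt_coef b i)`_b = (-1) ^+ i.
Proof.
by rewrite /alt_coef coefXnM ltnn subnn -horner_coef0 horner_exp hornerD hornerX hornerN hornerC sub0r.
Qed.

Lemma det_alt_coef (l : part) (m : 'X_{1..N}) :
  (\det (alt_mx l))@_m =
  \sum_(s : 'S_N) (-1) ^+ s * \prod_(i < N) (alt_coef (nth 0%N l i + N.-1 - i) i)`_(m (s i)).
Proof.
rewrite /determinant raddf_sum; apply: eq_bigr => s _ /=.
have -> : \prod_(i < N) alt_mx l i (s i) =
    \prod_(p < N) (map_poly (@mpolyC N int) (alt_coef (nth 0%N l (s^-1 p)%g + N.-1 - (s^-1 p)%g) (s^-1 p)%g)).['X_p].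
  rewrite [RHS](reindex_inj (@perm_inj _ s)) /=; apply: eq_bigr => i _.
  by rewrite mxE permK /alt_coef rmorphM !rmorphXn /= rmorphB rmorph1 /= map_polyX !hornerE.
rewrite -[in LHS](rmorph_sign (@mpolyC N int)) mcoeffCM; congr (_ * _).
rewrite mcoeff_prod_horner (reindex_inj (@perm_inj _ s)) /=.
by apply: eq_bigr => i _; rewrite permK.
Qed.

End Alternants.

Lemma leq_sum_eq N (F G : 'I_N -> nat) : (forall i, (F i <= G i)%N) ->
  (\sum_(i < N) G i <= \sum_(i < N) F i)%N -> forall i, F i = G i.
Proof.
move=> le; have := leqif_sum (fun i (_ : xpredT i) => leqif_eq (le i)) => e.
by rewrite (geq_leqif e) => /forall_inP h i; apply/eqP/h.
Qed.

Lemma perm_monotone N (s : 'S_N) : (forall i j : 'I_N, (i < j)%N -> (s i < s j)%N) -> s = 1%g.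
Proof.
move=> mono; have le (i : 'I_N) : (i <= s i)%N.
  case: i => i; elim: i => // i IH iN; have iN' : (i < N)%N by apply: ltnW.
  by apply: leq_ltn_trans (IH iN') _; apply: mono => /=.
apply/permP => i; rewrite perm1; apply/val_inj/esym/(leq_sum_eq le) => /=.
by rewrite [leqRHS](reindex_inj (@perm_inj _ s)).
Qed.

Lemma part_nth_leq (l : part) i j : (i <= j)%N -> (nth 0 l j <= nth 0 l i)%N.
Proof.
move=> ij; have [jl|jl] := ltnP j (size l); last by rewrite nth_default.
have /(pairwiseP 0%N) h := part_pairwise l; case: (ltngtP i j) ij => // [ij _|->//].
by apply: h => //; rewrite inE ?(ltn_trans ij).
Qed.

Lemma sumn_nth N (s : seq nat) : (size s <= N)%N -> sumn s = (\sum_(i < N) nth 0 s i)%N.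
Proof.
move=> sN; rewrite sumnE (big_nth 0%N) big_mkord -(subnKC sN) big_split_ord /=.
by rewrite [X in (_ = _ + X)%N]big1 ?addn0 // => i _; rewrite nth_default // leq_addr.
Qed.

Lemma part_nth_inj (k l : part) : (forall i, nth 0%N k i = nth 0%N l i) -> k = l.
Proof.
have szle (k' l' : part) : (forall i, nth 0%N k' i = nth 0%N l' i) -> (size k' <= size l')%N.
  move=> e; rewrite leqNgt; apply/negP => lt; have := allP (part_pos k') _ (mem_nth 0%N lt).
  by rewrite e nth_default.
move=> e; apply/val_inj/(@eq_from_nth _ 0%N) => //; apply/eqP; rewrite eqn_leq !szle //.
Qed.

Section Independence.
Variable N : nat.

Definition lead_monom (l : part) : 'X_{1..N} := [multinom (nth 0 l p + N.-1 - p)%N | p < N].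

(** A nonzero term needs l_i + N - 1 - i to be at most the exponent of k + rho at s(i), for every i.
    Since |k| <= |l|, summing over i forces equality everywhere; both exponent sequences decrease
    strictly, so s = 1 and l = k. *)
Lemma mcoeff_det_alt (k l : part) :
  (size k <= N)%N -> (size l <= N)%N -> (sumn k <= sumn l)%N ->
  (\det (alt_mx N l))@_(lead_monom k) = if l == k then \prod_(i < N) (-1) ^+ i else 0.
Proof.
move=> kN lN kl; rewrite det_alt_coef.
have term (s : 'S_N) : (forall i : 'I_N, (nth 0 l i + N.-1 - i <= lead_monom k (s i))%N) ->
    l = k /\ s = 1%g.
  move=> le; have eqs : forall i : 'I_N, (nth 0 l i + N.-1 - i = lead_monom k (s i))%N.
    apply: leq_sum_eq => //; have -> : (\sum_(i < N) lead_monom k (s i) = \sum_(i < N) lead_monom k i)%N.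
      by rewrite [RHS](reindex_inj (@perm_inj _ s)).
    have sumE (m : part) : (size m <= N)%N -> (\sum_(i < N) (nth 0 m i + N.-1 - i) = sumn m + \sum_(i < N) (N.-1 - i))%N.
      move=> mN; rewrite (sumn_nth mN) -big_split; apply: eq_bigr => i _ /=.
      by have := ltn_ord i; lia.
    by under eq_bigr do rewrite mnmE; rewrite !sumE // leq_add2r.
  have s1 : s = 1%g.
    apply: perm_monotone => i j ij; rewrite ltnNge; apply/negP => ji.
    have := eqs i; have := eqs j; rewrite !mnmE.
    have := part_nth_leq k ji; have := part_nth_leq l (ltnW ij).
    move: (nth _ _ _) (nth _ _ _) (nth _ _ _) (nth _ _ _) => *.
    have := ltn_ord i; have := ltn_ord j; have := ltn_ord (s i); have := ltn_ord (s j); lia.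
  split=> //; apply: part_nth_inj => i; have [iN|Ni] := ltnP i N; last first.
    by rewrite !nth_default ?(leq_trans kN) ?(leq_trans lN).
  have := eqs (Ordinal iN); rewrite s1 perm1 mnmE /=; lia.
have term0 (s : 'S_N) : l <> k \/ s <> 1%g ->
    \prod_(i < N) (alt_coef (nth 0%N l i + N.-1 - i) i)`_(lead_monom k (s i)) = 0.
  move=> ne; case: (pselect (forall i : 'I_N, (nth 0 l i + N.-1 - i <= lead_monom k (s i))%N)).
    by move=> /term[lk s1]; case: ne.
  move/existsNP => [i /negP]; rewrite -ltnNge => lt.
  by rewrite (bigD1 i) //= alt_coef_low // mul0r.
case: eqP => [lk|lk]; last by apply: big1 => s _; rewrite term0 ?mulr0 //; left.
rewrite (bigD1 1%g) //= odd_perm1 mul1r [X in _ + X]big1 ?addr0.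
  by apply: eq_bigr => i _; rewrite perm1 mnmE lk alt_coef_lead.
by move=> s /eqP s1; rewrite term0 ?mulr0 //; right.
Qed.

(** Triangularity with respect to size: at the monomial of k, partitions at least as large as k and
    different from it contribute nothing, and smaller ones have coefficient 0 by induction. *)
Lemma det_alt_independent (ls : seq part) (c : part -> int) : uniq ls ->
  {in ls, forall l : part, (size l <= N)%N} ->
  \sum_(l <- ls) c l *: \det (alt_mx N l) = 0 -> {in ls, forall l, c l = 0}.
Proof.
move=> uls lsN rel l; have [d] := ubnP (sumn l); elim: d l => // d IH k kd kls.
have /(congr1 (fun p => p@_(lead_monom k))) := rel.
rewrite mcoeff0 raddf_sum (bigD1_seq k) //= big_seq_cond [X in _ + X]big1 ?addr0.
  rewrite mcoeffZ mcoeff_det_alt ?lsN // eqxx // => /eqP.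
  by rewrite mulf_eq0 => /orP[/eqP//|/prodf_eq0[i _]]; rewrite signr_eq0.
move=> l /andP[lls lk]; rewrite mcoeffZ.
have [lt|ge] := ltnP (sumn l) (sumn k); first by rewrite IH ?mul0r //; lia.
by rewrite mcoeff_det_alt ?lsN // (negbTE lk) mulr0.
Qed.

Lemma nth_map_Posz (s : seq nat) i : nth 0 [seq k%:Z | k <- s] i = (nth 0%N s i)%:Z.
Proof.
have [h|h] := ltnP i (size s); first by rewrite (nth_map 0%N).
by rewrite !nth_default ?size_map.
Qed.

Lemma calG_mul_elem (l : part) : calG_part N l * \det (elem_mx N) = \det (alt_mx N l).
Proof.
rewrite -calG_mx_mul det_mulmx; congr (_ * _); rewrite /calG_part /calG; congr (\det _).
by apply/matrixP => i j; rewrite !mxE nth_map_Posz PoszD.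
Qed.

End Independence.

Lemma part_of_seq_size (l : part) (s : seq nat) : part_of_seq l s -> (size l <= size s)%N.
Proof.
move=> ls; rewrite leqNgt; apply/negP => lt.
by have := allP (part_pos l) _ (mem_nth 0%N lt); rewrite ls nth_default.
Qed.

Lemma G_seq_part (l : part) (s : seq nat) : part_of_seq l s ->
  G_seq [seq k%:Z | k <- s] = << l >>.
Proof.
move=> ls; have ll := part_of_seq_size ls.
have calGE N : calG N [seq k%:Z | k <- s] = calG_part N l.
  rewrite /calG_part /calG; congr (\det _).
  by apply/matrixP => i j; rewrite !mxE !nth_map_Posz ls.
rewrite /G_seq; case: xgetP => [c _ cP|/(_ << l >>) []]; last first.
  move=> N; rewrite size_map => sN _; rewrite domU1; split=> [k|].
    by rewrite inE => /eqP ->; apply: leq_trans sN.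
  by rewrite calGE big_seq1 coeffU mul1r eqxx scale1r.
(* One admissible N determines the expansion; N = [size s] satisfies both bounds because the entries
   are non-negative. *)
have [||cN cE] := cP (size s); first by rewrite size_map.
  by move=> i; rewrite size_map nth_map_Posz; lia.
pose ks := undup (l :: dom c).
have uks : uniq ks by exact: undup_uniq.
have ind := @det_alt_independent (size s) ks (fun k => coeff k (c - << l >>)) uks.
have {ind} ind : {in ks, forall k, coeff k (c - << l >>) = 0}.
  apply: ind => [k|]; first by rewrite mem_undup inE => /orP[/eqP ->//|/cN].
  under eq_bigr do rewrite -calG_mul_elem scalerAl.
  rewrite -mulr_suml; apply/eqP; rewrite mulf_eq0; apply/orP; left; apply/eqP.
  have lks : l \in ks by rewrite mem_undup mem_head.
  under eq_bigr do rewrite coeffB scalerBl coeffU mul1r.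
  rewrite sumrB -(sum_dom_widenZ (fun k => calG_part (size s) k)) -?cE ?calGE //; last first.
    by move=> k kc; rewrite mem_undup inE kc orbT.
  rewrite (bigD1_seq l) //= eqxx scale1r big1 ?addr0 ?subrr // => k /negbTE kl.
  by rewrite eq_sym kl scale0r.
apply/eqP; rewrite -subr_eq0; apply/freeg_eqP => k; rewrite coeff0.
have [/ind//|] := boolP (k \in ks); rewrite mem_undup inE negb_or => /andP[kl kc].
by rewrite coeffB coeff_outdom // coeffU eq_sym (negbTE kl) mulr0 subr0.
Qed.

(** * Rank conditions *)

(** The kernel of the second map meets the image of the first in at most the whole kernel. Thus
    R_(i,i+2) has at most as many rows as R_(i,i+1) and at most as many columns as R_(i+1,i+2). *)
Lemma rank_sylvester K n r i : can_occur K n r -> (i.+2 <= n)%N ->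
  (r i i.+1 + r i.+1 i.+2 <= r i i.+2 + r i.+1 i.+1)%N.
Proof.
move=> [V [f [dimV rkf]]] le.
have rk1 j : (j.+1 <= n)%N -> \dim (limg (f j)) = r j j.+1.
  by move=> jn; have := rkf j 1%N isT jn; rewrite /= comp_lfun1r.
have rk2 : \dim (limg (f i.+1 \o f i)%VF) = r i i.+2.
  by have := rkf i 2%N isT le; rewrite /= comp_lfun1r.
rewrite -!rk1 ?(ltnW le) // -rk2 -dimV ?(ltnW le) //.
rewrite limg_comp.
have := limg_ker_dim (f i.+1) fullv; have := limg_ker_dim (f i.+1) (limg (f i)).
rewrite capfv; have := dimvS (capvSr (limg (f i)) (lker (f i.+1))).
lia.
Qed.

(** The default is never taken for weakly decreasing s, the only case in which it is evaluated. *)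
Definition seq_part (s : seq nat) : part := insubd part0 [seq x <- s | 0 < x]%N.

Lemma seq_partE s : pairwise geq s -> seq_part s = [seq x <- s | 0 < x]%N :> seq nat.
Proof.
move=> ps; rewrite /seq_part val_insubd ifT // /is_part filter_all andbT.
apply: sorted_filter; last exact: pairwise_sorted.
by move=> u v w /= h1 h2; apply: leq_trans h2 h1.
Qed.

Lemma part_of_seq_part s : pairwise geq s -> part_of_seq (seq_part s) s.
Proof.
move=> ps k; rewrite seq_partE //; elim: s ps k => //= -[|x] s IH /andP[/allP h /IH {}IH] [|k] //=.
  have -> : [seq x <- s | 0 < x]%N = [::] by apply/eqP; rewrite -[_ == _]negbK -has_filter; apply/hasPn => y /h; rewrite /= leqn0 -leqNgt => /eqP ->.
  by [].
have -> : [seq x <- s | 0 < x]%N = [::] by apply/eqP; rewrite -[_ == _]negbK -has_filter; apply/hasPn => y /h; rewrite /= leqn0 -leqNgt => /eqP ->.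
rewrite nth_nil; have [ks|ks] := ltnP k (size s); last by rewrite nth_default.
by have := h _ (mem_nth 0%N ks); rewrite /= leqn0 => /eqP.
Qed.

Lemma part_of_seq_inj (k l : part) s : part_of_seq k s -> part_of_seq l s -> k = l.
Proof. by move=> ks ls; apply: part_nth_inj => i; rewrite ks ls. Qed.

Lemma part_of_seq_sumn (l : part) s : part_of_seq l s -> sumn l = sumn s.
Proof.
move=> ls; rewrite (sumn_nth (part_of_seq_size ls)) (sumn_nth (leqnn _)).
by apply: eq_bigr => i _; rewrite ls.
Qed.

Lemma tensor_basis n (mu : n.-tuple part) : tensor (fun i => << tnth mu i >>) = << mu >>.
Proof.
rewrite /tensor -(@fsbig_widen _ _ _ _ [set mu]) //.
  by rewrite fsbig_set1 big1 ?scale1r // => i _; rewrite coeffU eqxx mulr1.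
move=> nu [_ /= ne]; have [i ni] : exists i, tnth nu i <> tnth mu i.
  by apply/existsNP => h; apply: ne; apply: eq_from_tnth.
by rewrite (bigD1 i) //= coeffU mul1r eq_sym; move/eqP/negbTE: ni => ->; rewrite mul0r scale0r.
Qed.

Lemma factor_seq_rect r (s t : seq part) i :
  nth part0 s i = part0 -> nth part0 (part0 :: t) i = part0 ->
  part_of_seq (rect (nrows r i i.+1) (ncols r i i.+1)) (factor_seq r s t i).
Proof.
move=> si ti k; rewrite /factor_seq si ti cats0 /= nth_nseq.
have [km|mk] := ltnP k (nrows r i i.+1).
  by rewrite nth_mkseq // nth_nil addn0; case: eqP => [->|]; rewrite ?km // if_same.
by rewrite nth_default ?size_mkseq //; case: ifP => // h; case: ifP h; rewrite ?ltn0 // ltnNge mk.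
Qed.

Lemma rect_part0 m a : m = 0%N \/ a = 0%N -> rect m a = part0.
Proof. by move=> [] ->; apply: val_inj => //=; rewrite if_same. Qed.

Lemma sumn_rect m a : sumn (rect m a) = (m * a)%N.
Proof. by rewrite sumn_nseq mulnC; case: eqP => [->|//]; rewrite !muln0. Qed.

(** * One step of the recursion, applied to a single tensor of rectangles *)

Section Step.
Variables (n : nat) (r : nat -> nat -> nat) (b c : nat -> nat).
Hypothesis b_le : forall i, (i < n.+1)%N -> (b i <= nrows r i i.+1)%N.
Hypothesis c_le : forall i, (i < n.+1)%N -> (c i <= ncols r i.+1 i.+2)%N.
Local Notation T := (n.+1.-tuple part).

Definition split_pairs : set (T * T) :=
  [set st | forall i : 'I_n.+1, rect_split (b i) (c i) (tnth st.1 i) (tnth st.2 i)].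

Definition factor_tuple (st : T * T) : n.+2.-tuple part :=
  [tuple seq_part (factor_seq r st.1 st.2 i) | i < n.+2].

(** Only the junction of the two pieces is at stake: the parts of tau are at most c, and [c_le]
    bounds c by the width of the rectangle to which sigma is added. *)
Lemma factor_tupleP st (i : 'I_n.+2) : split_pairs st ->
  part_of_seq (tnth (factor_tuple st) i) (factor_seq r st.1 st.2 i).
Proof.
case: st => s t sp; rewrite tnth_mktuple; apply: part_of_seq_part => /=.
rewrite /factor_seq pairwise_cat part_pairwise andbT; apply/andP; split.
  apply/allrelP => x y /mapP[k _ ->] yt /=; apply: leq_trans (leq_addr _ _).
  case: i yt => -[|i] //= iN yt; have := sp (Ordinal (iN : (i < n.+1)%N)) => -[_ /diagram_in_rect[_ /allP ta] _ _].
  apply: leq_trans (c_le (iN : (i < n.+1)%N)); apply: ta.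
  by rewrite (tnth_nth part0).
apply/(pairwiseP 0%N) => k l; rewrite !inE size_mkseq => km lm kl.
by rewrite !nth_mkseq //= leq_add2l; apply: part_nth_leq; apply: ltnW.
Qed.

(** Cutting each sequence after the rows of its rectangle recovers both pieces; by [b_le] no part of
    sigma is lost. So the sum over mu counts every pair once. *)
Lemma factor_tuple_inj : {in split_pairs &, injective factor_tuple}.
Proof.
move=> [s t] [s' t']; rewrite !inE => sp sp' e.
have eqn (i : 'I_n.+2) k : nth 0%N (factor_seq r s t i) k = nth 0%N (factor_seq r s' t' i) k.
  by rewrite -(factor_tupleP i sp) e (factor_tupleP i sp').
have {}eqn i k : (i < n.+2)%N -> nth 0%N (factor_seq r s t i) k = nth 0%N (factor_seq r s' t' i) k.
  by move=> iN; apply: (eqn (Ordinal iN)).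
congr (_, _); apply: eq_from_tnth => -[i iN].
  rewrite !(tnth_nth part0) /=; apply: part_nth_inj => k.
  have [/= /diagram_in_rect[sb _] _ _ _] := sp (Ordinal iN).
  have [/= /diagram_in_rect[sb' _] _ _ _] := sp' (Ordinal iN).
  have [km|mk] := ltnP k (nrows r i i.+1).
    have := eqn i k (ltnW iN); rewrite /factor_seq !nth_cat !size_mkseq km !nth_mkseq //.
    exact: addnI.
  have mb := leq_trans (b_le iN) mk.
  rewrite !(tnth_nth part0) /= in sb sb'.
  by rewrite ?[nth 0%N _ k]nth_default ?(leq_trans sb mb) ?(leq_trans sb' mb).
rewrite !(tnth_nth part0) /=; apply: part_nth_inj => k.
have := eqn i.+1 (nrows r i.+1 i.+2 + k)%N iN.
by rewrite /factor_seq !nth_cat !size_mkseq ltnNge leq_addr /= addKn.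
Qed.

Lemma sumn_factor_tuple st : split_pairs st ->
  (\sum_(i < n.+2) sumn (tnth (factor_tuple st) i) =
   \sum_(i < n.+2) ncols r i i.+1 * nrows r i i.+1 +
   \sum_(i < n.+1) (sumn (tnth st.1 i) + sumn (tnth st.2 i)))%N.
Proof.
case: st => s t sp /=.
have E (i : 'I_n.+2) : sumn (tnth (factor_tuple (s, t)) i) =
    (ncols r i i.+1 * nrows r i i.+1 + (sumn (nth part0 s i) + sumn (nth part0 (part0 :: t) i)))%N.
  rewrite (part_of_seq_sumn (factor_tupleP i sp)) /factor_seq sumn_cat addnA; congr (_ + _)%N.
  have sm : (size (nth part0 s i) <= nrows r i i.+1)%N.
    have [iN|Ni] := ltnP i n.+1; last by rewrite [nth _ _ _]nth_default // size_tuple.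
    have [/= /diagram_in_rect[sb _] _ _ _] := sp (Ordinal iN).
    by apply: leq_trans (b_le iN); rewrite (tnth_nth part0) in sb.
  rewrite (sumn_nth sm) (@sumn_nth (nrows r i i.+1)) ?size_mkseq //.
  under eq_bigr => k _ do rewrite nth_mkseq //.
  by rewrite big_split sum_nat_const card_ord mulnC.
under eq_bigr do rewrite E; rewrite !big_split /=; congr (_ + (_ + _))%N.
  rewrite big_ord_recr /= [nth _ _ n.+1]nth_default ?size_tuple // addn0.
  by apply: eq_bigr => i _; rewrite (tnth_nth part0).
rewrite big_ord_recl /= add0n; apply: eq_bigr => i _.
by rewrite (tnth_nth part0).
Qed.

(** The sizes b, c are left general for two uses: zero when everything beyond the neighbouring
    rectangles is empty, and the sizes of R_(i,i+2) in the theorem. *)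
Lemma quiverP_step :
  quiverP n (rbar r) = << [tuple rect (b i) (c i) | i < n.+1] >> ->
  quiverP n.+1 r =
  \sum_(mu \in [set mu : n.+2.-tuple part | exists s t : T,
      split_pairs (s, t) /\ forall i, part_of_seq (tnth mu i) (factor_seq r s t i)])
    ((-1) ^ ((\sum_(i < n.+2) sumn (tnth mu i))%:Z
       - (\sum_(i < n.+2) ncols r i i.+1 * nrows r i i.+1 +
          \sum_(i < n.+1) b i * c i)%N%:Z) : int) *: << mu >>.
Proof.
move=> IH; rewrite [LHS]/= IH domU1 big_seq1 coeffU eqxx mulr1 scale1r.
(* Pairs violating the splitting condition have a vanishing coproduct coefficient; those satisfying
   it obey the row bound of the recursion by [b_le]. *)
rewrite -(@fsbig_widen _ _ _ _ split_pairs); first last.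
- move=> [s t] [_ /= nsp].
  have [i ni] : exists i : 'I_n.+1, ~ rect_split (b i) (c i) (tnth s i) (tnth t i) by apply/existsNP.
  rewrite (bigD1 i) //= tnth_mktuple coprod_rect_coeff.
  by case: asboolP => // _; rewrite mul0r scale0r.
- move=> [s t] sp i /=; have [/diagram_in_rect[sb _] _ _ _] := sp i.
  by apply: leq_trans sb (b_le (ltn_ord i)).
pose G (mu : n.+2.-tuple part) := ((-1) ^ ((\sum_(i < n.+2) sumn (tnth mu i))%:Z
       - (\sum_(i < n.+2) ncols r i i.+1 * nrows r i i.+1 +
          \sum_(i < n.+1) b i * c i)%N%:Z) : int) *: << mu >> : Gamma_tensor n.+2.
rewrite (@eq_fsbigr _ _ _ _ _ (G \o factor_tuple)); last first.
  move=> [s t]; rewrite inE => sp; rewrite /G /= sumn_factor_tuple //; congr (_ *: _).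
    have E (i : 'I_n.+1) : coeff (tnth s i, tnth t i) (coprod (tnth [tuple rect (b i) (c i) | i < n.+1] i)) =
        (-1) ^ ((sumn (tnth s i) + sumn (tnth t i))%N%:Z - (b i * c i)%N%:Z).
      by rewrite tnth_mktuple coprod_rect_coeff PoszD; case: asboolP => // -[]; apply: sp.
    under eq_bigr do rewrite E.
    rewrite -(big_morph (exprz (-1 : int)) (exprzDr (unitrN1 _)) (expr0z _)).
    congr (_ ^ _); rewrite sumrB -!(big_morph Posz PoszD erefl) !PoszD.
    by ring.
  rewrite -tensor_basis; congr tensor; apply/funext => i.
  by apply: G_seq_part; apply: (factor_tupleP i sp).
apply/esym/(@reindex_fsbig _ _ _ _ _ factor_tuple split_pairs _ G).
split=> [st sp|st st'|mu [s [t [sp muP]]]].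
- by exists st.1, st.2; split; [case: st sp|move=> i; apply: factor_tupleP].
- by move=> *; apply: factor_tuple_inj.
exists (s, t) => //; apply: eq_from_tnth => i.
exact: part_of_seq_inj (factor_tupleP i sp) (muP i).
Qed.

End Step.

Lemma quiverP_near n r :
  (forall i j, (i.+1 < j)%N -> (j <= n.+1)%N -> rect_empty r i j) ->
  quiverP n r = << [tuple rect (nrows r i i.+1) (ncols r i i.+1) | i < n.+1] >>.
Proof.
elim: n r => [|n IH] r near.
  by congr << _ >>; apply: eq_from_tnth => i; rewrite ord1 tnth_mktuple.
rewrite (@quiverP_step n r (fun=> 0%N) (fun=> 0%N)) //; last first.
  rewrite IH => [|i j ij jn].
    congr << _ >>; apply: eq_from_tnth => i; rewrite !tnth_mktuple [RHS]rect_part0; last by left.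
    by apply: rect_part0; apply: (near i i.+2); rewrite // ltnS ltn_ord.
  have := near i j.+1 (ltnW ij) jn; rewrite /rect_empty /nrows /ncols /rbar.
  by case: j ij jn.
(* In a 0 x 0 rectangle sigma and tau must be empty, so a single mu remains, with exponent 0. *)
rewrite (_ : mkset _ = [set [tuple rect (nrows r i i.+1) (ncols r i i.+1) | i < n.+2]]).
  rewrite fsbig_set1 [X in _ ^ X](_ : _ = 0) ?expr0z ?scale1r //.
  apply/eqP; rewrite subr_eq0 eqz_nat [X in (_ + X)%N]big1 // addn0; apply/eqP.
  by apply: eq_bigr => i _; rewrite tnth_mktuple sumn_rect mulnC.
have empty (l : part) : diagram l `<=` rect_diagram 0 0 -> l = part0.
  by move=> /diagram_in_rect[+ _]; rewrite leqn0 size_eq0 => /eqP l0; apply: val_inj.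
apply/seteqP; split=> [mu [s [t [sp muP]]]|_ ->].
  apply: eq_from_tnth => i; apply: part_of_seq_inj (muP i) _; rewrite tnth_mktuple.
  apply: factor_seq_rect.
    have [iN|Ni] := ltnP i n.+1; last by rewrite nth_default // size_tuple.
    by have [/empty + _ _ _] := sp (Ordinal iN); rewrite (tnth_nth part0).
  case: i => -[|i] //= iN.
  by have [_ /empty + _ _] := sp (Ordinal (iN : (i < n.+1)%N)); rewrite (tnth_nth part0).
have nth0 k : nth part0 [tuple part0 | _ < n.+1] k = part0.
  have [kn|nk] := ltnP k n.+1; last by rewrite nth_default // size_tuple.
  by rewrite -(tnth_nth part0 _ (Ordinal kn)) tnth_mktuple.
exists [tuple part0 | _ < n.+1], [tuple part0 | _ < n.+1]; split=> i.
  rewrite !tnth_mktuple; split.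
  - by case=> ? ?; rewrite /diagram /= nth_nil.
  - by case=> ? ?; rewrite /diagram /= nth_nil.
  - apply/seteqP; split=> -[? ?]; rewrite /rotated /rect_diagram /diagram /= ?nth_nil; last by case.
    by case=> // -[[]].
  split; last by case=> ? ? ?; rewrite /rotated /rect_diagram /diagram /= nth_nil => -[].
  exists part0, part0; split=> //; apply/seteqP; split=> -[? ?]; rewrite /rotated /rect_diagram /diagram /= nth_nil; by case.
rewrite tnth_mktuple; apply: factor_seq_rect.
  exact: nth0.
by case: i => -[|i] iN //; apply: nth0.
Qed.

Lemma expected_codim_near n r :
  (forall i j, (i + 2 < j)%N -> (j <= n.+1)%N -> rect_empty r i j) ->
  expected_codim n.+1 r = (\sum_(i < n.+1) ncols r i i.+1 * nrows r i i.+1 +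
                           \sum_(i < n) nrows r i i.+2 * ncols r i i.+2)%N.
Proof.
move=> far; rewrite /expected_codim.
pose f i j := (ncols r i j * nrows r i j)%N.
have tail i j : (i + 2 < j)%N -> (\sum_(j <= k < n.+2) f i k)%N = 0%N.
  move=> ij; rewrite big_nat big1 // => k /andP[jk kn].
  by have [h|h] := far i k (leq_trans ij jk) kn; rewrite /f h ?muln0.
have inner i : (\sum_(j < n.+2 | i < j) f i j = \sum_(i.+1 <= j < n.+2) f i j)%N.
  by rewrite big_geq_mkord.
under eq_bigr => i _ do rewrite inner.
rewrite big_ord_recr /= [X in (_ + X)%N]big_geq // addn0.
rewrite big_ord_recr [in RHS]big_ord_recr /= (@big_ltn _ _ _ n.+1) // (@big_geq _ _ _ n.+2) // addn0.
rewrite addnAC -big_split; congr (_ + _)%N; apply: eq_bigr => i _ /=.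
have iN : (i.+2 < n.+2)%N by rewrite !ltnS ltn_ord.
rewrite (big_ltn (ltnW iN)) (big_ltn iN) tail ?addn0; last by rewrite addn2.
by rewrite /f [X in (_ + X)%N]mulnC.
Qed.

Theorem corollary4p3 (K : fieldType) (n : nat) (r : nat -> nat -> nat)
    (r_occurs : can_occur K n.+1 r)
    (far_empty : forall i j : nat, (i + 2 < j)%N -> (j <= n.+1)%N ->
       rect_empty r i j) :
  quiverP n r =
  \sum_(mu \in [set mu : n.+1.-tuple part |
          exists sigma tau : n.-tuple part,
            (forall i : 'I_n,
               let m := nrows r i i.+2 in
               let a := ncols r i i.+2 in
               let s := diagram (tnth sigma i) in
               let t := rotated m a (tnth tau i) in
               [/\ s `<=` rect_diagram m a,
                   diagram (tnth tau i) `<=` rect_diagram m a,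
                   s `|` t = rect_diagram m a &
                   rook_strip (s `&` t)]) /\
            (forall i : 'I_n.+1,
               part_of_seq (tnth mu i) (factor_seq r sigma tau i))])
    ((-1) ^ ((\sum_(i < n.+1) sumn (tnth mu i))%:Z
             - (expected_codim n.+1 r)%:Z) : int) *: << mu >>.
Proof.
rewrite (expected_codim_near far_empty).
case: n r_occurs far_empty => [|n] r_occurs far_empty.
  rewrite quiverP_near; last by case=> [|i] [|[|j]].
  rewrite (_ : mkset _ = [set [tuple rect (nrows r i i.+1) (ncols r i i.+1) | i < 1]]).
    rewrite fsbig_set1 big_ord0 addn0 [X in _ ^ X](_ : _ = 0) ?expr0z ?scale1r //.
    by rewrite !big_ord1 tnth_mktuple sumn_rect mulnC subrr.
  apply/seteqP; split=> [mu [s [t [_ muP]]]|_ ->].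
    apply: eq_from_tnth => i; apply: part_of_seq_inj (muP i) _; rewrite tnth_mktuple ord1.
    by apply: factor_seq_rect; rewrite /= ?nth_default ?size_tuple.
  exists [tuple], [tuple]; split=> [[]//|i].
  by rewrite tnth_mktuple ord1; apply: factor_seq_rect.
(* The two bounds on these sizes are the two readings of Sylvester's inequality. *)
apply: (@quiverP_step n r (fun i => nrows r i i.+2) (fun i => ncols r i i.+2)) => [i iN|i iN|].
- by have := rank_sylvester r_occurs iN; rewrite /nrows; lia.
- by have := rank_sylvester r_occurs iN; rewrite /ncols /=; lia.
rewrite quiverP_near => [|i j ij jn].
  by congr << _ >>; apply: eq_from_tnth => i; rewrite !tnth_mktuple.
(* The rectangle (i, j) of the shifted conditions is the rectangle (i, j + 1) of r, so emptiness
   beyond distance 2 becomes emptiness beyond distance 1. *)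
have := far_empty i j.+1; rewrite addn2 !ltnS => /(_ ij jn); rewrite /rect_empty /nrows /ncols /rbar.
by case: j ij jn.
Qed.
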